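(* Let $r\in\mathbb{N}$, let $\xi_1,\ldots,\xi_r\in\mathbb{C}$ be roots of unity and $\gamma_1,\ldots,\gamma_r\in\mathbb{C}$ with $\Re\gamma_j>0$ $(1\leqslant j\leqslant r)$. Assume that $\xi_j\neq 1$ for all $j$ $(1\leqslant j\leqslant r)$. Then $\zeta_r((s_j);(\xi_j);(\gamma_j))$ can be analytically continued to $\mathbb{C}^r$ as an entire function in $(s_j)=(s_1,\ldots,s_r)$. Moreover, for $n_1,\ldots,n_r\in\mathbb{N}_0$, $$\zeta_r((-n_j);(\xi_j);(\gamma_j))=(-1)^{r+n_1+\cdots+n_r}\,\mathfrak{B}((n_j);(\xi_j^{-1});(\gamma_j)).$$
   Context: $\mathbb{N}=\{1,2,\dots\}$, $\mathbb{N}_0=\mathbb{N}\cup\{0\}$. The multiple zeta-function of the generalized Euler-Zagier-Lerch type is $$\zeta_r((s_j);(\xi_j);(\gamma_j))=\sum_{m_1=1}^\infty\cdots\sum_{m_r=1}^\infty\prod_{j=1}^r\xi_j^{m_j}(m_1\gamma_1+\cdots+m_j\gamma_j)^{-s_j}$$ (principal branch of the powers), which converges absolutely in the region $\mathcal{D}_r=\{(s_1,\ldots,s_r)\in\mathbb{C}^r\mid \Re(s_{r-k+1}+\cdots+s_r)>k\ (1\leqslant k\leqslant r)\}$. For roots of unity $\xi_j\neq1$ and $\gamma_j\in\mathbb{C}$, the twisted multiple Bernoulli numbers $\mathfrak{B}((n_j);(\xi_j);(\gamma_j))=\mathfrak{B}(n_1,\ldots,n_r;(\xi_j);(\gamma_j))$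 are defined by the expansion at the origin $$\prod_{j=1}^r\frac{1}{1-\xi_j\exp\left(\gamma_j\sum_{k=j}^rt_k\right)}=\sum_{n_1=0}^\infty\cdots\sum_{n_r=0}^\infty\mathfrak{B}(n_1,\ldots,n_r;(\xi_j);(\gamma_j))\frac{t_1^{n_1}}{n_1!}\cdots\frac{t_r^{n_r}}{n_r!}.$$ *)

(* Defs.v *)
From HB Require Import structures.
From mathcomp Require Import all_boot all_order all_algebra.
From mathcomp Require Import all_classical all_reals all_analysis.
From mathcomp.analysis.showcase Require summability.
From mathcomp.real_closed Require Import complex.

Set Implicit Arguments.
Unset Strict Implicit.
Unset Printing Implicit Defensive.

Import Order.TTheory GRing.Theory Num.Theory.
Import numFieldNormedType.Exports.
Local Open Scope classical_set_scope.
Local Open Scope ring_scope.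

(* C as a normed space over itself, with its usual topology. *)
HB.instance Definition _ (R : realType) := NormedModule.copy R[i] (R[i])^o.

Definition cexp {R : realType} (z : R[i]) : R[i] :=
  Complex (expR (complex.Re z) * cos (complex.Im z))
          (expR (complex.Re z) * sin (complex.Im z)).

(* Principal argument, with values in ]-pi, pi] for z != 0. *)
Definition carg {R : realType} (z : R[i]) : R :=
  let a := acos (complex.Re z / ComplexField.Normc.normc z) in
  if 0 <= complex.Im z then a else - a.

Definition clog {R : realType} (z : R[i]) : R[i] :=
  Complex (ln (ComplexField.Normc.normc z)) (carg z).

Definition cpow {R : realType} (z s : R[i]) : R[i] := cexp (s * clog z).

Definition is_root_of_unity {R : realType} (z : R[i]) : Prop :=
  exists2 n : nat, (0 < n)%N & n.-unity_root z.

(* Fréchet differentiability with a C-linear differential at every point of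
   C^r, since the scalar field of both normed modules is R[i]. *)
Definition entire {R : realType} (r : nat) (F : 'rV[R[i]]_r -> R[i]) :
    Prop :=
  forall s, differentiable F s.

(* Multiple series over N_0^r are unordered sums: limits of the finite partial
   sums along the filter of finite sets of indices. In C, convergence along
   this filter is absolute convergence of the series. *)

(* The j-th summation variable, which ranges over {1, 2, ...}, is (m j).+1. *)
Definition zeta_term {R : realType} (r : nat) (xi gamma : 'I_r -> R[i])
    (s : 'rV[R[i]]_r) (m : {ffun 'I_r -> nat}) : R[i] :=
  \prod_(j < r) (xi j ^+ (m j).+1 *
    cpow (\sum_(k < r | (k <= j)%N) (m k).+1%:R * gamma k) (- s 0 j)).

Definition zeta {R : realType} (r : nat) (xi gamma : 'I_r -> R[i])
    (s : 'rV[R[i]]_r) : R[i] :=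
  summability.sum (zeta_term xi gamma s).

(* With indices starting from 0, s_{r-k+1} + ... + s_r is the sum of the s_j
   with r - k <= j < r. *)
Definition zeta_domain {R : realType} (r : nat) : set 'rV[R[i]]_r :=
  [set s | forall k : nat, (1 <= k <= r)%N ->
     k%:R < complex.Re (\sum_(j < r | (r - k <= j)%N) s 0 j)].

Definition bernoulli_gen {R : realType} (r : nat) (xi gamma : 'I_r -> R[i])
    (t : 'rV[R[i]]_r) : R[i] :=
  \prod_(j < r)
    (1 / (1 - xi j * cexp (gamma j * \sum_(k < r | (j <= k)%N) t 0 k))).

Definition bernoulli_term {R : realType} (r : nat)
    (B : {ffun 'I_r -> nat} -> R[i]) (t : 'rV[R[i]]_r)
    (n : {ffun 'I_r -> nat}) : R[i] :=
  B n * \prod_(j < r) (t 0 j ^+ n j / (n j)`!%:R).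

(* B is the family of coefficients of the expansion of the generating function
   at the origin: the multiple power series converges absolutely to it on a
   neighbourhood of 0. *)
Definition bernoulli_expansion {R : realType} (r : nat)
    (xi gamma : 'I_r -> R[i]) (B : {ffun 'I_r -> nat} -> R[i]) : Prop :=
  \forall t \near (0 : 'rV[R[i]]_r),
    summability.partial_sum (bernoulli_term B t) @ summability.totally
      --> bernoulli_gen xi gamma t.

(* The family satisfying bernoulli_expansion; it exists when xi j != 1 for all
   j, and it is unique by uniqueness of power series coefficients. *)
Definition twisted_bernoulli {R : realType} (r : nat)
    (xi gamma : 'I_r -> R[i]) : {ffun 'I_r -> nat} -> R[i] :=
  get (bernoulli_expansion xi gamma).

(* Main.v *)
(* The series is continued by iterated Abel summation. For [xi <> 1],
     \sum_m xi^m g(A + m gamma) = \sum_(k < N) xi^k / (1 - xi)^(k+1) Delta^k g(A)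
        + (xi / (1 - xi))^N \sum_m xi^m Delta^N g(A + m gamma),
   where Delta is the difference in direction gamma, and the right hand side makes
   sense once the N-th differences decay fast enough. On a cone containing the
   gamma_j, the powers a^(-s) are symbols: each difference gains a factor
   1 / (1 + Re a). Symbols are stable under products and twisted summation, so the
   sums over m_r, ..., m_1 can be performed one after the other for every s. The
   remainder of the first order expansion in s is a symbol of size O(|h|^2), and
   remains so after summation: the continuation is differentiable.

   At s = -n the summands are polynomials, and the Abel series over k is finite.
   For the generating function in t, the polynomials (a + gamma)^n / n! add up to
   exponentials exp(a T), on which Delta acts as exp(gamma T) - 1, and the Abel
   series becomes geometric with sum 1 / (1 - xi exp(gamma T)). Since
   xi w / (1 - xi w) = - 1 / (1 - (xi w)^-1), the result is the generating function
   of the Bernoulli numbers for xi^-1 at -t, up to the sign (-1)^r, and the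
   coefficients of a convergent multiple power series are unique. *)

Require Import Defs.
From HB Require Import structures.
From mathcomp Require Import all_boot all_order all_algebra.
From mathcomp Require Import finmap.
From mathcomp Require Import all_classical all_reals all_analysis.
From mathcomp.real_closed Require Import complex.
From mathcomp Require Import ring lra.
From mathcomp.analysis.showcase Require summability.
Import Order.TTheory GRing.Theory Num.Theory.
Import numFieldNormedType.Exports.
Set Implicit Arguments.
Unset Strict Implicit.
Unset Printing Implicit Defensive.
Local Open Scope classical_set_scope.
Local Open Scope ring_scope.

(** The classes of symbols are defined by finite differences rather than derivatives because every
    [fdiff u] commutes with twisted summation: stability under summation then needs no
    differentiation under a sum. All bounds live on a sector that contains 0 and the gamma_j. Outer
    variables reach the inner sums only through an offset in that sector, so the continuation, its
    expansion in s, the convergent series and the values at -n all follow the same recursion on r.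
    Two kinds of decay occur. With [inv_weight], a symbol of order k has summable differences of
    order k + 2. At s = -n the degree is unbounded, and no power of the weight is uniform in n.
    There the decay is an arbitrarily small constant, set against an exponential weight; the price,
    a geometric growth in n, is absorbed by taking t small. *)

Notation cn := (ComplexField.Normc.normc).
Notation re := complex.Re.
Notation im := complex.Im.

(** * Complex norms *)

Section ComplexNorm.
Context {R : realType}.
Implicit Types z w : R[i].

Lemma cn_ge0 z : 0 <= cn z.
Proof. by case: z => a b; rewrite /= sqrtr_ge0. Qed.

Lemma normE z : `|z| = (cn z)%:C%C.
Proof. by case: z. Qed.

Lemma cn0 : cn (0 : R[i]) = 0. Proof. exact: ComplexField.Normc.normc0. Qed.
Lemma cn1 : cn (1 : R[i]) = 1. Proof. exact: ComplexField.Normc.normc1. Qed.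
Lemma cnM z w : cn (z * w) = cn z * cn w.
Proof. exact: ComplexField.Normc.normcM. Qed.
Lemma cnV z : cn (z^-1) = (cn z)^-1.
Proof. exact: ComplexField.Normc.normcV. Qed.
Lemma cnN z : cn (- z) = cn z. Proof. exact: normcN. Qed.
Lemma cnD z w : cn (z + w) <= cn z + cn w. Proof. exact: le_normcD. Qed.
Lemma cnB z w : cn (z - w) <= cn z + cn w.
Proof. by rewrite -(cnN w) cnD. Qed.
Lemma cnBC z w : cn (z - w) = cn (w - z).
Proof. by rewrite -cnN opprB. Qed.
Lemma cnX z n : cn (z ^+ n) = cn z ^+ n.
Proof. by elim: n => [|n IH]; rewrite ?expr0 ?cn1 // !exprS cnM IH. Qed.
Lemma cn_eq0 z : (cn z == 0) = (z == 0).
Proof.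
apply/eqP/eqP => [|->]; last exact: cn0.
exact: ComplexField.Normc.eq0_normc.
Qed.
Lemma cn_gt0 z : (0 < cn z) = (z != 0).
Proof. by rewrite lt_neqAle cn_ge0 andbT eq_sym cn_eq0. Qed.
Lemma cn_real (x : R) : cn x%:C%C = `|x|.
Proof. by rewrite /= expr0n /= addr0 sqrtr_sqr. Qed.
Lemma cn_sum (I : Type) (s : seq I) (P : pred I) (f : I -> R[i]) :
  cn (\sum_(i <- s | P i) f i) <= \sum_(i <- s | P i) cn (f i).
Proof.
elim/big_ind2 : _ => [|x1 x2 y1 y2 h1 h2|//]; first by rewrite cn0.
by apply: (le_trans (cnD _ _)); rewrite lerD.
Qed.
Lemma re_le_cn z : `|re z| <= cn z.
Proof.
case: z => a b /=; rewrite -(sqrtr_sqr a) ler_wsqrtr // lerDl; exact: sqr_ge0.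
Qed.
Lemma im_le_cn z : `|im z| <= cn z.
Proof.
case: z => a b /=; rewrite -(sqrtr_sqr b) ler_wsqrtr // lerDr; exact: sqr_ge0.
Qed.
Lemma re_cn z : re z <= cn z.
Proof. exact: le_trans (ler_norm _) (re_le_cn z). Qed.
Lemma reD z w : re (z + w) = re z + re w. Proof. by case: z; case: w. Qed.
Lemma imD z w : im (z + w) = im z + im w. Proof. by case: z; case: w. Qed.
Lemma reM z w : re (z * w) = re z * re w - im z * im w.
Proof. by case: z; case: w. Qed.
Lemma imM z w : im (z * w) = re z * im w + im z * re w.
Proof. by case: z => a b; case: w => c d /=; rewrite addrC. Qed.
Lemma reN z : re (- z) = - re z. Proof. by case: z. Qed.
Lemma imN z : im (- z) = - im z. Proof. by case: z. Qed.
Lemma re_sum (I : Type) (s : seq I) (P : pred I) (f : I -> R[i]) :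
  re (\sum_(i <- s | P i) f i) = \sum_(i <- s | P i) re (f i).
Proof. by elim/big_ind2 : _ => // x1 x2 y1 y2 <- <-; rewrite reD. Qed.
Lemma cn_le_reim z : cn z <= `|re z| + `|im z|.
Proof.
have -> : z = (re z)%:C%C + (Complex 0 1) * (im z)%:C%C by rewrite [LHS]complexE.
apply: (le_trans (cnD _ _)).
rewrite cnM !cn_real /= expr0n /= add0r expr1n sqrtr1 mul1r !mul0r !mul1r.
by rewrite !(mulr0,subr0,addr0,add0r).
Qed.
Lemma natr_complex (n : nat) : (n%:R : R[i]) = (n%:R)%:C%C.
Proof. by rewrite rmorph_nat. Qed.
Lemma cnMn (n : nat) : cn (n%:R : R[i]) = n%:R.
Proof. by rewrite natr_complex cn_real ger0_norm. Qed.
Lemma reMr (x : R) z : re (x%:C%C * z) = x * re z.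
Proof. by case: z => a b /=; rewrite mul0r subr0. Qed.
End ComplexNorm.

(** * Unordered sums *)

Section HasSum.
Context {R : realType}.
Implicit Types I J : choiceType.
Local Open Scope fset_scope.
Local Open Scope ring_scope.

#[local] Existing Instance summability.totally_filter.

(** Convergence along finite index sets with a real epsilon, so that estimates take place in the
    ordered field [R] and not in the partially ordered [R[i]]; [has_sumP] relates it to the
    filter. *)
Definition has_sum I (x : I -> R[i]) (l : R[i]) := forall e : R, 0 < e ->
  exists A0 : {fset I}, forall A : {fset I}, A0 `<=` A ->
    cn (\sum_(i <- A) x i - l) < e.

(** The bound is a parameter because it also bounds the sum ([has_sum_le]), and the recursions below
    need it explicitly. *)
Definition asummable I (x : I -> R[i]) (M : R) := forall A : {fset I},
  \sum_(i <- A) cn (x i) <= M.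

Lemma partial_sumE I (x : I -> R[i]) (A : {fset I}) :
  summability.partial_sum x A = \sum_(i <- A) x i.
Proof. by rewrite /summability.partial_sum big_seq_fsetE. Qed.

Lemma has_sumP I (x : I -> R[i]) l :
  has_sum x l <-> summability.partial_sum x @ summability.totally --> l.
Proof.
split=> [h|h].
- apply/cvgrPdist_lt => e e0.
  have [er ei] : 0 < re e /\ e = (re e)%:C%C.
    by move: e0; rewrite ltcE /= => /andP[/eqP i0 r0]; case: e i0 r0 => a b /= ->.
  have [A0 hA] := h _ er.
  exists A0 => // A /= /hA; rewrite -partial_sumE => hl.
  by rewrite -normrN opprB normE ei ltcR.
- move=> e e0; have e0' : 0 < e%:C%C :> R[i] by rewrite ltcR.
  move/cvgrPdist_lt : h => /(_ _ e0') [A0 _ hA].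
  exists A0 => A /hA /=; rewrite partial_sumE -normrN opprB normE ltcR //.
Qed.

Lemma has_sum_uniq I (x : I -> R[i]) l l' : has_sum x l -> has_sum x l' -> l = l'.
Proof.
move=> h h'; apply/eqP; rewrite -subr_eq0 -cn_eq0; apply/eqP/le_anti.
rewrite cn_ge0 andbT; apply/ler_addgt0Pr => e e0; rewrite add0r.
have e2 : 0 < e / 2 by rewrite divr_gt0.
have [A hA] := h _ e2; have [A' hA'] := h' _ e2.
have := hA (A `|` A') (fsubsetUl _ _); have := hA' (A `|` A') (fsubsetUr _ _).
set S := \sum_(i <- _) _ => h1 h2.
have -> : l - l' = (S - l') - (S - l) by ring.
by apply: (le_trans (cnB _ _)); lra.
Qed.

Lemma has_sumD I (x y : I -> R[i]) l l' : has_sum x l -> has_sum y l' ->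
  has_sum (fun i => x i + y i) (l + l').
Proof.
move=> h h' e e0; have e2 : 0 < e / 2 by rewrite divr_gt0.
have [A hA] := h _ e2; have [A' hA'] := h' _ e2.
exists (A `|` A') => B; rewrite fsubUset => /andP[/hA h1 /hA' h2].
rewrite big_split /= opprD addrACA; apply: (le_lt_trans (cnD _ _)); lra.
Qed.

Lemma has_sumZ I (x : I -> R[i]) l c : has_sum x l ->
  has_sum (fun i => c * x i) (c * l).
Proof.
move=> h e e0; have c1 : 0 < cn c + 1 by rewrite ltr_wpDl // cn_ge0.
have [A hA] := h _ (divr_gt0 e0 c1); exists A => B /hA.
rewrite ltr_pdivlMr // => h1; rewrite -mulr_sumr -mulrBr cnM.
apply: le_lt_trans h1; rewrite mulrC ler_wpM2l ?cn_ge0 // lerDl //.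
Qed.

Lemma has_sumN I (x : I -> R[i]) l : has_sum x l ->
  has_sum (fun i => - x i) (- l).
Proof. by move=> /(has_sumZ (-1)); rewrite mulN1r; under eq_fun do rewrite mulN1r. Qed.

Lemma has_sumB I (x y : I -> R[i]) l l' : has_sum x l -> has_sum y l' ->
  has_sum (fun i => x i - y i) (l - l').
Proof. by move=> h /has_sumN; exact: has_sumD. Qed.

Lemma has_sum0 I : has_sum (fun _ : I => 0) 0.
Proof. by move=> e e0; exists fset0 => A _; rewrite big1 // subr0 cn0. Qed.

Lemma has_sum_bigsum I (T : Type) (s : seq T) (x : T -> I -> R[i]) l :
  (forall k, has_sum (x k) (l k)) ->
  has_sum (fun i => \sum_(k <- s) x k i) (\sum_(k <- s) l k).
Proof.
move=> h; elim: s => [|k s IH].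
  under eq_fun do rewrite big_nil.
  by rewrite big_nil; exact: has_sum0.
under eq_fun do rewrite big_cons.
by rewrite big_cons; exact: has_sumD.
Qed.

Lemma has_sum_le I (x : I -> R[i]) l M : asummable x M -> has_sum x l -> cn l <= M.
Proof.
move=> a h; apply/ler_addgt0Pr => e e0; have [A /(_ A (fsubset_refl _)) hA] := h _ e0.
set S := \sum_(i <- _) _ in hA.
have -> : l = S - (S - l) by ring.
apply: (le_trans (cnB _ _)); apply: lerD; last exact: ltW.
exact: le_trans (cn_sum _ _ _) (a A).
Qed.

Lemma asummable_ge0 I (x : I -> R[i]) M : asummable x M -> 0 <= M.
Proof. by move=> /(_ fset0); rewrite big_nil. Qed.

Lemma asummable_le I (x y : I -> R[i]) M : (forall i, cn (x i) <= cn (y i)) ->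
  asummable y M -> asummable x M.
Proof. by move=> h a A; apply: le_trans (a A); apply: ler_sum. Qed.

Lemma asummable_weaken I (x : I -> R[i]) M M' : M <= M' -> asummable x M -> asummable x M'.
Proof. by move=> h a A; apply: le_trans (a A) h. Qed.

Lemma asummableZ I (x : I -> R[i]) M c : asummable x M -> asummable (fun i => c * x i) (cn c * M).
Proof.
move=> a A; under eq_bigr do rewrite cnM.
by rewrite -mulr_sumr ler_wpM2l // cn_ge0.
Qed.

Lemma asummableD I (x y : I -> R[i]) M M' : asummable x M -> asummable y M' ->
  asummable (fun i => x i + y i) (M + M').
Proof.
move=> a a' A; apply: le_trans (lerD (a A) (a' A)); rewrite -big_split /=.
by apply: ler_sum => i _; exact: cnD.
Qed.

Lemma fsub_sum_le I (x : I -> R) (A B : {fset I}) : (forall i, 0 <= x i) ->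
  A `<=` B -> \sum_(i <- A) x i <= \sum_(i <- B) x i.
Proof.
move=> x0 AB; rewrite (big_fsetID _ (mem A) B) /=.
have -> : [fset i in B | i \in A] = A.
  apply/fsetP => i; rewrite !inE /= andbC.
  by case: (boolP (i \in A)) => //= /(fsubsetP AB) ->.
by rewrite lerDl sumr_ge0.
Qed.

Lemma nonneg_has_sum I (y : I -> R) M : (forall i, 0 <= y i) ->
  asummable (fun i => (y i)%:C%C) M -> exists l : R, has_sum (fun i => (y i)%:C%C) l%:C%C.
Proof.
move=> y0 a; have yS A : \sum_(i <- A) cn (y i)%:C%C = \sum_(i <- A) y i.
  by apply: eq_bigr => i _; rewrite cn_real ger0_norm.
pose S := [set \sum_(i <- A) y i | A in [set: {fset I}]].
have hS : has_sup S.
  split; first by exists (\sum_(i <- fset0) y i); exists fset0.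
  by exists M => _ [A _ <-]; rewrite -yS.
exists (sup S) => e e0.
have [_ [A _ <-] hA] := sup_adherent e0 hS.
exists A => B AB.
have -> : \sum_(i <- B) (y i)%:C%C - (sup S)%:C%C = (\sum_(i <- B) y i - sup S)%:C%C.
  by rewrite rmorphB rmorph_sum.
rewrite cn_real.
have h1 : \sum_(i <- B) y i <= sup S by apply: sup_upper_bound => //; exists B.
have h2 := fsub_sum_le y0 AB.
rewrite ler0_norm ?subr_le0 //; lra.
Qed.

Lemma asummable_has_sum I (x : I -> R[i]) M : asummable x M -> exists l, has_sum x l.
Proof.
move=> a.
have key (f : R[i] -> R) : (forall z, `|f z| <= cn z) ->
    exists l, has_sum (fun i => (f (x i))%:C%C) l.
  move=> hf.
  (* A real family dominated by [cn (x i)] is the difference of two nonnegative ones, [f + |f|] and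
     [|f|], whose sums are suprema. *)
  have [l1 h1] : exists l : R, has_sum (fun i => (f (x i) + `|f (x i)|)%:C%C) l%:C%C.
    apply: (@nonneg_has_sum _ _ (2 * M)) => [i|].
      by have := ler_norm (- f (x i)); rewrite normrN; lra.
    move=> A; apply: (@le_trans _ _ (2 * \sum_(i <- A) cn (x i))).
      rewrite mulr_sumr; apply: ler_sum => i _; rewrite cn_real.
      by apply: (le_trans (ler_normD _ _)); rewrite normr_id; have := hf (x i); lra.
    by rewrite ler_wpM2l.
  have [l2 h2] : exists l : R, has_sum (fun i => (`|f (x i)|)%:C%C) l%:C%C.
    apply: (@nonneg_has_sum _ _ M) => // A; apply: le_trans (a A).
    by apply: ler_sum => i _; rewrite cn_real normr_id.
  exists (l1%:C%C - l2%:C%C); have := has_sumB h1 h2.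
  by congr has_sum; apply/funext => i; apply/eqP; rewrite eq_complex /= subr0 addrK !eqxx.
have [l1 h1] := key (@complex.Re R) re_le_cn; have [l2 h2] := key (@complex.Im R) im_le_cn.
exists (l1 + Complex 0 1 * l2); have := has_sumD h1 (has_sumZ (Complex 0 1) h2).
by congr has_sum; apply/funext => i; rewrite [RHS]complexE.
Qed.

Lemma has_sum_bij I J (f : J -> I) (g : I -> J) (x : I -> R[i]) l :
  cancel f g -> cancel g f -> has_sum x l -> has_sum (x \o f) l.
Proof.
move=> fK gK h e e0; have [A hA] := h _ e0.
exists [fset g i | i in A] => B AB.
have := hA [fset f j | j in B].
rewrite big_imfset /=; last by move=> i j _ _; exact: (can_inj fK).
apply; apply/fsubsetP => i iA; apply/imfsetP; exists (g i) => //=.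
by apply: (fsubsetP AB); apply/imfsetP; exists i.
Qed.

Lemma asummable_bij I J (f : J -> I) (x : I -> R[i]) M :
  injective f -> asummable x M -> asummable (x \o f) M.
Proof.
move=> fI a A; have := a [fset f j | j in A].
by rewrite big_imfset //= => i j _ _; exact: fI.
Qed.

Lemma sum_fsetX I J (A : {fset I}) (B : {fset J}) (V : zmodType) (x : I * J -> V) :
  \sum_(p <- A `*` B) x p = \sum_(i <- A) \sum_(j <- B) x (i, j).
Proof.
rewrite -big_allpairs.
apply: perm_big; apply: uniq_perm; first exact: fset_uniq.
  by rewrite allpairs_uniq ?fset_uniq // => -[? ?] [? ?] _ _ [-> ->].
move=> [i j]; rewrite in_fsetM /=; apply/idP/idP.
  by move=> /andP[iA jB]; apply/allpairsP; exists (i, j).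
by move=> /allpairsP[[i' j'] [/= ? ? [-> ->]]]; apply/andP.
Qed.

Lemma asummable_sig I J (x : I * J -> R[i]) (B : I -> R) M :
  (forall i, asummable (fun j => x (i, j)) (B i)) ->
  asummable (fun i => (B i)%:C%C) M -> asummable x M.
Proof.
move=> h hB A.
pose A1 := [fset p.1 | p in A]; pose A2 := [fset p.2 | p in A].
have sub : A `<=` A1 `*` A2.
  apply/fsubsetP => p pA; rewrite in_fsetM; apply/andP.
  by split; apply/imfsetP; exists p.
apply: (le_trans (fsub_sum_le _ sub)) => [i|]; first exact: cn_ge0.
rewrite sum_fsetX; apply: le_trans (hB A1); apply: ler_sum => i _.
apply: (le_trans (h i A2)); rewrite cn_real; exact: ler_norm.
Qed.

Lemma asummable_row I J (x : I * J -> R[i]) M i : asummable x M ->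
  asummable (fun j => x (i, j)) M.
Proof. by apply: asummable_bij => j j' []. Qed.

Lemma has_sum_swap I J (x : I * J -> R[i]) l :
  has_sum x l -> has_sum (fun p => x (p.2, p.1)) l.
Proof.
by apply: (@has_sum_bij _ _ (fun p => (p.2, p.1)) (fun p => (p.2, p.1))) => -[].
Qed.

(** Compare both sides with a finite rectangle: it contains the finite set that controls the double
    sum, and its second side is large enough for the finitely many rows in its first side. *)
Lemma has_sum_fubini I J (x : I * J -> R[i]) (b : I -> R[i]) l :
  has_sum x l -> (forall i, has_sum (fun j => x (i, j)) (b i)) -> has_sum b l.
Proof.
move=> h hb e e0; have e2 : 0 < e / 2 by rewrite divr_gt0.
have [P0 hP] := h _ e2.
exists [fset p.1 | p in P0] => A PA.
have hA : has_sum (fun j => \sum_(i <- A) x (i, j)) (\sum_(i <- A) b i).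
  exact: has_sum_bigsum.
have [B0 hB] := hA _ e2.
pose B := B0 `|` [fset p.2 | p in P0].
have := hB B (fsubsetUl _ _); have := hP (A `*` B).
rewrite sum_fsetX exchange_big /=; set S := \sum_(j <- _) _ => h1 h2.
have -> : \sum_(i <- A) b i - l = (S - l) - (S - \sum_(i <- A) b i) by ring.
apply: (le_lt_trans (cnB _ _)).
have : cn (S - l) < e / 2; last by lra.
apply: h1; apply/fsubsetP => p pP; rewrite in_fsetM inE.
apply/andP; split; first by apply: (fsubsetP PA); apply/imfsetP; exists p.
by apply/orP; right; apply/imfsetP; exists p.
Qed.

Lemma has_sum_seq (x : nat -> R[i]) l : has_sum x l -> forall e : R, 0 < e ->
  exists n0, forall n, (n0 <= n)%N -> cn (\sum_(i < n) x i - l) < e.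
Proof.
move=> h e e0; have [A hA] := h _ e0.
exists (\max_(i <- A) i.+1)%N => n le_n.
have := hA [fset i in iota 0 n].
rewrite -(big_mkord xpredT x) /index_iota subn0.
rewrite (perm_big (iota 0 n)); last first.
  apply: uniq_perm; [exact: fset_uniq|exact: iota_uniq|by move=> i; rewrite !inE].
apply; apply/fsubsetP => i iA; rewrite !inE mem_iota /= add0n.
by apply: leq_trans le_n; rewrite (bigD1_seq i) //= leq_max leqnn.
Qed.

(** Absolute summability already provides an unordered sum; the ordinary partial sums only identify
    its value. *)
Lemma seq_has_sum (x : nat -> R[i]) M l : asummable x M -> (forall e : R, 0 < e ->
  exists n0, forall n, (n0 <= n)%N -> cn (\sum_(i < n) x i - l) < e) -> has_sum x l.
Proof.
move=> a h; have [l' h'] := asummable_has_sum a.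
suff -> : l = l' by [].
apply/eqP; rewrite -subr_eq0 -cn_eq0; apply/eqP/le_anti.
rewrite cn_ge0 andbT; apply/ler_addgt0Pr => e e0; rewrite add0r.
have e2 : 0 < e / 2 by rewrite divr_gt0.
have [n1 h1] := h _ e2; have [n2 h2] := has_sum_seq h' e2.
have := h1 _ (leq_maxl n1 n2); have := h2 _ (leq_maxr n1 n2).
set S := \sum_(i < _) _ => k1 k2.
have -> : l - l' = (S - l') - (S - l) by ring.
by apply: (le_trans (cnB _ _)); lra.
Qed.

Lemma asummable_nat (x : nat -> R[i]) M :
  (forall n, \sum_(i < n) cn (x i) <= M) -> asummable x M.
Proof.
move=> h A; pose n := (\max_(i <- A) i.+1)%N; apply: le_trans (h n).
rewrite -(big_mkord xpredT (fun i => cn (x i))) /index_iota subn0.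
have -> : \sum_(i <- iota 0 n) cn (x i) = \sum_(i <- [fset i in iota 0 n]) cn (x i).
  apply: perm_big; apply: uniq_perm; [exact: iota_uniq|exact: fset_uniq|].
  by move=> i; rewrite !inE.
apply: fsub_sum_le => [i|]; first exact: cn_ge0.
apply/fsubsetP => i iA; rewrite !inE mem_iota /= add0n.
by rewrite /n (bigD1_seq i) //= leq_max leqnn.
Qed.

Lemma has_sum_shift (x : nat -> R[i]) M l : asummable x M ->
  has_sum (fun n => x n.+1) l -> has_sum x (x 0%N + l).
Proof.
move=> a h; apply: (seq_has_sum a) => e e0.
have [n0 hn] := has_sum_seq h e0; exists n0.+1 => -[//|n] /hn.
rewrite big_ord_recl /=; congr (_ < _); congr cn.
by rewrite opprD addrACA subrr add0r.
Qed.

Lemma has_sum_finite (x : nat -> R[i]) d :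
  (forall i, (d <= i)%N -> x i = 0) -> has_sum x (\sum_(i < d) x i).
Proof.
move=> h.
have hs (y : nat -> R[i]) n : (forall i, (d <= i)%N -> y i = 0) -> (d <= n)%N ->
    \sum_(i < n) y i = \sum_(i < d) y i.
  move=> hy dn; rewrite -!(big_mkord xpredT y) (big_cat_nat (leq0n d) dn) /=.
  rewrite [X in _ + X = _](_ : _ = 0) ?addr0 // big_nat_cond.
  by apply: big1 => i /andP[/andP[/hy ->]].
apply: (@seq_has_sum _ (\sum_(i < d) cn (x i))) => [|e e0].
  apply: asummable_nat => n; pose m := maxn n d.
  apply: (@le_trans _ _ (\sum_(i < m) cn (x i))).
    rewrite -!(big_mkord xpredT (fun i => cn (x i))).
    rewrite (big_cat_nat (leq0n n) (leq_maxl n d)) /= lerDl sumr_ge0 // => i _.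
    exact: cn_ge0.
  rewrite -!(big_mkord xpredT (fun i => cn (x i))).
  rewrite (big_cat_nat (leq0n d) (leq_maxr n d)) /=.
  rewrite [X in _ + X <= _](_ : _ = 0) ?addr0 // big_nat_cond.
  by apply: big1 => i /andP[/andP[/h -> _]] _; rewrite cn0.
by exists d => n dn; rewrite hs // subrr cn0.
Qed.

Lemma asummable_mul I J (x : I -> R[i]) (y : J -> R[i]) M M' : asummable x M -> asummable y M' ->
  asummable (fun p => x p.1 * y p.2) (M * M').
Proof.
move=> a a'; apply: (asummable_sig (B := fun i => cn (x i) * M')) => [i|A].
  exact: (asummableZ (x i) a').
under eq_bigr do rewrite cn_real ger0_norm ?mulr_ge0 ?cn_ge0 ?(asummable_ge0 a') //.
by rewrite -mulr_suml ler_wpM2r // (asummable_ge0 a').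
Qed.

Lemma has_sum_mul I J (x : I -> R[i]) (y : J -> R[i]) M M' l l' :
  asummable x M -> asummable y M' -> has_sum x l -> has_sum y l' ->
  has_sum (fun p => x p.1 * y p.2) (l * l').
Proof.
move=> a a' h h'; have [L hL] := asummable_has_sum (asummable_mul a a').
suff -> : l * l' = L by [].
have := has_sum_fubini hL (fun i => has_sumZ (x i) h').
move=> k; apply: has_sum_uniq k.
by under eq_fun do rewrite mulrC; rewrite mulrC; exact: has_sumZ.
Qed.

Lemma sum_geo_le (q : R) n : 0 <= q -> q < 1 -> \sum_(i < n) q ^+ i <= (1 - q)^-1.
Proof.
move=> q0 q1; have hq : 0 < 1 - q by rewrite subr_gt0.
rewrite -div1r ler_pdivlMr //; have := subrX1 q n => h.
have : (\sum_(i < n) q ^+ i) * (1 - q) = 1 - q ^+ n by lra.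
by move=> ->; rewrite gerBl exprn_ge0.
Qed.

Lemma asummable_geo (q : R[i]) : cn q < 1 -> asummable (fun k => q ^+ k) (1 - cn q)^-1.
Proof.
move=> q1; apply: asummable_nat => n; under eq_bigr do rewrite cnX.
by apply: sum_geo_le => //; exact: cn_ge0.
Qed.

(** The sum l exists by absolute summability and satisfies l = 1 + q l. *)
Lemma has_sum_geo (q : R[i]) : cn q < 1 -> has_sum (fun k => q ^+ k) (1 - q)^-1.
Proof.
move=> q1; have [l hl] := asummable_has_sum (asummable_geo q1).
suff -> : (1 - q)^-1 = l by [].
have q1' : 1 - q != 0.
  by apply/eqP => /subr0_eq h; move: q1; rewrite -h cn1 ltxx.
have h1 : has_sum (fun k => q ^+ k.+1) (q * l).
  by under eq_fun do rewrite exprS; exact: has_sumZ.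
have := has_sum_uniq hl (has_sum_shift (asummable_geo q1) h1).
rewrite expr0 => e; apply: (mulfI q1'); rewrite mulfV // mulrBl mul1r {1}e; ring.
Qed.
End HasSum.

(** * Paths in the complex plane, exponential and logarithm *)

Section RealPath.
Context {R : realType}.
Implicit Types (f g : R -> R[i]) (t : R) (z : R[i]).

(** Derivative of a path in the complex plane, by real and imaginary parts: calculus along segments
    is thereby reduced to real derivatives and the real mean value theorem. *)
Definition cder f t (d : R[i]) :=
  is_derive t 1 (fun x => re (f x)) (re d) /\ is_derive t 1 (fun x => im (f x)) (im d).

Lemma is_derive_ext (h k : R -> R) t (d d' : R) : h =1 k -> d = d' ->
  is_derive t 1 h d -> is_derive t 1 k d'.
Proof. by move=> /funext <- <-. Qed.

Lemma cder_eq f t d d' : cder f t d -> d = d' -> cder f t d'.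
Proof. by move=> h <-. Qed.

Lemma cder_ext f g t d : f =1 g -> cder f t d -> cder g t d.
Proof. by move=> /funext <-. Qed.

Lemma cder_cst z t : cder (fun _ => z) t 0.
Proof. by split; exact: is_derive_cst. Qed.

Lemma cderD f g t d e : cder f t d -> cder g t e -> cder (fun x => f x + g x) t (d + e).
Proof.
move=> [f1 f2] [g1 g2]; split.
  by apply: is_derive_ext (is_deriveD f1 g1) => [x|]; rewrite reD.
by apply: is_derive_ext (is_deriveD f2 g2) => [x|]; rewrite imD.
Qed.

Lemma cderN f t d : cder f t d -> cder (fun x => - f x) t (- d).
Proof.
move=> [f1 f2]; split.
  by apply: is_derive_ext (is_deriveN f1) => [x|]; rewrite reN.
by apply: is_derive_ext (is_deriveN f2) => [x|]; rewrite imN.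
Qed.

Lemma cderB f g t d e : cder f t d -> cder g t e -> cder (fun x => f x - g x) t (d - e).
Proof. by move=> hf hg; exact: cderD hf (cderN hg). Qed.

Lemma cderM f g t d e : cder f t d -> cder g t e ->
  cder (fun x => f x * g x) t (d * g t + f t * e).
Proof.
move=> [f1 f2] [g1 g2]; split.
  apply: is_derive_ext (is_deriveB (is_deriveM f1 g1) (is_deriveM f2 g2)) => [x|].
    by rewrite reM.
  by rewrite reD !reM /GRing.scale /=; ring.
apply: is_derive_ext (is_deriveD (is_deriveM f1 g2) (is_deriveM f2 g1)) => [x|].
  by rewrite imM.
by rewrite imD !imM /GRing.scale /=; ring.
Qed.

Lemma cderZ z f t d : cder f t d -> cder (fun x => z * f x) t (z * d).
Proof.
move=> h; apply: cder_eq (cderM (cder_cst z t) h) _.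
by rewrite mul0r add0r.
Qed.

Lemma cder_line z w t : cder (fun x => z + x%:C%C * w) t w.
Proof.
have hid : cder (fun x => x%:C%C) t 1.
  split; first exact: is_derive_id.
  exact: is_derive_cst.
apply: cder_eq (cderD (cder_cst z t) (cderM hid (cder_cst w t))) _.
by rewrite mulr0 addr0 add0r mul1r.
Qed.

Lemma cder_exp f t d : cder f t d -> cder (fun x => cexp (f x)) t (cexp (f t) * d).
Proof.
move=> [f1 f2].
have he : is_derive t 1 (fun x => expR (re (f x))) (expR (re (f t)) * re d).
  exact: (@is_derive1_comp _ expR (fun x => re (f x)) t _ _ (is_derive_expR _) f1).
have hc : is_derive t 1 (fun x => cos (im (f x))) (- sin (im (f t)) * im d).
  exact: (@is_derive1_comp _ cos (fun x => im (f x)) t _ _ (is_derive_cos _) f2).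
have hs : is_derive t 1 (fun x => sin (im (f x))) (cos (im (f t)) * im d).
  exact: (@is_derive1_comp _ sin (fun x => im (f x)) t _ _ (is_derive_sin _) f2).
split.
  apply: is_derive_ext (is_deriveM he hc) => [x //|].
  by rewrite reM /GRing.scale /=; ring.
apply: is_derive_ext (is_deriveM he hs) => [x //|].
by rewrite imM /GRing.scale /=; ring.
Qed.

Lemma cexp0 : cexp (0 : R[i]) = 1.
Proof. by rewrite /cexp /= expR0 cos0 sin0 mulr1 mulr0. Qed.

Lemma cexpD z w : cexp (z + w) = cexp z * cexp w.
Proof.
case: z => a b; case: w => c d; apply/eqP; rewrite eq_complex /= expRD cosD sinD.
by apply/andP; split; apply/eqP; ring.
Qed.

Lemma cn_cexp z : cn (cexp z) = expR (re z).
Proof.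
rewrite /cexp /= !exprMn -mulrDr cos2Dsin2 mulr1 sqrtr_sqr.
by rewrite ger0_norm // expR_ge0.
Qed.

Lemma cexp_neq0 z : cexp z != 0.
Proof. by rewrite -cn_gt0 cn_cexp expR_gt0. Qed.

Lemma cexpN z : cexp (- z) = (cexp z)^-1.
Proof.
by apply: (mulIf (cexp_neq0 z)); rewrite mulVf ?cexp_neq0 // -cexpD addNr cexp0.
Qed.

Lemma cexpMn n z : cexp (n%:R * z) = cexp z ^+ n.
Proof.
elim: n => [|n IH]; first by rewrite mul0r cexp0.
by rewrite -addn1 natrD mulrDl mul1r cexpD IH addn1 exprSr.
Qed.

Lemma cexp_clog z : z != 0 -> cexp (clog z) = z.
Proof.
rewrite -cn_gt0 => z0; rewrite /cexp /clog /= lnK; last by rewrite posrE.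
have [a b] : `|re z| <= cn z /\ `|im z| <= cn z by rewrite re_le_cn im_le_cn.
have rr : -1 <= re z / cn z <= 1.
  by rewrite ler_pdivlMr // ler_pdivrMr // mulN1r mul1r -ler_norml.
have nz : cn z ^+ 2 = re z ^+ 2 + im z ^+ 2.
  by case: (z) => x y /=; rewrite sqr_sqrtr // addr_ge0 // sqr_ge0.
have cz : cn z != 0 by rewrite gt_eqF.
have sq : Num.sqrt (1 - (re z / cn z) ^+ 2) = `|im z| / cn z.
  have -> : 1 - (re z / cn z) ^+ 2 = (im z / cn z) ^+ 2.
    rewrite !exprMn exprVn; apply: (mulIf (expf_neq0 2 cz)).
    by rewrite mulrBl !mulfVK ?expf_neq0 // nz; ring.
  by rewrite sqrtr_sqr normrM normfV (ger0_norm (ltW z0)).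
have eC : cos (carg z) = re z / cn z.
  by rewrite /carg; case: ifP => _; rewrite ?cosN acosK // in_itv.
have eS : sin (carg z) = im z / cn z.
  rewrite /carg; case: ifP => h; rewrite ?sinN sin_acos // sq.
    by rewrite ger0_norm.
  by rewrite ler0_norm ?mulNr ?opprK // ltW // ltNge h.
by rewrite eC eS; case: (z) cz => x y cz; rewrite ![_ * (_ / _)]mulrC !mulfVK.
Qed.

(** [acos] is not differentiable at 1, its argument on the positive real axis. The arctangent
    formula, valid on the right half plane, is what gets differentiated. *)
Lemma carg_atan z : 0 < re z -> carg z = atan (im z / re z).
Proof.
move=> x0; have z0 : z != 0 by apply/eqP => h; move: x0; rewrite h ltxx.
have cz : 0 < cn z by rewrite cn_gt0.
have nz : cn z ^+ 2 = re z ^+ 2 + im z ^+ 2.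
  by case: (z) => x y /=; rewrite sqr_sqrtr // addr_ge0 // sqr_ge0.
set q := im z / re z.
have cq : cos (atan q) = re z / cn z.
  rewrite cos_atan.
  have -> : 1 + q ^+ 2 = (cn z / re z) ^+ 2.
    rewrite !exprMn exprVn nz /q; field; exact: lt0r_neq0.
  by rewrite sqrtr_sqr normrM normfV !ger0_norm ?invf_div // ltW.
rewrite /carg -cq.
have h1 := atan_gtNpi2 q; have h2 := atan_ltpi2 q; have h3 := pi_gt0 R.
have q0 : (0 <= im z) = (0 <= q) by rewrite /q pmulr_lge0 // invr_gt0.
rewrite q0; case: ifP => hq.
  rewrite cosK // in_itv /=; apply/andP; split; last by lra.
  by have := le_atan hq; rewrite atan0.
rewrite -(cosN (atan q)) cosK ?opprK // in_itv /=; apply/andP; split; last by lra.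
have : q <= 0 by rewrite ltW // ltNge hq.
by move=> /le_atan; rewrite atan0 oppr_ge0.
Qed.

Lemma cder_log f t d : 0 < re (f t) -> cder f t d ->
  cder (fun x => clog (f x)) t (d / f t).
Proof.
move=> x0 [f1 f2].
have nz : 0 < re (f t) ^+ 2 + im (f t) ^+ 2 by rewrite ltr_wpDr ?sqr_ge0 // exprn_gt0.
have cE : cn (f t) = Num.sqrt (re (f t) ^+ 2 + im (f t) ^+ 2) by case: (f t).
have fV : (f t)^-1 = Complex (re (f t) / (re (f t) ^+ 2 + im (f t) ^+ 2))
                      (- (im (f t) / (re (f t) ^+ 2 + im (f t) ^+ 2))).
  by case: (f t).
split.
  have h : is_derive t 1 (fun x => re (f x) ^+ 2 + im (f x) ^+ 2)
      ((2 * re (f t)) * re d + (2 * im (f t)) * im d).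
    apply: is_derive_ext (is_deriveD (is_deriveX 2 f1) (is_deriveX 2 f2)) => [x //|].
    by rewrite /GRing.scale /= !expr1.
  have hs := @is_derive1_comp _ Num.sqrt _ t _ _ (is_derive1_sqrt nz) h.
  have s0 : 0 < Num.sqrt (re (f t) ^+ 2 + im (f t) ^+ 2) by rewrite sqrtr_gt0.
  have hl := @is_derive1_comp _ (@ln R) _ t _ _ (is_derive1_ln s0) hs.
  apply: is_derive_ext hl => [x|].
    by rewrite /clog /=; case: (f x).
  rewrite reM fV /=.
  have e : Num.sqrt (re (f t) ^+ 2 + im (f t) ^+ 2) ^+ 2 =
      re (f t) ^+ 2 + im (f t) ^+ 2 by rewrite sqr_sqrtr // ltW.
  move: e s0; set S := Num.sqrt _ => e s0; rewrite -e; field.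
  exact: lt0r_neq0.
have hq : is_derive t 1 (fun x => im (f x) / re (f x))
    (im (f t) * (- (re (f t)) ^- 2 * re d) + (re (f t))^-1 * im d).
  by apply: is_derive_ext (is_deriveM f2 (is_deriveV (lt0r_neq0 x0) f1)) => [x //|].
have ha := @is_derive1_comp _ atan _ t _ _ (is_derive1_atan _) hq.
have h0 : is_derive t 1 (fun x => carg (f x)) ((1 + (im (f t) / re (f t)) ^+ 2)^-1 *
    (im (f t) * (- re (f t) ^- 2 * re d) + (re (f t))^-1 * im d)).
  (* The arctangent formula holds at all points near t, because the real part stays positive
     there. *)
  apply: near_eq_is_derive ha.
  have ct : {for t, continuous (fun x => re (f x))}.
    have [df _] := f1; apply: differentiable_continuous.
    exact/derivable1_diffP.
  near=> x; rewrite carg_atan //; near: x.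
  exact: (cvgr_gt _ ct).
apply: is_derive_ext h0 => [x //|].
rewrite imM fV /=; have x1 := lt0r_neq0 x0; field.
by rewrite x1 lt0r_neq0.
Unshelve. all: by end_near. Qed.

(* The factor 2 comes from estimating real and imaginary parts separately. *)
Lemma path_mvt f (d : R -> R[i]) (g dg : R -> R) :
  (forall t, 0 <= t <= 1 -> cder f t (d t)) ->
  (forall t, 0 <= t <= 1 -> is_derive t 1 g (dg t)) ->
  (forall t, 0 <= t <= 1 -> cn (d t) <= dg t) ->
  cn (f 1 - f 0) <= 2 * (g 1 - g 0).
Proof.
move=> hf hg hb.
have key (F dF : R -> R) : (forall t, 0 <= t <= 1 -> is_derive t 1 F (dF t)) ->
    (forall t, 0 <= t <= 1 -> dF t <= dg t) -> F 1 - F 0 <= g 1 - g 0.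
  move=> hF hd.
  have hH t : 0 <= t <= 1 -> is_derive t 1 (F - g) (dF t - dg t).
    by move=> ht; apply: is_deriveB; [exact: hF|exact: hg].
  have [||c] := @MVT _ (F - g) (fun t => dF t - dg t) 0 1 ltr01.
  - by move=> t; rewrite in_itv /= => /andP[/ltW a /ltW b]; apply: hH; rewrite a b.
  - apply: continuous_in_subspaceT => t; rewrite inE /= in_itv /= => ht.
    apply: differentiable_continuous; apply/derivable1_diffP.
    by have [] := hH _ ht.
  rewrite in_itv /= => /andP[/ltW a /ltW b].
  have := hd c; rewrite a b => /(_ isT) h; rewrite subr0 mulr1 !fctE => e.
  lra.
have key2 (F dF : R -> R) : (forall t, 0 <= t <= 1 -> is_derive t 1 F (dF t)) ->
    (forall t, 0 <= t <= 1 -> `|dF t| <= dg t) -> `|F 1 - F 0| <= g 1 - g 0.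
  move=> hF hd; rewrite ler_norml; apply/andP; split.
    have := key (- F) (- dF); rewrite !fctE => k.
    suff : - F 1 - - F 0 <= g 1 - g 0 by lra.
    apply: k => t ht; first by apply: is_deriveN; exact: hF.
    by apply: le_trans (hd t ht); rewrite -normrN ler_norm.
  apply: (key F dF) => // t ht; apply: le_trans (hd t ht); exact: ler_norm.
apply: (le_trans (cn_le_reim _)).
have -> : re (f 1 - f 0) = re (f 1) - re (f 0) by rewrite reD reN.
have -> : im (f 1 - f 0) = im (f 1) - im (f 0) by rewrite imD imN.
have -> : 2 * (g 1 - g 0) = (g 1 - g 0) + (g 1 - g 0) by ring.
apply: lerD; [apply: (key2 (fun x => re (f x)) (fun x => re (d x)))|
              apply: (key2 (fun x => im (f x)) (fun x => im (d x)))] => t ht; try by case: (hf t ht).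
  exact: le_trans (re_le_cn _) (hb _ ht).
exact: le_trans (im_le_cn _) (hb _ ht).
Qed.

Lemma path_mvt_cst f (d : R -> R[i]) B :
  (forall t, 0 <= t <= 1 -> cder f t (d t)) ->
  (forall t, 0 <= t <= 1 -> cn (d t) <= B) -> cn (f 1 - f 0) <= 2 * B.
Proof.
move=> hf hb; have := @path_mvt f d (fun t => B * t) (fun=> B) hf.
rewrite mulr1 mulr0 subr0; apply=> // t _.
by apply: is_derive_ext (is_deriveZ B (is_derive_id t 1)) => [x //|];
  rewrite /GRing.scale /= mulr1.
Qed.
End RealPath.

(** * Remainders and power series of the exponential *)

Section Exponential.
Context {R : realType}.
Implicit Types (f g : R -> R[i]) (t : R) (z : R[i]).

Lemma cderX f t d n : cder f t d ->
  cder (fun x => f x ^+ n.+1) t (n.+1%:R * f t ^+ n * d).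
Proof.
move=> h; elim: n => [|n IH].
  by apply: cder_eq h _; rewrite expr0 !mul1r.
apply: cder_eq (cder_ext _ (cderM h IH)) _ => [x|]; first by rewrite -exprS.
rewrite -[n.+2]addn1 natrD !exprS; ring.
Qed.

Lemma cnZ_line t z : 0 <= t <= 1 -> cn (t%:C%C * z) <= cn z.
Proof.
move=> /andP[a b]; rewrite cnM cn_real ger0_norm //.
by rewrite ler_piMl // cn_ge0.
Qed.

Lemma cn_cexp_le z : cn (cexp z) <= expR (cn z).
Proof. by rewrite cn_cexp ler_expR re_cn. Qed.

Lemma cder_ray z t : cder (fun x => x%:C%C * z) t z.
Proof. by apply: cder_ext (cder_line 0 z t) => x; rewrite add0r. Qed.

Lemma cexp_sub1 z : cn (cexp z - 1) <= 2 * (cn z * expR (cn z)).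
Proof.
have := @path_mvt_cst R (fun x => cexp (x%:C%C * z)) (fun x => cexp (x%:C%C * z) * z)
  (cn z * expR (cn z)).
rewrite mul1r mul0r cexp0; apply => t ht.
  by apply: cder_exp; exact: cder_ray.
rewrite cnM mulrC ler_wpM2l ?cn_ge0 //; apply: (le_trans (cn_cexp_le _)).
by rewrite ler_expR cnZ_line.
Qed.

(** Along the ray to z the derivative of the remainder is [(cexp (t z) - 1) * z], which [cexp_sub1]
    bounds; each mean value step contributes a factor 2, hence 4. *)
Lemma cexp_sub2 z : cn (cexp z - 1 - z) <= 4 * (cn z ^+ 2 * expR (cn z)).
Proof.
have := @path_mvt_cst R (fun x => cexp (x%:C%C * z) - x%:C%C * z)
  (fun x => cexp (x%:C%C * z) * z - z) (2 * (cn z ^+ 2 * expR (cn z))).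
rewrite mul1r mul0r cexp0 subr0.
have -> : 4 * (cn z ^+ 2 * expR (cn z)) = 2 * (2 * (cn z ^+ 2 * expR (cn z))) by ring.
rewrite addrAC; apply => t ht.
  by apply: cderB; [apply: cder_exp|]; exact: cder_ray.
have -> : cexp (t%:C%C * z) * z - z = (cexp (t%:C%C * z) - 1) * z by ring.
have h0 := cnZ_line z ht.
have h1 : expR (cn (t%:C%C * z)) <= expR (cn z) by rewrite ler_expR.
rewrite cnM; apply: (@le_trans _ _ (2 * (cn z * expR (cn z)) * cn z)); last first.
  by rewrite le_eqVlt; apply/orP; left; apply/eqP; ring.
rewrite ler_wpM2r ?cn_ge0 //; apply: (le_trans (cexp_sub1 _)).
by rewrite ler_wpM2l // ler_pM // ?cn_ge0 // expR_ge0.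
Qed.

Definition exp_trunc n z := \sum_(k < n) z ^+ k / k`!%:R.

Lemma cder_exp_trunc n z t :
  cder (fun x => exp_trunc n.+1 (x%:C%C * z)) t (z * exp_trunc n (t%:C%C * z)).
Proof.
elim: n => [|n IH].
  rewrite /exp_trunc big_ord0 mulr0; apply: cder_ext (cder_cst 1 t) => x.
  by rewrite big_ord1 expr0 fact0 divr1.
have h := cderZ ((n.+1)`!%:R)^-1 (cderX n (cder_ray z t)).
apply: cder_eq (cder_ext _ (cderD IH h)) _ => [x|].
  by rewrite /exp_trunc [RHS]big_ord_recr /= [_^-1 * _]mulrC.
rewrite /exp_trunc [in RHS]big_ord_recr /= mulrDr; congr (_ + _).
rewrite factS natrM; have n0 : n.+1%:R != 0 :> R[i] by rewrite pnatr_eq0.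
have f0 : n`!%:R != 0 :> R[i] by rewrite pnatr_eq0 -lt0n fact_gt0.
by move: (n.+1%:R : R[i]) (n`!%:R : R[i]) n0 f0 => a b a0 b0; field; rewrite a0 b0.
Qed.

(** Along the ray, the derivative of the remainder of index n + 1 is z times the one of index n, and
    the majorant integrates to t^(n+1) / (n+1). The factor 2 of [path_mvt] is paid at each of the n
    steps, whence [2 * cn z]. *)
Lemma exp_truncP n z :
  cn (cexp z - exp_trunc n z) <= (2 * cn z) ^+ n / n`!%:R * expR (cn z).
Proof.
elim: n z => [|n IH] z.
  by rewrite /exp_trunc big_ord0 subr0 expr0 divr1 mul1r cn_cexp_le.
pose C := cn z * ((2 * cn z) ^+ n / n`!%:R * expR (cn z)).
have fp : 0 < n`!%:R :> R by rewrite ltr0n fact_gt0.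
have C0 : 0 <= C.
  by rewrite /C !mulr_ge0 ?cn_ge0 ?exprn_ge0 ?invr_ge0 ?expR_ge0 ?mulr_ge0 ?cn_ge0 ?ler0n.
have := @path_mvt R (fun x => cexp (x%:C%C * z) - exp_trunc n.+1 (x%:C%C * z))
  (fun x => cexp (x%:C%C * z) * z - z * exp_trunc n (x%:C%C * z))
  (fun x => C / n.+1%:R * x ^+ n.+1) (fun x => C * x ^+ n).
rewrite mul1r mul0r cexp0 expr1n expr0n /= mulr0 subr0 mulr1.
have -> : exp_trunc n.+1 0 = 1.
  rewrite /exp_trunc big_ord_recl /= expr0 fact0 divr1 big1 ?addr0 // => i _.
  by rewrite expr0n /= mul0r.
rewrite subrr subr0 => h.
have -> : (2 * cn z) ^+ n.+1 / (n.+1)`!%:R * expR (cn z) = 2 * (C / n.+1%:R).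
  rewrite /C factS natrM exprS; have n0 : n.+1%:R != 0 :> R by rewrite pnatr_eq0.
  have f0 := lt0r_neq0 fp.
  by move: (n.+1%:R : R) (n`!%:R : R) n0 f0 => a b a0 b0; field; rewrite a0 b0.
apply: h => t ht.
- by apply: cderB; [apply: cder_exp; exact: cder_ray|exact: cder_exp_trunc].
- apply: is_derive_ext (is_deriveZ (C / n.+1%:R) (is_deriveX n.+1 (is_derive_id t 1))) => [x|].
    by rewrite /GRing.scale /= exprfctE.
  rewrite /GRing.scale /= mulr1; have n0 : n.+1%:R != 0 :> R by rewrite pnatr_eq0.
  move: (n.+1%:R : R) n0 => a a0; field; exact: a0.
- have -> : cexp (t%:C%C * z) * z - z * exp_trunc n (t%:C%C * z) =
      z * (cexp (t%:C%C * z) - exp_trunc n (t%:C%C * z)) by ring.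
  rewrite cnM.
  have t0 : 0 <= t by case/andP: ht.
  have -> : C * t ^+ n = cn z * ((2 * cn (t%:C%C * z)) ^+ n / n`!%:R * expR (cn z)).
    by rewrite /C cnM cn_real ger0_norm // !exprMn; field; rewrite gt_eqF.
  rewrite ler_wpM2l ?cn_ge0 //; apply: (le_trans (IH _)).
  rewrite ler_wpM2l // ?ler_expR ?cnZ_line //.
  by rewrite mulr_ge0 ?invr_ge0 ?ler0n // exprn_ge0 // mulr_ge0 // cn_ge0.
Qed.

Lemma exp_coeff_small (x e : R) : 0 < e -> exists n0, forall n, (n0 <= n)%N ->
  `|x ^+ n / n`!%:R| < e.
Proof.
move=> e0; have := cvg_exp_coeff x => /cvgrPdist_lt /(_ _ e0) [n0 _ h].
by exists n0 => n /h; rewrite sub0r normrN.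
Qed.

Lemma exp_term_le (x : R) n : 0 <= x -> x ^+ n / n`!%:R <= expR x.
Proof.
move=> x0; case: n => [|n]; last first.
  by apply: le_trans (expR_ge1Dxn n x0); rewrite lerDr.
by rewrite expr0 fact0 divr1; have := expR_ge1Dx x; lra.
Qed.

Lemma asummable_exp z : exists M, asummable (fun k => z ^+ k / k`!%:R) M.
Proof.
exists (expR (cn z)); apply: asummable_nat => n.
have -> : \sum_(i < n) cn (z ^+ i / i`!%:R) = series (exp_coeff (cn z)) n.
  rewrite /series /= big_mkord; apply: eq_bigr => i _.
  by rewrite cnM cnX cnV cnMn.
rewrite /expR; apply: nondecreasing_cvgn_le; last exact: is_cvg_series_exp_coeff.
apply: nondecreasing_series => k _ _; rewrite /exp_coeff /=.
by rewrite mulr_ge0 ?invr_ge0 ?ler0n // exprn_ge0 // cn_ge0.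
Qed.

Lemma has_sum_exp z : has_sum (fun k => z ^+ k / k`!%:R) (cexp z).
Proof.
have [M hM] := asummable_exp z; apply: (seq_has_sum hM) => e e0.
have E0 := expR_gt0 (cn z).
have [n0 h] := exp_coeff_small (2 * cn z) (divr_gt0 e0 E0).
exists n0 => n /h; rewrite ltr_pdivlMr // => h1; rewrite cnBC.
apply: le_lt_trans h1; apply: (le_trans (exp_truncP n z)).
by rewrite ler_wpM2r // ler_norm.
Qed.

Lemma carg_le z : z != 0 -> `|carg z| <= pi.
Proof.
rewrite -cn_gt0 => z0.
have rr : -1 <= re z / cn z <= 1.
  by rewrite ler_pdivlMr // ler_pdivrMr // mulN1r mul1r -ler_norml re_le_cn.
rewrite /carg; case: ifP => _; rewrite ?normrN ger0_norm ?acos_ge0 ?acos_lepi //.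
Qed.

Lemma cn_clog z : z != 0 -> cn (clog z) <= `|ln (cn z)| + pi.
Proof.
move=> z0; apply: (le_trans (cn_le_reim _)); rewrite /clog /= lerD2l.
exact: carg_le.
Qed.
End Exponential.

(** * Symbols *)

Section DifferenceClasses.
Context {R : realType} (K M : R) (K1 : 1 <= K) (M0 : 0 <= M).
Implicit Types (f g : R[i] -> R[i]) (W V eta : R[i] -> R) (A u v : R[i]) (n : nat).

(** A sector around the positive real axis. It is stable under addition, and [cn A] and [re A] are
    comparable on it, so that a single real weight measures growth. *)
Definition cone A := cn A <= K * re A.
(** Steps of bounded length: moving by such a step changes the weights by at most a constant
    factor. *)
Definition direction u := cone u && (re u <= M).
Definition weight A : R := 1 + re A.
Definition inv_weight A : R := (weight A)^-1.
Definition fdiff u f : R[i] -> R[i] := fun A => f (A + u) - f A.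

Lemma aperture_gt0 : 0 < K. Proof. exact: lt_le_trans K1. Qed.

Lemma cone_re_ge0 A : cone A -> 0 <= re A.
Proof.
move=> h; have := le_trans (cn_ge0 A) h; rewrite pmulr_rge0 //; exact: aperture_gt0.
Qed.

Lemma cone0 : cone 0. Proof. by rewrite /cone cn0 /= mulr0. Qed.

Lemma coneD A B : cone A -> cone B -> cone (A + B).
Proof.
by rewrite /cone => a b; apply: (le_trans (cnD _ _)); rewrite reD mulrDr lerD.
Qed.

Lemma coneZ (t : R) A : 0 <= t -> cone A -> cone (t%:C%C * A).
Proof.
move=> t0; rewrite /cone cnM cn_real reMr ger0_norm // mulrCA => h.
by rewrite ler_wpM2l.
Qed.

Lemma coneMn m A : cone A -> cone (m%:R * A).
Proof. by rewrite natr_complex; apply: coneZ; rewrite ler0n. Qed.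

Lemma direction_cone u : direction u -> cone u. Proof. by case/andP. Qed.
Lemma direction_re u : direction u -> re u <= M. Proof. by case/andP. Qed.
Lemma direction_cn u : direction u -> cn u <= K * M.
Proof.
by case/andP => h h'; apply: (le_trans h); rewrite ler_wpM2l // ltW // aperture_gt0.
Qed.

Lemma weight_ge1 A : cone A -> 1 <= weight A.
Proof. by move=> /cone_re_ge0; rewrite /weight; lra. Qed.
Lemma weight_gt0 A : cone A -> 0 < weight A.
Proof. by move=> /weight_ge1; lra. Qed.
Lemma weightX_ge1 A k : cone A -> 1 <= weight A ^+ k.
Proof. by move=> /weight_ge1; exact: exprn_ege1. Qed.
Lemma inv_weight_ge0 A : cone A -> 0 <= inv_weight A.
Proof. by move=> /weight_gt0 h; rewrite invr_ge0 ltW. Qed.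
Lemma inv_weight_le1 A : cone A -> inv_weight A <= 1.
Proof. by move=> h; rewrite invf_le1 ?weight_ge1 ?weight_gt0. Qed.

Definition decaying eta := forall A, cone A ->
  0 <= eta A /\ forall v, cone v -> eta (A + v) <= eta A.

Lemma inv_weight_decaying : decaying inv_weight.
Proof.
move=> A dA; split=> [|v dv]; first exact: inv_weight_ge0.
rewrite lef_pV2 ?posrE ?weight_gt0 ?coneD // /weight reD.
by have := cone_re_ge0 dv; lra.
Qed.

(** Intermediate t serve the mean value theorem on the segment from A to A + u; t = 1 serves the
    translated factor in the product rule for differences. *)
Definition slowly_varying k W := forall A u (t : R), cone A -> direction u -> 0 <= t <= 1 ->
  W (A + t%:C%C * u) <= k * W A.

(* The discrete analogue of a symbol class: [k]-fold differences of [f], [k <= n],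
   are bounded by [W * eta ^ k]. With [eta = inv_weight], each difference gains
   one power of decay. *)
Fixpoint symb eta n W f : Prop :=
  (forall A, cone A -> cn (f A) <= W A) /\
  (if n is n'.+1 then forall u, direction u -> symb eta n' (fun A => W A * eta A) (fdiff u f)
   else True).

Lemma symb_base eta n W f A : symb eta n W f -> cone A -> cn (f A) <= W A.
Proof. by case: n => [|n] [h _]; exact: h. Qed.

Lemma symb_W_ge0 eta n W f A : symb eta n W f -> cone A -> 0 <= W A.
Proof. by move=> /symb_base h /h; apply: le_trans; exact: cn_ge0. Qed.

Lemma symb_le eta n W V f : decaying eta -> (forall A, cone A -> W A <= V A) ->
  symb eta n W f -> symb eta n V f.
Proof.
move=> he; elim: n W V f => [|n IH] W V f h [h0 h1].
  by split=> // A dA; exact: le_trans (h0 _ dA) (h _ dA).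
split=> [A dA|u du].
  exact: le_trans (h0 _ dA) (h _ dA).
apply: IH (h1 u du) => A dA; rewrite ler_wpM2r ?h //; by case: (he _ dA).
Qed.

Lemma symb_pred eta n W f : symb eta n.+1 W f -> symb eta n W f.
Proof.
elim: n W f => [|n IH] W f [h0 h1]; split=> // u du.
by apply: IH; exact: h1.
Qed.

Lemma symb_mono eta m n W f : (m <= n)%N -> symb eta n W f -> symb eta m W f.
Proof.
by move=> /subnK <-; elim: (n - m)%N => [|k IH] //; rewrite addSn => /symb_pred.
Qed.

Lemma cone_line A u (t : R) : cone A -> direction u -> 0 <= t <= 1 -> cone (A + t%:C%C * u).
Proof. by move=> dA du /andP[t0 _]; apply: coneD => //; apply: coneZ => //;
  exact: direction_cone. Qed.

Lemma cone_step A u : cone A -> direction u -> cone (A + u).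
Proof. by move=> dA /direction_cone; exact: coneD. Qed.

Lemma symb_ext eta n W f g : (forall A, cone A -> f A = g A) ->
  symb eta n W f -> symb eta n W g.
Proof.
elim: n W f g => [|n IH] W f g e [h0 h1].
  by split=> // A dA; rewrite -e ?h0.
split=> [A dA|u du].
  by rewrite -e ?h0.
by apply: IH (h1 u du) => A dA; rewrite /fdiff !e ?cone_step.
Qed.

Lemma fdiffD u f g : fdiff u (fun A => f A + g A) = (fun A => fdiff u f A + fdiff u g A).
Proof. by apply/funext => A; rewrite /fdiff; ring. Qed.
Lemma fdiffZ u c f : fdiff u (fun A => c * f A) = (fun A => c * fdiff u f A).
Proof. by apply/funext => A; rewrite /fdiff; ring. Qed.
Lemma fdiffC u v f : fdiff u (fdiff v f) = fdiff v (fdiff u f).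
Proof. by apply/funext => A; rewrite /fdiff [A + v + u]addrAC; ring. Qed.
Lemma fdiffM u f g : fdiff u (fun A => f A * g A) =
  (fun A => fdiff u f A * g (A + u) + f A * fdiff u g A).
Proof. by apply/funext => A; rewrite /fdiff; ring. Qed.

Lemma symbD eta n W V f g : symb eta n W f -> symb eta n V g ->
  symb eta n (fun A => W A + V A) (fun A => f A + g A).
Proof.
elim: n W V f g => [|n IH] W V f g [f0 f1] [g0 g1].
  by split=> // A dA; apply: (le_trans (cnD _ _)); rewrite lerD ?f0 ?g0.
split=> [A dA|u du].
  by apply: (le_trans (cnD _ _)); rewrite lerD ?f0 ?g0.
rewrite fdiffD; have := IH _ _ _ _ (f1 u du) (g1 u du).
  by congr symb; apply/funext => A; rewrite mulrDl.
Qed.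

Lemma symbZ eta n W f c : symb eta n W f ->
  symb eta n (fun A => cn c * W A) (fun A => c * f A).
Proof.
elim: n W f => [|n IH] W f [f0 f1].
  by split=> // A dA; rewrite cnM ler_wpM2l ?cn_ge0 ?f0.
split=> [A dA|u du].
  by rewrite cnM ler_wpM2l ?cn_ge0 ?f0.
rewrite fdiffZ; have := IH _ _ (f1 u du).
  by congr symb; apply/funext => A; rewrite mulrA.
Qed.

Lemma symb_cst eta n c : decaying eta -> symb eta n (fun=> cn c) (fun=> c).
Proof.
move=> he.
have z m V : (forall A, cone A -> 0 <= V A) -> symb eta m V (fun=> 0).
  elim: m V => [|m IH] V hV.
    by split=> // A dA; rewrite cn0 hV.
  split=> [A dA|u du].
    by rewrite cn0 hV.
  have -> : fdiff u (fun=> 0) = fun=> 0 by apply/funext => A; rewrite /fdiff subrr.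
    by apply: IH => A dA; rewrite mulr_ge0 ?hV //; case: (he _ dA).
case: n => [|n]; split=> // u du.
have -> : fdiff u (fun=> c) = fun=> 0 by apply/funext => A; rewrite /fdiff subrr.
by apply: z => A dA; rewrite mulr_ge0 ?cn_ge0 //; case: (he _ dA).
Qed.

Definition translate u f : R[i] -> R[i] := fun A => f (A + u).

Lemma fdiff_shift u v f : fdiff u (translate v f) = translate v (fdiff u f).
Proof. by apply/funext => A; rewrite /fdiff /translate addrAC. Qed.

Lemma symb_shift eta n W f u : decaying eta -> direction u -> symb eta n W f ->
  symb eta n (fun A => W (A + u)) (translate u f).
Proof.
move=> he du; elim: n W f => [|n IH] W f [f0 f1].
  by split=> // A dA; rewrite f0 ?cone_step.
split=> [A dA|v dv].
  by rewrite f0 ?cone_step.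
rewrite fdiff_shift; apply: symb_le (IH _ _ (f1 v dv)) => // A dA.
  rewrite ler_wpM2l //; last by case: (he _ dA) => _; apply; exact: direction_cone.
  exact: le_trans (cn_ge0 _) (f0 _ (cone_step dA du)).
Qed.

Lemma symb_shift_slow k eta n W f u : decaying eta -> slowly_varying k W -> direction u ->
  symb eta n W f -> symb eta n (fun A => k * W A) (translate u f).
Proof.
move=> he hs du /(symb_shift he du); apply: symb_le => // A dA.
by have := hs A u 1 dA du; rewrite mul1r; apply; apply/andP.
Qed.

Lemma slowly_varying_decay k W eta : decaying eta -> (forall A, cone A -> 0 <= W A) ->
  slowly_varying k W -> slowly_varying k (fun A => W A * eta A).
Proof.
move=> he h0 hs A u t dA du ht; rewrite mulrA.
have dA' := cone_line dA du ht; have [e0 e1] := he _ dA'.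
apply: ler_pM => //; [exact: h0|exact: hs|].
by case: (he _ dA) => _; apply; apply: coneZ; [case/andP: ht|exact: direction_cone].
Qed.

(** In the product rule the factor g is translated, which costs k; the two terms then carry the
    decays [k * eta] and [eta'], which add up. Keeping the two decays apart allows factors with
    different constants of decay. *)
Lemma symbM k n eta eta' W V f g : decaying eta -> decaying eta' -> 0 <= k ->
  slowly_varying k V -> symb eta n W f -> symb eta' n V g ->
  symb (fun A => k * eta A + eta' A) n (fun A => W A * V A) (fun A => f A * g A).
Proof.
move=> he he' k0.
have he2 : decaying (fun A => k * eta A + eta' A).
  move=> A dA; have [a b] := he _ dA; have [c d] := he' _ dA.
  split=> [|v dv]; first by rewrite addr_ge0 // mulr_ge0.
  by apply: lerD; [apply: ler_wpM2l => //; exact: b|exact: d].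
have base m W' V' f' g' A : symb eta m W' f' -> symb eta' m V' g' -> cone A ->
    cn (f' A * g' A) <= W' A * V' A.
  move=> hf hg dA; rewrite cnM; apply: ler_pM; rewrite ?cn_ge0 //.
    exact: symb_base hf dA.
  exact: symb_base hg dA.
elim: n W V f g => [|n IH] W V f g hs hf hg.
  by split=> // A dA; exact: base hf hg dA.
split=> [A dA|u du]; first exact: base hf hg dA.
have [_ f1] := hf; have [_ g1] := hg; rewrite fdiffM.
have V0 A : cone A -> 0 <= V A by exact: symb_W_ge0 hg.
have sk : slowly_varying k (fun A => k * V A).
  by move=> A v t dA dv ht; rewrite ler_wpM2l //; exact: hs.
have i1 := IH _ _ _ _ sk (f1 u du) (symb_shift_slow he' hs du (symb_pred hg)).
have i2 := IH _ _ _ _ (slowly_varying_decay he' V0 hs) (symb_pred hf) (g1 u du).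
apply: symb_le (symbD i1 i2) => // A dA.
by rewrite le_eqVlt; apply/orP; left; apply/eqP; ring.
Qed.

(** A constant in the decay is paid once per difference, hence at most [c ^+ n]. *)
Lemma symb_scale n eta c W f : decaying eta -> 1 <= c ->
  symb (fun A => c * eta A) n W f -> symb eta n (fun A => c ^+ n * W A) f.
Proof.
move=> he c1; have c0 : 0 <= c by lra.
elim: n W f => [|n IH] W f.
  by case=> h _; split=> // A dA; rewrite expr0 mul1r h.
move=> h; have [f0 f1] := h; split=> [A dA|u du].
  apply: (le_trans (f0 _ dA)); rewrite ler_peMl ?exprn_ege1 //.
  exact: symb_W_ge0 h dA.
apply: symb_le (IH _ _ (f1 u du)) => // A dA.
by rewrite le_eqVlt; apply/orP; left; apply/eqP; rewrite exprS; ring.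
Qed.

Definition has_derivative f g := forall A u (t : R), cone A -> direction u -> 0 <= t <= 1 ->
  cder (fun x => f (A + x%:C%C * u)) t (u * g (A + t%:C%C * u)).

Lemma has_derivative_fdiff f g v : direction v -> has_derivative f g ->
  has_derivative (fdiff v f) (fdiff v g).
Proof.
move=> dv h A u t dA du ht; rewrite /fdiff mulrBr.
apply: cderB; last exact: h.
have := h (A + v) u t (cone_step dA dv) du ht.
by rewrite addrAC; apply: cder_ext => x; rewrite addrAC.
Qed.

(** The mean value theorem on the segment from A to A + u turns a bound on the derivative into one
    on the difference. Further differences commute with [fdiff u] and with differentiation, so the
    induction applies to [fdiff v f] and [fdiff v g]. *)
Lemma symb_fdiff n eta V X f g u : decaying eta -> direction u -> has_derivative f g ->
  symb eta n V g ->
  (forall A t, cone A -> 0 <= t <= 1 -> 2 * cn u * V (A + t%:C%C * u) <= X A) ->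
  symb eta n X (fdiff u f).
Proof.
move=> he du.
have base m V' X' f' g' : has_derivative f' g' -> symb eta m V' g' ->
    (forall A t, cone A -> 0 <= t <= 1 -> 2 * cn u * V' (A + t%:C%C * u) <= X' A) ->
    forall A, cone A -> cn (fdiff u f' A) <= X' A.
  move=> hf hg hX A dA.
  have x0 : 0 <= X' A.
    have t0 : 0 <= (0 : R) <= 1 by rewrite lexx ler01.
    apply: le_trans (hX A 0 dA t0); rewrite !mulr_ge0 ?cn_ge0 //.
    by apply: (symb_W_ge0 hg); exact: cone_line.
  have := @path_mvt_cst R (fun x => f' (A + x%:C%C * u))
    (fun x => u * g' (A + x%:C%C * u)) (X' A / 2).
  rewrite mul1r mul0r addr0 mulrCA mulfV ?mulr1; last by rewrite pnatr_eq0.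
  apply=> t ht; first exact: hf.
  rewrite cnM ler_pdivlMr // mulrC mulrA; apply: le_trans (hX A t dA ht).
  rewrite ler_wpM2l ?mulr_ge0 ?cn_ge0 //.
  by apply: (symb_base hg); exact: cone_line.
elim: n V X f g => [|n IH] V X f g hf hg hX.
  by split=> //; exact: base hf hg hX.
split=> [|v dv]; first exact: base hf hg hX.
have [_ g1] := hg; rewrite fdiffC; apply: IH (has_derivative_fdiff dv hf) (g1 v dv) _ =>
  A t dA ht.
have dA' := cone_line dA du ht; have [e0 _] := he _ dA'.
rewrite mulrA; apply: ler_pM => //.
- by rewrite !mulr_ge0 ?cn_ge0 // (symb_W_ge0 hg).
- exact: hX.
- by case: (he _ dA) => _; apply; apply: coneZ; [case/andP: ht|exact: direction_cone].
Qed.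
End DifferenceClasses.

(** * Iterated Abel summation *)

Section TwistedSum.
Context {R : realType} (xi gam : R[i]).
Context (xi_le1 : cn xi <= 1) (xi_neq1 : xi != 1).
Implicit Types (f g : R[i] -> R[i]) (A u : R[i]).

(** The value is meaningful only if the series converges; [get] returns an arbitrary point
    otherwise. *)
Definition tsum0 g A : R[i] := get [set l | has_sum (fun m => xi ^+ m * g (A + m%:R * gam)) l].

(* [N]-fold Abel summation of [\sum_m xi ^ m * g (A + m * gam)]. It needs only
   the [N]-th differences of [g] to be summable, and its value does not change
   when [N] grows further; [tsum] is this eventual value. *)
Fixpoint tsumN N g A : R[i] :=
  if N is N'.+1 then (g A + xi * tsumN N' (fdiff gam g) A) / (1 - xi) else tsum0 g A.

Definition tsum g A : R[i] :=
  get [set l | exists N0, forall N, (N0 <= N)%N -> tsumN N g A = l].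

Definition diff_summable N g A :=
  exists B, asummable (fun m => iter N (fdiff gam) g (A + m%:R * gam)) B.

Lemma one_sub_neq0 : 1 - xi != 0.
Proof. by rewrite subr_eq0 eq_sym. Qed.

Lemma cn_xiX m : cn (xi ^+ m) <= 1.
Proof. by rewrite cnX exprn_ile1 // cn_ge0. Qed.

Lemma asummable_xi (x : nat -> R[i]) B : asummable x B -> asummable (fun m => xi ^+ m * x m) B.
Proof.
by apply: asummable_le => m; rewrite cnM ler_piMl ?cn_ge0 // cn_xiX.
Qed.

Lemma tsum0_eq g A l : has_sum (fun m => xi ^+ m * g (A + m%:R * gam)) l -> tsum0 g A = l.
Proof.
move=> h; apply: has_sum_uniq _ (h).
have := @getPex _ [set l | has_sum (fun m => xi ^+ m * g (A + m%:R * gam)) l].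
by apply; exists l.
Qed.

Lemma tsum0_has_sum g A : diff_summable 0 g A ->
  has_sum (fun m => xi ^+ m * g (A + m%:R * gam)) (tsum0 g A).
Proof.
move=> [B /asummable_xi /asummable_has_sum [l hl]]; by rewrite (tsum0_eq hl).
Qed.

Lemma shiftS A m : A + m.+1%:R * gam = A + m%:R * gam + gam.
Proof. by rewrite -addn1 natrD mulrDl mul1r addrA. Qed.

Lemma asummable_S (x : nat -> R[i]) B : asummable x B -> asummable (fun m => x m.+1) B.
Proof. by apply: asummable_bij; exact: succn_inj. Qed.

Lemma diff_summable_S N g A : diff_summable N g A -> diff_summable N.+1 g A.
Proof.
move=> [B hB]; exists (B + cn (-1) * B).
have := asummableD (asummable_S hB) (asummableZ (-1) hB); congr asummable; apply/funext => m.
by rewrite iterS /fdiff -/(fdiff gam) mulN1r shiftS.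
Qed.

Lemma diff_summable_mono N N' g A : (N <= N')%N -> diff_summable N g A -> diff_summable N' g A.
Proof.
by move=> /subnK <- h; elim: (N' - N)%N => [//|k IH]; rewrite addSn; exact: diff_summable_S.
Qed.

Lemma diff_summable_fdiff N g A : diff_summable N.+1 g A <-> diff_summable N (fdiff gam g) A.
Proof. by rewrite /diff_summable iterSr. Qed.

(** Let S be the sum and l the sum of the series shifted by one step. Then S = g(A) + xi l and the
    differenced series has sum l - S, so (1 - xi) S = g(A) + xi (l - S). *)
Lemma tsum0_step g A : diff_summable 0 g A ->
  tsum0 g A = (g A + xi * tsum0 (fdiff gam g) A) / (1 - xi).
Proof.
move=> h; have hs := tsum0_has_sum h; have [B hB] := h.
have [l hl] := asummable_has_sum (asummable_xi (asummable_S hB)).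
have hsh : has_sum (fun m => xi ^+ m.+1 * g (A + m.+1%:R * gam)) (xi * l).
  by under eq_fun do rewrite exprS -mulrA; exact: has_sumZ.
have e1 := has_sum_uniq hs (has_sum_shift (asummable_xi hB) hsh).
rewrite expr0 mul1r mul0r addr0 in e1.
have -> : tsum0 (fdiff gam g) A = l - tsum0 g A.
  apply: tsum0_eq; have := has_sumB hl hs; congr has_sum; apply/funext => m.
  by rewrite /fdiff shiftS mulrBr.
apply: (mulIf one_sub_neq0); rewrite mulfVK ?one_sub_neq0 //.
have -> : g A = tsum0 g A - xi * l by rewrite e1 addrK.
ring.
Qed.

Lemma tsumN_step N g A : diff_summable N g A -> tsumN N.+1 g A = tsumN N g A.
Proof.
elim: N g => [|N IH] g h; first by rewrite /= -tsum0_step.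
by rewrite [LHS]/= -/(tsumN N.+1 _ _) IH // -diff_summable_fdiff.
Qed.

Lemma tsum_eq N g A : diff_summable N g A -> tsum g A = tsumN N g A.
Proof.
move=> h; have e N' : (N <= N')%N -> tsumN N' g A = tsumN N g A.
  move=> /subnK <-; elim: (N' - N)%N => [//|k IH].
  rewrite addSn tsumN_step //; apply: diff_summable_mono h; exact: leq_addl.
have [N0 /(_ (maxn N N0) (leq_maxr _ _)) <-] :
    [set l | exists N0, forall N', (N0 <= N')%N -> tsumN N' g A = l] (tsum g A).
  by apply: getPex; exists (tsumN N g A); exists N.
by rewrite e // leq_maxl.
Qed.

Lemma iter_fdiffD N f g : iter N (fdiff gam) (fun A => f A + g A) =
  fun A => iter N (fdiff gam) f A + iter N (fdiff gam) g A.
Proof. by elim: N => [//|N IH]; rewrite !iterS IH fdiffD. Qed.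

Lemma iter_fdiffZ N c f : iter N (fdiff gam) (fun A => c * f A) =
  fun A => c * iter N (fdiff gam) f A.
Proof. by elim: N => [//|N IH]; rewrite !iterS IH fdiffZ. Qed.

Lemma iter_fdiff_shift N u f :
  iter N (fdiff gam) (translate u f) = translate u (iter N (fdiff gam) f).
Proof. by elim: N => [//|N IH]; rewrite !iterS IH fdiff_shift. Qed.

Lemma diff_summableD N f g A : diff_summable N f A -> diff_summable N g A ->
  diff_summable N (fun A => f A + g A) A.
Proof.
by move=> [B hB] [B' hB']; exists (B + B'); rewrite iter_fdiffD; exact: asummableD.
Qed.

Lemma diff_summableZ N c f A : diff_summable N f A -> diff_summable N (fun A => c * f A) A.
Proof. by move=> [B hB]; exists (cn c * B); rewrite iter_fdiffZ; exact: asummableZ. Qed.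

Lemma diff_summable_shift N u f A : diff_summable N f (A + u) ->
  diff_summable N (translate u f) A.
Proof.
move=> [B hB]; exists B; rewrite iter_fdiff_shift.
by move: hB; congr asummable; apply/funext => m; rewrite /translate addrAC.
Qed.

Lemma tsumND N f g A : diff_summable N f A -> diff_summable N g A ->
  tsumN N (fun A => f A + g A) A = tsumN N f A + tsumN N g A.
Proof.
elim: N f g => [|N IH] f g hf hg /=.
  apply: tsum0_eq; have := has_sumD (tsum0_has_sum hf) (tsum0_has_sum hg).
  by congr has_sum; apply/funext => m; rewrite mulrDr.
by rewrite fdiffD IH; [ring|exact/diff_summable_fdiff|exact/diff_summable_fdiff].
Qed.

Lemma tsumNZ N c f A : diff_summable N f A -> tsumN N (fun A => c * f A) A = c * tsumN N f A.
Proof.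
elim: N f => [|N IH] f hf /=.
  apply: tsum0_eq; have := has_sumZ c (tsum0_has_sum hf).
  by congr has_sum; apply/funext => m; rewrite mulrCA.
by rewrite fdiffZ IH; [ring|exact/diff_summable_fdiff].
Qed.

Lemma tsumN_shift N u f A : diff_summable N f (A + u) ->
  tsumN N (translate u f) A = tsumN N f (A + u).
Proof.
elim: N f => [|N IH] f hf /=.
  apply: tsum0_eq; have := tsum0_has_sum hf.
  by congr has_sum; apply/funext => m; rewrite /translate addrAC.
by rewrite fdiff_shift IH //; exact/diff_summable_fdiff.
Qed.

Lemma tsumN_ext N f g A : (forall m, f (A + m%:R * gam) = g (A + m%:R * gam)) ->
  tsumN N f A = tsumN N g A.
Proof.
elim: N f g => [|N IH] f g h /=.
  by rewrite /tsum0; under [X in get X]eq_set do under eq_fun do rewrite h.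
have := h 0%N; rewrite mul0r addr0 => ->.
by rewrite (IH _ (fdiff gam g)) // => m; rewrite /fdiff -shiftS !h.
Qed.

Lemma tsum_ext f g A : (forall m, f (A + m%:R * gam) = g (A + m%:R * gam)) -> tsum f A = tsum g A.
Proof.
move=> h; rewrite /tsum; congr get; apply/seteqP; split=> l [N0 hN]; exists N0 => N /hN <-.
  by apply: tsumN_ext => m; rewrite h.
exact: tsumN_ext.
Qed.

Definition regular g A := exists N, diff_summable N g A.

Lemma regular2 f g A : regular f A -> regular g A -> exists N,
  diff_summable N f A /\ diff_summable N g A.
Proof.
move=> [N h] [N' h']; exists (maxn N N'); split.
  exact: diff_summable_mono (leq_maxl _ _) h.
exact: diff_summable_mono (leq_maxr _ _) h'.
Qed.

Lemma regularD f g A : regular f A -> regular g A -> regular (fun A => f A + g A) A.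
Proof. by move=> /regular2 h /h [N [a b]]; exists N; exact: diff_summableD. Qed.

Lemma regularZ c f A : regular f A -> regular (fun A => c * f A) A.
Proof. by move=> [N a]; exists N; exact: diff_summableZ. Qed.

Lemma tsumD f g A : regular f A -> regular g A ->
  tsum (fun A => f A + g A) A = tsum f A + tsum g A.
Proof.
move=> /regular2 h /h [N [a b]].
by rewrite (tsum_eq (diff_summableD a b)) (tsum_eq a) (tsum_eq b) tsumND.
Qed.

Lemma tsumZ c f A : regular f A -> tsum (fun A => c * f A) A = c * tsum f A.
Proof. by move=> [N a]; rewrite (tsum_eq (diff_summableZ c a)) (tsum_eq a) tsumNZ. Qed.

Lemma tsumB f g A : regular f A -> regular g A ->
  tsum (fun A => f A - g A) A = tsum f A - tsum g A.
Proof.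
move=> hf hg; rewrite -[in RHS]mulN1r -tsumZ // -tsumD ?regularZ //.
- by apply: tsum_ext => m; rewrite mulN1r.
- exact: regularZ.
Qed.

Lemma tsum_shift u f A : regular f (A + u) -> tsum (translate u f) A = tsum f (A + u).
Proof. by move=> [N a]; rewrite (tsum_eq (diff_summable_shift a)) (tsum_eq a) tsumN_shift. Qed.

(** This commutation makes the symbol classes stable: a difference of a twisted sum is the twisted
    sum of a difference, to which the same bounds apply. *)
Lemma tsum_fdiff u f A : regular f A -> regular f (A + u) ->
  tsum (fdiff u f) A = fdiff u (tsum f) A.
Proof.
move=> h h'; rewrite {2}/fdiff -(tsum_shift h') -tsumB //.
by move: h' => [N h']; exists N; exact: diff_summable_shift.
Qed.

Lemma tsum_lincomb (I : finType) (c : I -> R[i]) (f : I -> R[i] -> R[i]) A :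
  (forall i, regular (f i) A) ->
  regular (fun A => \sum_i c i * f i A) A /\
  tsum (fun A => \sum_i c i * f i A) A = \sum_i c i * tsum (f i) A.
Proof.
move=> h; elim: (index_enum I) => [|i s [IH1 IH2]].
  have z : regular (fun=> 0) A.
    exists 0%N; exists 0 => B; rewrite big1 // => i _; exact: cn0.
  split; first by under eq_fun do rewrite big_nil.
  rewrite big_nil; under [X in tsum X]eq_fun do rewrite big_nil -(mulr0 0).
  by rewrite (tsumZ 0 z) mul0r.
have hi := regularZ (c i) (h i).
split; first by under eq_fun do rewrite big_cons; exact: regularD.
rewrite big_cons -IH2 -tsumZ // -tsumD //.
by under [X in tsum X]eq_fun do rewrite big_cons.
Qed.
End TwistedSum.

(** * Bounds for twisted sums of symbols *)

Section TwistedSumBounds.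
Context {R : realType} (K M : R) (K1 : 1 <= K) (M0 : 0 <= M).
Context (xi gam : R[i]) (xi_le1 : cn xi <= 1) (xi_neq1 : xi != 1).
Context (gam_dir : direction K M gam) (gam_pos : 0 < re gam).
Implicit Types (f g : R[i] -> R[i]) (A u : R[i]).

Local Notation symb := (symb K M).
Local Notation cone := (cone K).
Local Notation tsum := (tsum xi gam).
Local Notation tsumN := (tsumN xi gam).

Definition decay m : R := ((1 + m%:R * re gam) ^+ 2)^-1.
Definition decay_sum : R := 1 + (re gam)^-1.

Lemma decay_gt0 m : 0 < 1 + m%:R * re gam.
Proof. by rewrite ltr_pwDl // mulr_ge0 // ltW. Qed.

Lemma decay_ge0 m : 0 <= decay m.
Proof. by rewrite invr_ge0 exprn_ge0 // ltW // decay_gt0. Qed.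

(** Telescoping: for x = 1 + k c and c = re gam, 1 / (x + c)^2 is at most 1 / (x (x + c)) = (1/x -
    1/(x + c)) / c. *)
Lemma sum_decay n : \sum_(m < n) decay m <= decay_sum.
Proof.
have h k : \sum_(m < k.+1) decay m <= 1 + (re gam)^-1 * (1 - (1 + k%:R * re gam)^-1).
  elim: k => [|k IH].
    by rewrite big_ord1 /decay mul0r addr0 expr1n invr1 subrr mulr0 addr0.
  rewrite big_ord_recr /=; apply: (le_trans (lerD IH (lexx _))).
  have a := decay_gt0 k; have b := decay_gt0 k.+1.
  have e : 1 + k.+1%:R * re gam = 1 + k%:R * re gam + re gam.
    by rewrite -addn1 natrD mulrDl mul1r addrA.
  rewrite /decay; move: a b; rewrite e; set x := 1 + k%:R * re gam => a b.
  have -> : 1 + (re gam)^-1 * (1 - (x + re gam)^-1) =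
     1 + (re gam)^-1 * (1 - x^-1) + (x * (x + re gam))^-1.
    by field; rewrite !lt0r_neq0.
  rewrite lerD2l lef_pV2 ?posrE ?exprn_gt0 ?mulr_gt0 // expr2 ler_wpM2r // ?ltW //.
  by rewrite ltrDl.
case: n => [|n]; first by rewrite big_ord0 addr_ge0 // invr_ge0 ltW.
apply: (le_trans (h n)); rewrite lerD2l; apply: ler_piMr.
  by rewrite invr_ge0 ltW.
by rewrite gerBl invr_ge0 ltW // decay_gt0.
Qed.

Lemma re_translateMn A m : re (A + m%:R * gam) = re A + m%:R * re gam.
Proof. by rewrite reD natr_complex reMr. Qed.

Lemma cone_translateMn A m : cone A -> cone (A + m%:R * gam).
Proof. by move=> dA; apply: coneD => //; apply: coneMn; exact: direction_cone gam_dir. Qed.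

Fixpoint tsum_cst N : R := if N is N'.+1 then (1 + tsum_cst N') / cn (1 - xi) else decay_sum.

Lemma tsum_cst_ge0 N : 0 <= tsum_cst N.
Proof.
elim: N => [|N IH] /=; first by rewrite addr_ge0 // invr_ge0 ltW.
by rewrite divr_ge0 ?cn_ge0 // addr_ge0.
Qed.

(** Each Abel step leaves a boundary term at A, paid by [W A <= v], and divides by 1 - xi. The last
    series, over N-th differences, is paid by the summable [decay]. The recursion of [tsum_cst]
    records these costs. *)
Lemma tsumN_bound N W f A (v : R) : cone A -> symb (@inv_weight R) N W f -> W A <= v ->
  (forall m, W (A + m%:R * gam) * inv_weight (A + m%:R * gam) ^+ N <= v * decay m) ->
  diff_summable gam N f A /\ cn (tsumN N f A) <= tsum_cst N * v.
Proof.
move=> dA; elim: N W f => [|N IH] W f hf hW hv.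
  have v0 : 0 <= v := le_trans (symb_W_ge0 hf dA) hW.
  have hb m : cn (f (A + m%:R * gam)) <= v * decay m.
    apply: le_trans (hv m); rewrite expr0 mulr1.
    by apply: (symb_base hf); exact: cone_translateMn.
  have ha : asummable (fun m => f (A + m%:R * gam)) (tsum_cst 0 * v).
    apply: asummable_nat => n; apply: (@le_trans _ _ (\sum_(m < n) v * decay m)).
      exact: ler_sum.
    by rewrite -mulr_sumr mulrC ler_wpM2r // sum_decay.
  have hs : diff_summable gam 0 f A by exists (tsum_cst 0 * v).
  split=> //; have := tsum0_has_sum xi_le1 hs.
  by apply: has_sum_le; exact: asummable_xi.
have [f0 f1] := hf; have dA' m := cone_translateMn m dA.
have [||hs hb] := IH _ _ (f1 _ gam_dir).
- apply: le_trans hW; apply: ler_piMr; first exact: (symb_W_ge0 hf); exact (inv_weight_le1 K1 dA).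
- by move=> m; rewrite -mulrA -exprS.
split; first exact/diff_summable_fdiff.
rewrite /= cnM cnV mulrAC; apply: ler_wpM2r; first by rewrite invr_ge0 cn_ge0.
apply: (le_trans (cnD _ _)); rewrite mulrDl mul1r; apply: lerD.
  by apply: le_trans hW; exact: f0.
by rewrite cnM; apply: le_trans hb; rewrite ler_piMl ?cn_ge0.
Qed.

(** Of the n + N available differences, N are spent on convergence and n remain for the result. By
    [tsum_fdiff] the latter move inside the sum, where each improves W and V by one factor
    [inv_weight]. *)
Lemma symb_tsum n N W V f : symb (@inv_weight R) (n + N) W f ->
  (forall A, cone A -> W A <= V A) ->
  (forall A m, cone A ->
    W (A + m%:R * gam) * inv_weight (A + m%:R * gam) ^+ N <= V A * decay m) ->
  symb (@inv_weight R) n (fun A => tsum_cst N * V A) (tsum f).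
Proof.
have base W' V' f' : symb (@inv_weight R) N W' f' -> (forall A, cone A -> W' A <= V' A) ->
  (forall A m, cone A ->
    W' (A + m%:R * gam) * inv_weight (A + m%:R * gam) ^+ N <= V' A * decay m) ->
  forall A, cone A -> diff_summable gam N f' A /\ cn (tsum f' A) <= tsum_cst N * V' A.
  move=> hf hW hV A dA; have [hs hb] := tsumN_bound dA hf (hW A dA) (fun m => hV A m dA).
  by split=> //; rewrite (tsum_eq xi_le1 xi_neq1 hs).
elim: n W V f => [|n IH] W V f hf hW hV.
  by split=> // A dA; have [_] := base _ _ _ hf hW hV A dA.
have hN := symb_mono (leq_addl n.+1 N) hf.
split=> [A dA|u du]; first by have [_] := base _ _ _ hN hW hV A dA.
have [_ f1] := hf.
have := IH (fun A => W A * inv_weight A) (fun A => V A * inv_weight A) (fdiff u f) (f1 u du) _ _.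
have hs A : cone A -> diff_summable gam N f A by move=> dA; have [] := base _ _ _ hN hW hV A dA.
move=> h; apply: symb_ext (symb_le (inv_weight_decaying K1) _ (h _ _)).
- move=> A dA; apply: tsum_fdiff => //; first by exists N; exact: hs.
  by exists N; apply: hs; exact (cone_step dA du).
- by move=> A _; rewrite mulrA.
- by move=> A dA; rewrite ler_wpM2r ?hW // (inv_weight_ge0 K1).
- move=> A m dA; rewrite mulrAC [leRHS]mulrAC; apply: ler_pM.
  + rewrite mulr_ge0 ?exprn_ge0 ?(inv_weight_ge0 K1) ?cone_translateMn //.
    by apply: (symb_W_ge0 hf); exact: cone_translateMn.
  + by rewrite (inv_weight_ge0 K1) // cone_translateMn.
  + exact: hV.
  + have [_] := inv_weight_decaying K1 dA; apply; apply: coneMn => //;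
    exact: direction_cone gam_dir.
Qed.

(** Origin of [k.+2]: the differences of that order of a symbol of order k have size weight^(-2),
    and the weight at A + m gam is at least 1 + m re gam. The factor [weight A ^+ k >= 1] on the
    right only restores the shape of the bound. *)
Lemma weight_tail k A m (c : R) : 0 <= c -> cone A ->
  c * weight (A + m%:R * gam) ^+ k * inv_weight (A + m%:R * gam) ^+ k.+2 <=
  c * weight A ^+ k * decay m.
Proof.
move=> c0 dA; have w1 := weight_gt0 K1 (cone_translateMn m dA).
have hw := weightX_ge1 K1 k dA.
rewrite -!mulrA ler_wpM2l // /inv_weight.
have -> : k.+2 = (k + 2)%N by rewrite addn2.
rewrite exprD mulrA -exprMn mulfV ?lt0r_neq0 // expr1n mul1r; apply: (@le_trans _ _ (decay m));
  last by rewrite ler_peMl ?decay_ge0.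
rewrite /decay exprVn lef_pV2 ?posrE ?exprn_gt0 ?decay_gt0 //.
rewrite ler_pXn2r ?nnegrE; [|by [] |exact/ltW/decay_gt0|exact: ltW].
rewrite /weight re_translateMn.
by have := cone_re_ge0 K1 dA; lra.
Qed.

Lemma weight_diff_summable k f A (c : R) : cone A ->
  symb (@inv_weight R) k.+2 (fun A => c * weight A ^+ k) f ->
  diff_summable gam k.+2 f A.
Proof.
(* The weight is 1 at A = 0, so nonnegativity of the bound at that point reads [0 <= c]. *)
move=> dA hf; have := symb_W_ge0 hf (cone0 K).
rewrite /weight /= addr0 expr1n mulr1 => c0.
by have [] := tsumN_bound dA hf (lexx _) (fun m => weight_tail k m c0 dA).
Qed.

Lemma symb_tsum_weight n k f (c : R) :
  symb (@inv_weight R) (n + k.+2) (fun A => c * weight A ^+ k) f ->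
  symb (@inv_weight R) n (fun A => tsum_cst k.+2 * c * weight A ^+ k) (tsum f).
Proof.
move=> hf; have := symb_W_ge0 hf (cone0 K).
rewrite /weight /= addr0 expr1n mulr1 => c0.
have := symb_tsum hf (fun A _ => lexx _) (fun A m dA => weight_tail k m c0 dA).
by congr symb; apply/funext => A; rewrite mulrA.
Qed.
End TwistedSumBounds.

(** * Powers and logarithms as symbols *)

Section PowerSymbols.
Context {R : realType} (K M : R) (K1 : 1 <= K) (M0 : 0 <= M).
Implicit Types (f g : R[i] -> R[i]) (W : R[i] -> R) (A u : R[i]).

Local Notation symb := (symb K M).
Local Notation cone := (cone K).
Local Notation direction := (direction K M).

Lemma slowly_varying_weight k : slowly_varying K M ((1 + M) ^+ k) (fun A => weight A ^+ k).
Proof.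
move=> A u t dA du ht; rewrite -exprMn; have hu := direction_re du.
have u0 := cone_re_ge0 K1 (direction_cone du); have a0 := cone_re_ge0 K1 dA.
have dA' := cone_line dA du ht; have := weight_gt0 K1 dA'; have := weight_gt0 K1 dA.
case/andP: ht => t0 t1 w1 w2.
apply: lerXn2r; rewrite ?nnegrE ?mulr_ge0 ?(ltW w1) ?(ltW w2) ?addr_ge0 //.
rewrite /weight reD reMr; have h1 : t * re u <= M by apply: le_trans hu; rewrite ler_piMl.
have h2 : 0 <= M * re A by rewrite mulr_ge0.
lra.
Qed.

Lemma slowly_varyingZ k c W : 0 <= c -> slowly_varying K M k W ->
  slowly_varying K M k (fun A => c * W A).
Proof.
by move=> c0 h A u t dA du ht; rewrite [leRHS]mulrCA ler_wpM2l //; exact: h.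
Qed.

Lemma slowly_varying_inv_weight c : 0 <= c -> slowly_varying K M 1 (fun A => c * inv_weight A).
Proof.
move=> c0; apply: slowly_varyingZ => // A u t dA du ht; rewrite mul1r.
have [_] := inv_weight_decaying K1 dA; apply; apply: coneZ;
  [by case/andP: ht|exact: direction_cone du].
Qed.

(** The induction step for all symbols below: a derivative controlled for n differences controls n +
    1 differences of f. The constant adds the size [c0] of f to the mean value bound, with
    [cn u <= K * M] and the slow variation k of W. It is explicit so as to stay uniform in the
    exponent. *)
Lemma symb_primitive n k W f g c0 c1 : slowly_varying K M k W -> (forall A, cone A -> 0 <= W A) ->
  0 <= k -> 0 <= c0 -> 0 <= c1 -> has_derivative K M f g ->
  (forall A, cone A -> cn (f A) <= c0 * W A) ->
  symb (@inv_weight R) n (fun A => c1 * (W A * inv_weight A)) g ->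
  symb (@inv_weight R) n.+1 (fun A => (c0 + 2 * (K * M) * k * c1) * W A) f.
Proof.
move=> hs W0 k0 c00 c10 hd hf hg.
have K0 := ltW (aperture_gt0 K1); have KM : 0 <= K * M by rewrite mulr_ge0.
split=> [A dA|u du].
  apply: (le_trans (hf A dA)); rewrite mulrDl lerDl mulr_ge0 ?W0 //.
  by rewrite !mulr_ge0.
apply: (symb_fdiff (inv_weight_decaying K1) du hd hg) => A t dA ht.
have h := slowly_varying_decay (inv_weight_decaying K1) W0 hs dA du ht.
have e0 := inv_weight_ge0 K1 dA; have w0 := W0 _ dA.
have dA' := cone_line dA du ht.
apply: (@le_trans _ _ (2 * (K * M) * (c1 * (k * (W A * inv_weight A))))).
  apply: ler_pM; rewrite ?mulr_ge0 ?cn_ge0 ?W0 ?(inv_weight_ge0 K1) //.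
    by rewrite ler_wpM2l // direction_cn.
  by rewrite ler_wpM2l // mulrA.
have -> : (c0 + 2 * (K * M) * k * c1) * W A * inv_weight A =
  c0 * (W A * inv_weight A) + 2 * (K * M) * (c1 * (k * (W A * inv_weight A))) by ring.
by rewrite lerDr !mulr_ge0.
Qed.

Lemma has_derivativeZ c f g : has_derivative K M f g ->
  has_derivative K M (fun A => c * f A) (fun A => c * g A).
Proof. by move=> h A u t dA du ht; rewrite mulrCA; apply: cderZ; exact: h. Qed.

Lemma has_derivativeB f f' g g' : has_derivative K M f f' -> has_derivative K M g g' ->
  has_derivative K M (fun A => f A - g A) (fun A => f' A - g' A).
Proof.
by move=> h h' A u t dA du ht; rewrite mulrBr; apply: cderB; [exact: h|exact: h'].
Qed.

Lemma has_derivative_cst c : has_derivative K M (fun=> c) (fun=> 0).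
Proof. by move=> A u t _ _ _; rewrite mulr0; exact: cder_cst. Qed.

Context (gam : R[i]) (gam_dir : direction gam) (gam_pos : 0 < re gam).

(** The sector contains 0, where the logarithm is singular; after the shift the argument has real
    part at least [re gam]. The same shift makes the summation start at m = 1. *)
Definition shift_log A : R[i] := clog (A + gam).
Definition shift_pow c A : R[i] := cpow (A + gam) c.
Definition shift_inv : R[i] -> R[i] := shift_pow (-1).

Lemma re_shift_gt0 A : cone A -> 0 < re (A + gam).
Proof. by move=> /(cone_re_ge0 K1) h; rewrite reD ltr_wpDl. Qed.

Lemma shift_neq0 A : cone A -> A + gam != 0.
Proof. by move=> /re_shift_gt0 h; apply/eqP => e; move: h; rewrite e ltxx. Qed.

Lemma shift_powD c d A : shift_pow (c + d) A = shift_pow c A * shift_pow d A.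
Proof. by rewrite /shift_pow /cpow mulrDl cexpD. Qed.

Lemma shift_invE A : cone A -> shift_inv A = (A + gam)^-1.
Proof.
by move=> dA; rewrite /shift_inv /shift_pow /cpow mulN1r cexpN cexp_clog // shift_neq0.
Qed.

Lemma has_derivative_shift_log : has_derivative K M shift_log shift_inv.
Proof.
move=> A u t dA du ht; have dA' := cone_line dA du ht; rewrite shift_invE // /shift_log.
apply: (cder_log (f := fun x => A + x%:C%C * u + gam)); first exact: re_shift_gt0.
rewrite -[u in cder _ _ u]addr0; apply: cderD; [exact: cder_line|exact: cder_cst].
Qed.

Lemma has_derivative_shift_pow c :
  has_derivative K M (shift_pow c) (fun A => c * (shift_pow c A * shift_inv A)).
Proof.
move=> A u t dA du ht.
have := cder_exp (cderZ c (has_derivative_shift_log dA du ht)).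
by move/cder_eq; apply; rewrite /shift_pow /cpow -/(shift_log _); ring.
Qed.

(* [exp |log z| <= exp pi * (cn z + 1 / cn z)], applied to [z = A + gam]. *)
Definition exp_log_cst : R := expR pi * (K * (1 + re gam) + (re gam)^-1).

Lemma aperture_ge0 : 0 <= K. Proof. exact: ltW (aperture_gt0 K1). Qed.

Lemma exp_log_cst_ge0 : 0 <= exp_log_cst.
Proof.
have K0 := aperture_gt0 K1; rewrite /exp_log_cst mulr_ge0 ?expR_ge0 // addr_ge0 //.
  by rewrite mulr_ge0 ?ltW // ltr_wpDl.
by rewrite invr_ge0 ltW.
Qed.

(** Bounding the exponential of |log z| serves powers and Taylor remainders alike, since [cexp_sub1]
    and [cexp_sub2] produce a factor [expR (cn z)]. *)
Lemma exp_cn_shift_log A : cone A -> expR (cn (shift_log A)) <= exp_log_cst * weight A.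
Proof.
move=> dA; have z0 := shift_neq0 dA; have rz := re_shift_gt0 dA.
have K0 := aperture_gt0 K1; have a0 := cone_re_ge0 K1 dA.
set z := A + gam in z0 rz *.
have cz : 0 < cn z by rewrite cn_gt0.
have w1 := weight_ge1 K1 dA.
have h1 : expR (`|ln (cn z)|) <= cn z + (cn z)^-1.
  case: (ger0P (ln (cn z))) => _.
    by rewrite lnK ?posrE // lerDl invr_ge0 ltW.
  by rewrite expRN lnK ?posrE // lerDr ltW.
have h2 : cn z <= K * (1 + re gam) * weight A.
  apply: (@le_trans _ _ (K * (re A + re gam))).
    by have := coneD dA (direction_cone gam_dir); rewrite /z /cone reD.
  rewrite -mulrA ler_wpM2l ?(ltW K0) // /weight.
  by have : 0 <= re gam * re A; [rewrite mulr_ge0 // ltW|lra].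
have h3 : (cn z)^-1 <= (re gam)^-1 * weight A.
  apply: (@le_trans _ _ (re gam)^-1); last by rewrite ler_peMr // invr_ge0 ltW.
  by rewrite lef_pV2 ?posrE //; apply: le_trans (re_cn z); rewrite /z reD lerDr.
apply: (@le_trans _ _ (expR (`|ln (cn z)| + pi))).
  by rewrite ler_expR cn_clog.
rewrite expRD mulrC /exp_log_cst -mulrA ler_wpM2l ?expR_ge0 // mulrDl.
by apply: (le_trans h1); apply: lerD.
Qed.

Lemma cn_shift_log_le A : cn (shift_log A) <= expR (cn (shift_log A)).
Proof. by apply: le_trans (expR_ge1Dx _); rewrite lerDr. Qed.

Lemma exp_scaled_log (s : nat) c A : cone A -> cn c <= s%:R ->
  expR (cn c * cn (shift_log A)) <= (exp_log_cst * weight A) ^+ s.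
Proof.
move=> dA cs; apply: (@le_trans _ _ (expR (s%:R * cn (shift_log A)))).
  by rewrite ler_expR ler_wpM2r // cn_ge0.
rewrite expRM_natl lerXn2r ?nnegrE ?expR_ge0 ?exp_cn_shift_log //.
exact: le_trans (expR_ge0 _) (exp_cn_shift_log dA).
Qed.

Lemma cn_shift_pow (s : nat) c A : cone A -> cn c <= s%:R ->
  cn (shift_pow c A) <= exp_log_cst ^+ s * weight A ^+ s.
Proof.
move=> dA cs; rewrite -exprMn; apply: le_trans (exp_scaled_log dA cs).
by rewrite -cnM; exact: cn_cexp_le.
Qed.

Definition shift_inv_cst : R := 1 + (re gam)^-1.

Lemma cn_shift_inv A : cone A -> cn (shift_inv A) <= shift_inv_cst * inv_weight A.
Proof.
move=> dA; have rz := re_shift_gt0 dA; have a0 := cone_re_ge0 K1 dA.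
have w0 := weight_gt0 K1 dA; rewrite shift_invE // cnV.
apply: (@le_trans _ _ (re (A + gam))^-1).
  by rewrite lef_pV2 ?posrE ?re_cn // cn_gt0 shift_neq0.
rewrite /inv_weight ler_pdivlMr // mulrC ler_pdivrMr // /shift_inv_cst reD mulrDl mul1r mulrDr mulVf ?lt0r_neq0 //.
have h : 0 <= (re gam)^-1 * re A by rewrite mulr_ge0 // invr_ge0 ltW.
rewrite /weight; move: gam_pos h; set x := _ * re A; lra.
Qed.

Lemma shift_inv_cst_ge0 : 0 <= shift_inv_cst.
Proof. by rewrite addr_ge0 // invr_ge0 ltW. Qed.

Lemma symb_mul_weight n k l W c d f g : 0 <= c -> 0 <= d ->
  slowly_varying K M k W -> 0 <= k -> (forall A, cone A -> 0 <= W A) ->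
  symb (@inv_weight R) n (fun A => c * weight A ^+ l) f ->
    symb (@inv_weight R) n (fun A => d * W A) g ->
  symb (@inv_weight R) n (fun A => (k + 1) ^+ n * (c * d) * (weight A ^+ l * W A)) (fun A =>
    f A * g A).
Proof.
move=> c0 d0 hs k0 W0 hf hg.
have he := inv_weight_decaying K1.
have h := symbM he he k0 (slowly_varyingZ d0 hs) hf hg.
have k1 : 1 <= k + 1 by rewrite lerDr.
apply: symb_le (symb_scale he k1 _) => //; last first.
  by move: h; congr symb; apply/funext => A; rewrite mulrDl mul1r.
by move=> A dA; rewrite le_eqVlt; apply/orP; left; apply/eqP; ring.
Qed.

Lemma slowly_varying_inv_weight1 : slowly_varying K M 1 (@inv_weight R).
Proof. by have := slowly_varying_inv_weight ler01;
  under [X in slowly_varying _ _ _ X]eq_fun do rewrite mul1r. Qed.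

(** The derivative is [- shift_inv ^ 2], which the product rule controls for as many differences as
    [shift_inv] itself; [symb_primitive] then provides one more. *)
Lemma symb_shift_inv n : exists2 c,
  0 <= c & symb (@inv_weight R) n (fun A => c * inv_weight A) shift_inv.
Proof.
elim: n => [|n [c c0 IH]].
  by exists shift_inv_cst; [exact: shift_inv_cst_ge0|split=> // A dA; exact: cn_shift_inv].
have he := inv_weight_decaying K1.
have h := symbM he he ler01 (slowly_varying_inv_weight c0) IH IH.
have h2 : symb (@inv_weight R) n (fun A => (2 ^+ n * (c * c)) * (inv_weight A * inv_weight A))
    (fun A => -1 * (shift_inv A * shift_inv A)).
  have two : 1 <= (2 : R) by rewrite ler1n.
  have h3 : symb (fun A => 2 * inv_weight A) n (fun A => c * inv_weight A * (c * inv_weight A))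
      (fun A => shift_inv A * shift_inv A).
    by move: h; congr symb; apply/funext => A; ring.
  have := symbZ (-1) (symb_scale he two h3).
  by congr symb; apply/funext => A; rewrite cnN cn1; ring.
have hd : has_derivative K M shift_inv (fun A => -1 * (shift_inv A * shift_inv A)) by exact: has_derivative_shift_pow.
have c2 : 0 <= 2 ^+ n * (c * c) :> R by rewrite mulr_ge0 ?exprn_ge0 ?mulr_ge0.
have hb (A : R[i]) : cone A -> 0 <= inv_weight A by exact: inv_weight_ge0.
have := symb_primitive slowly_varying_inv_weight1 hb ler01 shift_inv_cst_ge0 c2 hd cn_shift_inv h2.
eexists; last by eassumption.
by rewrite addr_ge0 ?shift_inv_cst_ge0 // mulr_ge0 // !mulr_ge0 // ltW // aperture_gt0.
Qed.

Lemma weightX_ge0 k A : cone A -> 0 <= weight A ^+ k.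
Proof. by move=> dA; apply: le_trans (weightX_ge1 K1 k dA). Qed.

Lemma symb_mul_shift_inv n : exists2 d, 0 <= d & forall l c f, 0 <= c ->
  symb (@inv_weight R) n (fun A => c * weight A ^+ l) f ->
  symb (@inv_weight R) n (fun A => d * c * (weight A ^+ l * inv_weight A)) (fun A =>
    f A * shift_inv A).
Proof.
have [d d0 hd] := symb_shift_inv n; exists (2 ^+ n * d) => [|l c f c0 hf].
  by rewrite mulr_ge0 // exprn_ge0.
have hb (A : R[i]) : cone A -> 0 <= inv_weight A by exact: inv_weight_ge0.
have := symb_mul_weight c0 d0 slowly_varying_inv_weight1 ler01 hb hf hd.
by congr symb; apply/funext => A; rewrite (_ : 1 + 1 = 2) //; set p := 2 ^+ n; ring.
Qed.

(** Induction on n through the derivative c z^c / z. The constant is uniform for [cn c <= s], so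
    that it covers a whole neighbourhood of an exponent. *)
Lemma symb_shift_pow n s : exists2 C, 0 <= C & forall c, cn c <= s%:R ->
  symb (@inv_weight R) n (fun A => C * weight A ^+ s) (shift_pow c).
Proof.
elim: n => [|n [C C0 IH]].
  exists (exp_log_cst ^+ s) => [|c cs]; first by rewrite exprn_ge0 // exp_log_cst_ge0.
  by split=> // A dA; exact: cn_shift_pow.
have [d d0 hd] := symb_mul_shift_inv n.
pose c1 := s%:R * (d * C).
have c10 : 0 <= c1 by rewrite !mulr_ge0.
have M1 : 0 <= (1 + M) ^+ s by rewrite exprn_ge0 // addr_ge0.
have L0 : 0 <= exp_log_cst ^+ s by rewrite exprn_ge0 // exp_log_cst_ge0.
exists (exp_log_cst ^+ s + 2 * (K * M) * (1 + M) ^+ s * c1) => [|c cs].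
  by rewrite addr_ge0 // !mulr_ge0 // ltW // aperture_gt0.
apply: symb_primitive (slowly_varying_weight s) (weightX_ge0 s) M1 L0 c10 (has_derivative_shift_pow c) _ _ => [A dA|].
  exact: cn_shift_pow.
apply: symb_le (symbZ c (hd _ _ _ C0 (IH c cs))); first exact: inv_weight_decaying.
move=> A dA; rewrite /c1 !mulrA ler_wpM2r ?(inv_weight_ge0 K1) // ler_wpM2r ?weightX_ge0 //.
by rewrite !ler_wpM2r.
Qed.

Lemma shift_log_exp_le (k : nat) A : cone A -> cn (shift_log A) ^+ k * expR (cn (shift_log A)) <=
  exp_log_cst ^+ k.+1 * weight A ^+ k.+1.
Proof.
move=> dA; rewrite -exprMn exprSr; have h := exp_cn_shift_log dA.
apply: ler_pM; rewrite ?exprn_ge0 ?cn_ge0 ?expR_ge0 //.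
rewrite lerXn2r ?nnegrE ?cn_ge0 ?(le_trans (cn_shift_log_le _)) //.
exact: le_trans (expR_ge0 _) h.
Qed.

Lemma symb_shift_log n : exists2 C,
  0 <= C & symb (@inv_weight R) n (fun A => C * weight A ^+ 1) shift_log.
Proof.
have hb A : cone A -> cn (shift_log A) <= exp_log_cst * weight A ^+ 1.
  by move=> dA; rewrite expr1; apply: le_trans (cn_shift_log_le _) (exp_cn_shift_log dA).
case: n => [|n]; first by exists exp_log_cst; [exact: exp_log_cst_ge0|split].
have [d d0 hd] := symb_shift_inv n.
have M1 : 0 <= (1 + M) ^+ 1 by rewrite exprn_ge0 // addr_ge0.
have h2 : symb (@inv_weight R) n (fun A => d * (weight A ^+ 1 * inv_weight A)) shift_inv.
  apply: symb_le hd; first exact: inv_weight_decaying.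
  move=> A dA; rewrite ler_wpM2l // ler_peMl ?(inv_weight_ge0 K1) //; exact (weightX_ge1 K1 1 dA).
exists (exp_log_cst + 2 * (K * M) * (1 + M) ^+ 1 * d).
  by rewrite addr_ge0 ?exp_log_cst_ge0 // !mulr_ge0 // ltW // aperture_gt0.
exact: symb_primitive (slowly_varying_weight 1) (weightX_ge0 1) M1 exp_log_cst_ge0 d0 has_derivative_shift_log hb h2.
Qed.

Lemma cn_scaled_log e c A : e <= 1 -> cn c <= e -> cn (c * shift_log A) <= cn (shift_log A).
Proof.
by move=> e1 ce; rewrite cnM ler_piMl ?cn_ge0 // (le_trans ce).
Qed.

(** The order 2 comes from [cexp_sub1]: one weight for |log z| and one for its exponential. Both the
    function and its derivative c z^c / z have size e. *)
Lemma symb_shift_pow_sub1 n : exists2 C, 0 <= C & forall (e : R) c, e <= 1 -> cn c <= e ->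
  symb (@inv_weight R) n (fun A => C * e * weight A ^+ 2) (fun A => shift_pow c A - 1).
Proof.
have L0 : 0 <= 2 * exp_log_cst ^+ 2 by rewrite mulr_ge0 // exprn_ge0 // exp_log_cst_ge0.
have hb (e : R) c : e <= 1 -> cn c <= e -> forall A, cone A ->
    cn (shift_pow c A - 1) <= 2 * exp_log_cst ^+ 2 * e * weight A ^+ 2.
  move=> e1 ce A dA; apply: (le_trans (cexp_sub1 _)); rewrite -/(shift_log A).
  have e0 := le_trans (cn_ge0 c) ce.
  apply: (@le_trans _ _ (2 * e * (cn (shift_log A) ^+ 1 * expR (cn (shift_log A))))).
    rewrite -mulrA ler_wpM2l // mulrA; apply: ler_pM; rewrite ?cn_ge0 ?expR_ge0 //.
      by rewrite cnM expr1 ler_wpM2r // cn_ge0.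
    by rewrite ler_expR (cn_scaled_log _ e1 ce).
  have -> : 2 * exp_log_cst ^+ 2 * e * weight A ^+ 2 = 2 * e * (exp_log_cst ^+ 2 * weight A ^+ 2) by ring.
  by apply: ler_wpM2l; [rewrite mulr_ge0|exact: shift_log_exp_le].
case: n => [|n].
  by exists (2 * exp_log_cst ^+ 2) => // e c e1 ce; split=> //; exact: hb.
have [C C0 hC] := symb_shift_pow n 1; have [d d0 hd] := symb_mul_shift_inv n.
have M1 : 0 <= (1 + M) ^+ 2 by rewrite exprn_ge0 // addr_ge0.
have K0 := ltW (aperture_gt0 K1).
exists (2 * exp_log_cst ^+ 2 + 2 * (K * M) * (1 + M) ^+ 2 * (d * C)) => [|e c e1 ce].
  by rewrite addr_ge0 // !mulr_ge0 // addr_ge0.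
have e0 := le_trans (cn_ge0 c) ce.
have a0 : 0 <= 2 * exp_log_cst ^+ 2 * e by rewrite mulr_ge0.
have b0 : 0 <= e * (d * C) by rewrite !mulr_ge0.
have hdr : has_derivative K M (fun A => shift_pow c A - 1) (fun A => c * (shift_pow c A * shift_inv A) - 0).
  by apply: has_derivativeB; [exact: has_derivative_shift_pow|exact: has_derivative_cst].
have := symb_primitive (slowly_varying_weight 2) (weightX_ge0 2) M1 a0 b0 hdr (hb e c e1 ce) _.
have c1 : cn c <= 1%:R by rewrite (le_trans ce).
have h2 := symbZ c (hd _ _ _ C0 (hC c c1)).
move=> h; apply: (symb_le (inv_weight_decaying K1) _ (h n _)).
  by move=> A dA; rewrite le_eqVlt; apply/orP; left; apply/eqP; ring.
under [X in symb _ _ _ X]eq_fun do rewrite subr0.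
apply: symb_le h2; first exact: inv_weight_decaying.
move=> A dA; have w1 := weight_ge1 K1 dA; have t0 := inv_weight_ge0 K1 dA.
have w0 : 0 <= weight A by rewrite (le_trans _ w1).
have -> : cn c * (d * C * (weight A ^+ 1 * inv_weight A)) = cn c * (d * C * weight A ^+ 1 * inv_weight A) by ring.
have -> : e * (d * C) * (weight A ^+ 2 * inv_weight A) = e * (d * C * weight A ^+ 2 * inv_weight A) by ring.
apply: ler_pM; rewrite ?cn_ge0 //; first by rewrite !mulr_ge0 // exprn_ge0.
by rewrite ler_wpM2r // ler_wpM2l ?mulr_ge0 // ler_weXn2l.
Qed.

(** The derivative of the remainder is c (z^c - 1) / z. Here c has size e and z^c - 1 has size e by
    [symb_shift_pow_sub1], which gives the square. *)
Lemma symb_shift_pow_taylor n : exists2 C, 0 <= C & forall (e : R) c, e <= 1 -> cn c <= e ->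
  symb (@inv_weight R) n (fun A => C * e ^+ 2 * weight A ^+ 3) (fun A =>
    shift_pow c A - 1 - c * shift_log A).
Proof.
have L0 : 0 <= 4 * exp_log_cst ^+ 3 by rewrite mulr_ge0 // exprn_ge0 // exp_log_cst_ge0.
have hb (e : R) c : e <= 1 -> cn c <= e -> forall A, cone A ->
    cn (shift_pow c A - 1 - c * shift_log A) <= 4 * exp_log_cst ^+ 3 * e ^+ 2 * weight A ^+ 3.
  move=> e1 ce A dA; apply: (le_trans (cexp_sub2 _)); rewrite -/(shift_log A).
  have e0 := le_trans (cn_ge0 c) ce.
  apply: (@le_trans _ _ (4 * e ^+ 2 * (cn (shift_log A) ^+ 2 * expR (cn (shift_log A))))).
    rewrite -mulrA ler_wpM2l // mulrA; apply: ler_pM; rewrite ?exprn_ge0 ?cn_ge0 ?expR_ge0 //.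
      rewrite cnM exprMn ler_wpM2r ?exprn_ge0 ?cn_ge0 //.
      by rewrite lerXn2r ?nnegrE ?cn_ge0.
    by rewrite ler_expR (cn_scaled_log _ e1 ce).
  have -> : 4 * exp_log_cst ^+ 3 * e ^+ 2 * weight A ^+ 3 = 4 * e ^+ 2 * (exp_log_cst ^+ 3 * weight A ^+ 3) by ring.
  by apply: ler_wpM2l; [rewrite mulr_ge0 // exprn_ge0|exact: shift_log_exp_le].
case: n => [|n].
  by exists (4 * exp_log_cst ^+ 3) => // e c e1 ce; split=> //; exact: hb.
have [C C0 hC] := symb_shift_pow_sub1 n; have [d d0 hd] := symb_mul_shift_inv n.
have M1 : 0 <= (1 + M) ^+ 3 by rewrite exprn_ge0 // addr_ge0.
have K0 := ltW (aperture_gt0 K1).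
exists (4 * exp_log_cst ^+ 3 + 2 * (K * M) * (1 + M) ^+ 3 * (d * C)) => [|e c e1 ce].
  by rewrite addr_ge0 // !mulr_ge0 // addr_ge0.
have e0 := le_trans (cn_ge0 c) ce.
have a0 : 0 <= 4 * exp_log_cst ^+ 3 * e ^+ 2 by rewrite mulr_ge0 // exprn_ge0.
have b0 : 0 <= e ^+ 2 * (d * C) by rewrite !mulr_ge0 // exprn_ge0.
have hdr : has_derivative K M (fun A => shift_pow c A - 1 - c * shift_log A)
    (fun A => c * (shift_pow c A * shift_inv A) - 0 - c * shift_inv A).
  apply: has_derivativeB; last by apply: has_derivativeZ; exact: has_derivative_shift_log.
  by apply: has_derivativeB; [exact: has_derivative_shift_pow|exact: has_derivative_cst].
have := symb_primitive (slowly_varying_weight 3) (weightX_ge0 3) M1 a0 b0 hdr (hb e c e1 ce) _.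
have Ce0 : 0 <= C * e by rewrite mulr_ge0.
have h2 := symbZ c (hd _ _ _ Ce0 (hC e c e1 ce)).
move=> h; apply: (symb_le (inv_weight_decaying K1) _ (h n _)).
  by move=> A dA; rewrite le_eqVlt; apply/orP; left; apply/eqP; ring.
have -> : (fun A => c * (shift_pow c A * shift_inv A) - 0 - c * shift_inv A) =
    (fun A => c * ((shift_pow c A - 1) * shift_inv A)) by apply/funext => A; ring.
apply: symb_le h2; first exact: inv_weight_decaying.
move=> A dA; have w1 := weight_ge1 K1 dA; have t0 := inv_weight_ge0 K1 dA.
have w0 : 0 <= weight A by rewrite (le_trans _ w1).
have -> : cn c * (d * (C * e) * (weight A ^+ 2 * inv_weight A)) =
  cn c * (e * (d * C * weight A ^+ 2 * inv_weight A)) by ring.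
have -> : e ^+ 2 * (d * C) * (weight A ^+ 3 * inv_weight A) =
  e * (e * (d * C * weight A ^+ 3 * inv_weight A)) by ring.
apply: ler_pM; rewrite ?cn_ge0 //; first by rewrite !mulr_ge0 // exprn_ge0.
apply: ler_wpM2l => //; rewrite ler_wpM2r // ler_wpM2l ?mulr_ge0 // ler_weXn2l //.
Qed.
End PowerSymbols.

(** * Symbols depending uniformly on a parameter *)

Section UniformSymbols.
Context {R : realType} (K M : R) (K1 : 1 <= K) (M0 : 0 <= M).

Local Notation symb := (symb K M).
Local Notation cone := (cone K).
Local Notation direction := (direction K M).

(* [F t] is a symbol of order [k] and size [rho t], uniformly in the parameter
   [t]; the constant may depend on the number of differences. *)
Definition usymb (T : Type) (P : T -> Prop) (rho : T -> R) k (F : T -> R[i] -> R[i]) :=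
  forall n, exists2 C, 0 <= C &
    forall t, P t -> symb (@inv_weight R) n (fun A => C * rho t * weight A ^+ k) (F t).

Context (T : Type) (P : T -> Prop).
Implicit Types (rho sig : T -> R) (F G : T -> R[i] -> R[i]).

Definition nonneg rho := forall t, P t -> 0 <= rho t.

Lemma usymb_ext rho k F G : (forall t A, P t -> cone A -> F t A = G t A) ->
  usymb P rho k F -> usymb P rho k G.
Proof.
move=> e hF n; have [C C0 h] := hF n; exists C => // t Pt.
by apply: symb_ext (h t Pt) => A; exact: e.
Qed.

Lemma usymb_eq rho k F G : (forall t A, F t A = G t A) -> usymb P rho k F -> usymb P rho k G.
Proof. by move=> e; apply: usymb_ext => t A _ _; exact: e. Qed.

Lemma usymb_order rho k l F : nonneg rho -> (k <= l)%N -> usymb P rho k F -> usymb P rho l F.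
Proof.
move=> r0 kl hF n; have [C C0 h] := hF n; exists C => // t Pt.
apply: symb_le (h t Pt); first exact: inv_weight_decaying.
by move=> A dA; rewrite ler_wpM2l ?mulr_ge0 ?r0 // ler_weXn2l // (weight_ge1 K1).
Qed.

Lemma usymb_size rho sig k F : (forall t, P t -> rho t <= sig t) ->
  usymb P rho k F -> usymb P sig k F.
Proof.
move=> rs hF n; have [C C0 h] := hF n; exists C => // t Pt.
apply: symb_le (h t Pt); first exact: inv_weight_decaying.
by move=> A dA; rewrite ler_wpM2r ?(weightX_ge0 K1) // ler_wpM2l // rs.
Qed.

Lemma usymbD rho k F G : usymb P rho k F -> usymb P rho k G ->
  usymb P rho k (fun t A => F t A + G t A).
Proof.
move=> hF hG n; have [C C0 h] := hF n; have [D D0 h'] := hG n.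
exists (C + D) => [|t Pt]; first exact: addr_ge0.
have := symbD (h t Pt) (h' t Pt); congr symb; apply/funext => A; ring.
Qed.

Lemma usymbZ rho sig k (c : T -> R[i]) F : nonneg rho -> (forall t, P t -> cn (c t) <= sig t) ->
  usymb P rho k F -> usymb P (fun t => sig t * rho t) k (fun t A => c t * F t A).
Proof.
move=> r0 hc hF n; have [C C0 h] := hF n; exists C => // t Pt.
apply: symb_le (symbZ (c t) (h t Pt)); first exact: inv_weight_decaying.
move=> A dA; have -> : C * (sig t * rho t) * weight A ^+ k = sig t * (C * rho t * weight A ^+ k).
  by ring.
by rewrite ler_wpM2r ?hc // !mulr_ge0 ?r0 // (weightX_ge0 K1).
Qed.

Lemma usymbM rho sig k l F G : nonneg rho -> nonneg sig ->
  usymb P rho k F -> usymb P sig l G ->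
  usymb P (fun t => rho t * sig t) (k + l) (fun t A => F t A * G t A).
Proof.
move=> r0 s0 hF hG n; have [C C0 h] := hF n; have [D D0 h'] := hG n.
have m0 : 0 <= (1 + M) ^+ l by rewrite exprn_ge0 // addr_ge0.
exists (((1 + M) ^+ l + 1) ^+ n * (C * D)) => [|t Pt].
  by rewrite mulr_ge0 ?exprn_ge0 ?mulr_ge0 // addr_ge0.
have c0 : 0 <= C * rho t by rewrite mulr_ge0 ?r0.
have d0 : 0 <= D * sig t by rewrite mulr_ge0 ?s0.
have := symb_mul_weight K1 c0 d0 (slowly_varying_weight K1 M0 l) m0 (fun A dA => weightX_ge0 K1 l dA) (h t Pt) (h' t Pt).
by congr symb; apply/funext => A; rewrite exprD; ring.
Qed.

Lemma usymb_translate rho k F u : direction u -> nonneg rho -> usymb P rho k F ->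
  usymb P rho k (fun t => translate u (F t)).
Proof.
move=> du r0 hF n; have [C C0 h] := hF n; exists ((1 + M) ^+ k * C) => [|t Pt].
  by rewrite mulr_ge0 // exprn_ge0 // addr_ge0.
have c0 : 0 <= C * rho t by rewrite mulr_ge0 ?r0.
have := symb_shift_slow (inv_weight_decaying K1) (slowly_varyingZ c0 (slowly_varying_weight K1 M0 k)) du (h t Pt).
by congr symb; apply/funext => A; rewrite !mulrA.
Qed.

Lemma usymb_regular rho k F (gam : R[i]) t A : direction gam -> 0 < re gam -> usymb P rho k F ->
  P t -> cone A -> regular gam (F t) A.
Proof.
move=> gd gp hF Pt dA; have [C C0 h] := hF k.+2.
(* Regularity does not mention a twist; 0 is supplied for the one that [weight_diff_summable]
   expects. *)
have z1 : cn (0 : R[i]) <= 1 by rewrite cn0.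
by exists k.+2; exact (weight_diff_summable K1 z1 gd gp dA (h t Pt)).
Qed.

(** Summation consumes k + 2 differences, which is why the class asks for bounds at every number of
    differences: the result is then again in the class, with the same order and size. *)
Lemma usymb_tsum rho k F (xi gam : R[i]) : cn xi <= 1 -> xi != 1 -> direction gam -> 0 < re gam ->
  usymb P rho k F -> usymb P rho k (fun t A => xi * tsum xi gam (F t) A).
Proof.
move=> x1 x2 gd gp hF n; have [C C0 h] := hF (n + k.+2)%N.
have q0 := tsum_cst_ge0 xi gp k.+2.
exists (tsum_cst xi gam k.+2 * C) => [|t Pt]; first by rewrite mulr_ge0.
apply: symb_le (symbZ xi (symb_tsum_weight K1 x1 x2 gd gp (h t Pt)));
  first exact: inv_weight_decaying.
move=> A dA; have -> : tsum_cst xi gam k.+2 * C * rho t * weight A ^+ k =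
  tsum_cst xi gam k.+2 * (C * rho t) * weight A ^+ k by ring.
apply: ler_piMl => //; have := symb_W_ge0 (h t Pt) dA => w.
by rewrite -mulrA mulr_ge0.
Qed.

Lemma usymb_cst k c : usymb P (fun=> cn c) k (fun _ _ => c).
Proof.
move=> n; exists 1 => // t Pt; apply: symb_le (symb_cst M n c (inv_weight_decaying K1)).
  exact: inv_weight_decaying.
by move=> A dA; rewrite mul1r ler_peMr ?cn_ge0 // (weightX_ge1 K1).
Qed.

Lemma usymb0 rho k : nonneg rho -> usymb P rho k (fun _ _ => 0).
Proof.
move=> r0 n; exists 0 => // t Pt; apply: symb_le (symb_cst M n 0 (inv_weight_decaying K1)).
  exact: inv_weight_decaying.
by move=> A dA; rewrite cn0 !mul0r.
Qed.

Lemma usymb_const_family (f : R[i] -> R[i]) k :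
  (forall n, exists2 C, 0 <= C & symb (@inv_weight R) n (fun A => C * weight A ^+ k) f) ->
  usymb P (fun=> 1) k (fun=> f).
Proof.
move=> h n; have [C C0 hC] := h n; exists C => // t _.
by move: hC; congr symb; apply/funext => A; rewrite mulr1.
Qed.
End UniformSymbols.

Lemma usymb_comp (R : realType) (K M : R) (T T' : Type) (P : T -> Prop) (P' : T' -> Prop)
    (phi : T' -> T) rho k F :
  (forall t, P' t -> P (phi t)) -> usymb K M P rho k F ->
  usymb K M P' (fun t => rho (phi t)) k (fun t => F (phi t)).
Proof. by move=> h hF n; have [C C0 hC] := hF n; exists C => // t /h; exact: hC. Qed.

(** * The continuation and its differentiability *)

Section MultipleSum.
Context {R : realType}.

Definition tail r (T : Type) (f : 'I_r.+1 -> T) : 'I_r -> T := fun i => f (lift ord0 i).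

(* Regularised value of the series in which the offset [A] is added to every
   linear form [m_1 gamma_1 + ... + m_j gamma_j]: the inner sums over
   [m_2, ..., m_r] see the outer variable only through the offset. *)
Fixpoint zeta_ext r : ('I_r -> R[i]) -> ('I_r -> R[i]) -> ('I_r -> R[i]) -> R[i] -> R[i] :=
  match r with
  | 0 => fun _ _ _ _ => 1
  | r'.+1 => fun xi gam s A => xi ord0 * tsum (xi ord0) (gam ord0)
      (fun a => shift_pow (gam ord0) (- s ord0) a *
                translate (gam ord0) (zeta_ext (tail xi) (tail gam) (tail s)) a) A
  end.

Context (K M : R) (K1 : 1 <= K) (M0 : 0 <= M).

(* A perturbation [t.2] of the exponents, together with a bound [t.1] on its
   coordinates. *)
Definition perturbation r : Type := (R * ('I_r -> R[i]))%type.
Definition small_pert r (t : perturbation r) := 0 <= t.1 <= 1 /\ forall j, cn (t.2 j) <= t.1.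

Local Notation B r := (usymb K M (@small_pert r)).

(* Every bound comes with the class, so that the first order expansion in [s] can
   be propagated through the outer twisted sums by induction on [r]. *)
Lemma zeta_ext_taylor r (xi gam s : 'I_r -> R[i]) :
  (forall j, cn (xi j) <= 1) -> (forall j, xi j != 1) ->
  (forall j, direction K M (gam j)) -> (forall j, 0 < re (gam j)) ->
  exists k (l : 'I_r -> R[i] -> R[i]),
  [/\ forall j, B r (fun=> 1) k (fun=> l j),
      B r (fun=> 1) k (fun t => zeta_ext xi gam (fun j => s j + t.2 j)),
      B r (fun t => t.1) k
        (fun t A => zeta_ext xi gam (fun j => s j + t.2 j) A - zeta_ext xi gam s A) &
      B r (fun t => t.1 ^+ 2) k
        (fun t A => zeta_ext xi gam (fun j => s j + t.2 j) A - zeta_ext xi gam s A -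
                    \sum_j t.2 j * l j A)].
Proof.
elim: r xi gam s => [|r IH] xi gam s x1 x2 gd gp.
  exists 0%N, (fun _ _ => 0); split; first by case.
  - by apply: (usymb_size K1 _ (usymb_cst M K1 (@small_pert 0) 0 1)) => // t _; rewrite cn1.
  - apply: (usymb_eq _ (usymb0 M K1 0 _)) => [t A|t [/andP[t0 _] _]]; last exact: t0.
    by rewrite subrr.
  - apply: (usymb_eq _ (usymb0 M K1 0 _)) => [t A|t _]; last exact: sqr_ge0.
    by rewrite big_ord0 subrr subr0.
have [k [l [hl hX hX1 hX2]]] := IH (tail xi) (tail gam) (tail s)
  (fun j => x1 _) (fun j => x2 _) (fun j => gd _) (fun j => gp _).
set g := gam ord0; have gd0 : direction K M g := gd _; have gp0 : 0 < re g := gp _.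
pose phi (t : perturbation r.+1) : perturbation r := (t.1, tail t.2).
have hphi t : small_pert t -> small_pert (phi t) by case=> a b; split=> // j; exact: b.
pose X0 : R[i] -> R[i] := translate g (zeta_ext (tail xi) (tail gam) (tail s)).
pose X (t : perturbation r.+1) : R[i] -> R[i] :=
  translate g (zeta_ext (tail xi) (tail gam) (fun j => tail s j + tail t.2 j)).
have n1 r' : nonneg (@small_pert r') (fun=> (1 : R)) by move=> t _; exact: ler01.
have ne r' : nonneg (@small_pert r') (fun t => t.1) by move=> t [/andP[]].
have ne2 r' : nonneg (@small_pert r') (fun t => t.1 ^+ 2) by move=> t _; exact: sqr_ge0.
have bX : B r.+1 (fun=> 1) k X.
  exact: (usymb_comp hphi (usymb_translate K1 M0 gd0 (n1 r) hX)).
have bX1 : B r.+1 (fun t => t.1) k (fun t A => X t A - X0 A).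
  exact: (usymb_comp hphi (usymb_translate K1 M0 gd0 (ne r) hX1)).
have bX2 : B r.+1 (fun t => t.1 ^+ 2) k
    (fun t A => X t A - X0 A - \sum_j tail t.2 j * translate g (l j) A).
  exact: (usymb_comp hphi (usymb_translate K1 M0 gd0 (ne2 r) hX2)).
have bl j : B r.+1 (fun=> 1) k (fun=> translate g (l j)).
  exact: (usymb_comp hphi (usymb_translate K1 M0 gd0 (n1 r) (hl j))).
(* The zero perturbation transfers the bounds on the perturbed family to the unperturbed
   function. *)
have z0 : small_pert ((0, fun=> 0) : perturbation r.+1).
  by split; [rewrite /= lexx ler01|move=> j; change (cn (0 : R[i]) <= 0); rewrite cn0].
have X0E : X (0, fun=> 0) = X0.
  by rewrite /X /X0; congr (translate _ (zeta_ext _ _ _)); apply/funext => j; rewrite /tail addr0.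
have bX0 : B r.+1 (fun=> 1) k (fun=> X0).
  by have := @usymb_comp _ K M _ _ (@small_pert r.+1) (@small_pert r.+1) (fun=> (0, fun=> 0)) _ _ _
    (fun t _ => z0) bX; rewrite X0E.
(* One order for all exponents s_1 + h with |h| at most 1. *)
have [S hS] : exists S : nat, cn (s ord0) + 1 <= S%:R.
  exists (Num.bound (cn (s ord0) + 1)); apply: ltW; apply: le_lt_trans (archi_boundP _).
    by [].
  by rewrite addr_ge0 // cn_ge0.
pose p : R[i] -> R[i] := shift_pow g (- s ord0).
have bp : B r.+1 (fun=> 1) S (fun=> p).
  apply: usymb_const_family => n; have [C C0 hC] := symb_shift_pow K1 M0 gd0 gp0 n S; exists C =>
    //.
  by apply: hC; rewrite cnN; apply: le_trans hS; rewrite lerDl.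
have bE : B r.+1 (fun=> 1) S (fun t => shift_pow g (- (s ord0 + t.2 ord0))).
  move=> n; have [C C0 hC] := symb_shift_pow K1 M0 gd0 gp0 n S; exists C => // t [/andP[t0 t1] h].
  rewrite mulr1; apply: hC; rewrite cnN; apply: le_trans hS.
  by apply: (le_trans (cnD _ _)); rewrite lerD2l (le_trans (h _)).
have bE1 : B r.+1 (fun t => t.1) 2 (fun t A => shift_pow g (- t.2 ord0) A - 1).
  move=> n; have [C C0 hC] := symb_shift_pow_sub1 K1 M0 gd0 gp0 n; exists C =>
    // t [/andP[t0 t1] h].
  by apply: hC => //; rewrite cnN.
have bE2 : B r.+1 (fun t => t.1 ^+ 2) 3
    (fun t A => shift_pow g (- t.2 ord0) A - 1 - (- t.2 ord0) * shift_log g A).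
  move=> n; have [C C0 hC] := symb_shift_pow_taylor K1 M0 gd0 gp0 n; exists C =>
    // t [/andP[t0 t1] h].
  by apply: hC => //; rewrite cnN.
have bL : B r.+1 (fun=> 1) 1 (fun=> shift_log g).
  by apply: usymb_const_family => n; exact: symb_shift_log.
pose G t A := shift_pow g (- (s ord0 + t.2 ord0)) A * X t A.
pose G0 A := p A * X0 A.
(* The partial derivatives of the summand: the first exponent brings down - log z, the others act on
   the inner factor only. *)
pose lG (j : 'I_r.+1) A := if unlift ord0 j is Some j' then p A * translate g (l j') A
  else p A * (- shift_log g A * X0 A).
have lG0 A : lG ord0 A = p A * (- shift_log g A * X0 A) by rewrite /lG unlift_none.
have lGS j A : lG (lift ord0 j) A = p A * translate g (l j) A by rewrite /lG liftK.
have hlt (t : perturbation r.+1) : small_pert t -> cn (- t.2 ord0) <= t.1 by case=> _ h;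
  rewrite cnN.
(* Common order for all terms: S from the power, k from the inner factor, and at most 3 from the
   logarithm and the Taylor remainders of the power. *)
have up a b : (a <= b + 3)%N -> (S + a <= S + (b + 3))%N by rewrite leq_add2l.
have bG : B r.+1 (fun=> 1) (S + (k + 3)) G.
  apply: (usymb_order K1 (n1 _) (up _ _ (leq_addr 3 k)) _).
  by apply: (usymb_size K1 _ (usymbM K1 M0 (n1 _) (n1 _) bE bX)) => // t _; rewrite mulr1.
have bG1 : B r.+1 (fun t => t.1) (S + (k + 3)) (fun t A => G t A - G0 A).
  have h1 : B r.+1 (fun t => t.1) (k + 3) (fun t A => (shift_pow g (- t.2 ord0) A - 1) * X t A).
    apply: (usymb_order K1 (ne _) _ (usymb_size K1 _ (usymbM K1 M0 (ne _) (n1 _) bE1 bX))) => //.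
      by rewrite addnC leq_add2l.
    by move=> t _; rewrite mulr1.
  have h2 := usymbD h1 (usymb_order K1 (ne _) (leq_addr 3 k) bX1).
  apply: (usymb_eq _ (usymb_size K1 _ (usymbM K1 M0 (n1 _) (ne _) bp h2))).
    by move=> t A; rewrite /G /G0 /p opprD shift_powD; ring.
  by move=> t _; rewrite mul1r.
(* With h the perturbation of s_1, the remainder is p times the sum of three terms: (z^(-h) - 1 + h
   log z) X, - h log z (X - X0), and the inner remainder. The middle one is quadratic as a product
   of two factors of first order. *)
have bG2 : B r.+1 (fun t => t.1 ^+ 2) (S + (k + 3))
    (fun t A => G t A - G0 A - \sum_j t.2 j * lG j A).
  have h1 : B r.+1 (fun t => t.1 ^+ 2) (k + 3)
      (fun t A => (shift_pow g (- t.2 ord0) A - 1 - (- t.2 ord0) * shift_log g A) * X t A).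
    rewrite addnC; apply: (usymb_size K1 _ (usymbM K1 M0 (ne2 _) (n1 _) bE2 bX)).
    by move=> t _; rewrite mulr1.
  have h2 : B r.+1 (fun t => t.1 ^+ 2) (k + 3)
      (fun t A => - t.2 ord0 * (shift_log g A * (X t A - X0 A))).
    have h3 := usymbM K1 M0 (n1 _) (ne _) bL bX1.
    have n3 : nonneg (@small_pert r.+1) (fun t => 1 * t.1) by move=> t h; rewrite mul1r (ne _ t h).
    have h4 := usymbZ K1 n3 hlt h3.
    apply: (usymb_order K1 (ne2 _) _ (usymb_size K1 _ h4)) => //.
      by rewrite addnC leq_add2l.
    by move=> t _; rewrite mul1r expr2.
  have h5 := usymbD (usymbD h1 h2) (usymb_order K1 (ne2 _) (leq_addr 3 k) bX2).
  apply: (usymb_eq _ (usymb_size K1 _ (usymbM K1 M0 (n1 _) (ne2 _) bp h5))).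
    move=> t A; rewrite /G /G0 big_ord_recl lG0.
    under [in RHS]eq_bigr do rewrite lGS mulrCA.
    by rewrite -mulr_sumr /p opprD shift_powD /tail; ring.
  by move=> t _; rewrite mul1r.
have blG j : B r.+1 (fun=> 1) (S + (k + 3)) (fun=> lG j).
  rewrite /lG; case: unliftP => [j' _|_].
    apply: (usymb_order K1 (n1 _) (up _ _ (leq_addr 3 k)) _).
    by apply: (usymb_size K1 _ (usymbM K1 M0 (n1 _) (n1 _) bp (bl j'))) => // t _; rewrite mulr1.
  have h1 := usymbM K1 M0 (n1 _) (n1 _) bL bX0.
  have n3 : nonneg (@small_pert r.+1) (fun=> 1 * 1 : R) by move=> t _; rewrite mul1r ler01.
  have h2 : B r.+1 (fun=> 1) (1 + k) (fun _ A => - shift_log g A * X0 A).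
    have hc (t : perturbation r.+1) : small_pert t -> cn (-1 : R[i]) <= 1 by rewrite cnN cn1.
    have h3 := usymbZ (c := fun=> -1) (sig := fun=> 1) K1 n3 hc h1.
    apply: (usymb_eq _ (usymb_size K1 _ h3)).
      by move=> t A; rewrite mulN1r mulNr.
    by move=> t _; rewrite !mulr1.
  have h3 := usymb_size K1 _ (usymbM K1 M0 (n1 _) (n1 _) bp h2).
  apply: (usymb_order K1 (n1 _) (up _ _ _) (h3 (fun=> 1) _)); last by move=> t _; rewrite mulr1.
  by rewrite addnC leq_add2l.
have x10 : cn (xi ord0) <= 1 := x1 _; have x20 : xi ord0 != 1 := x2 _.
have HfE t : zeta_ext xi gam (fun j => s j + t.2 j) = fun A => xi ord0 * tsum (xi ord0) g (G t) A.
  by [].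
have GE : G (0, fun=> 0) = G0 by apply/funext => A; rewrite /G X0E /= addr0.
have smlG t A : small_pert t -> cone K A -> regular g (G t) A.
  exact: (usymb_regular K1 gd0 gp0 bG).
have smlG0 A : cone K A -> regular g G0 A by rewrite -GE; exact: smlG.
have smll j A : cone K A -> regular g (lG j) A.
  exact: (usymb_regular K1 gd0 gp0 (blG j) z0).
exists (S + (k + 3))%N, (fun j A => xi ord0 * tsum (xi ord0) g (lG j) A); split.
- by move=> j; exact: (usymb_tsum K1 x10 x20 gd0 gp0 (blG j)).
- exact: (usymb_tsum K1 x10 x20 gd0 gp0 bG).
- apply: (usymb_ext _ (usymb_tsum K1 x10 x20 gd0 gp0 bG1)) => t A ht dA.
  by rewrite (tsumB x10 x20 (smlG t A ht dA) (smlG0 A dA)) mulrBr.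
- apply: (usymb_ext _ (usymb_tsum K1 x10 x20 gd0 gp0 bG2)) => t A ht dA.
  have [q1 q2] := tsum_lincomb x10 x20 t.2 (fun j => smll j A dA).
  have q3 : regular g (fun A => G t A - G0 A) A.
    exact: (usymb_regular K1 gd0 gp0 bG1 ht dA).
  rewrite (tsumB x10 x20 q3 q1) q2 (tsumB x10 x20 (smlG t A ht dA) (smlG0 A dA)).
  rewrite !mulrBr mulr_sumr; congr (_ - _).
  by apply: eq_bigr => j _; rewrite mulrCA.
Qed.
End MultipleSum.

(** * From the first order expansion to complex differentiability *)

Section Entire.
Context {R : realType}.

Definition linform r (l : 'I_r -> R[i]) (h : 'rV[R[i]]_r) : R[i] := \sum_j h 0 j * l j.

Fact linform_linear r (l : 'I_r -> R[i]) : linear (linform l).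
Proof.
move=> a u v; rewrite /linform scaler_sumr -big_split /=; apply: eq_bigr => j _.
by rewrite !mxE mulrDl /GRing.scale /= mulrA.
Qed.

HB.instance Definition _ r (l : 'I_r -> R[i]) :=
  GRing.isLinear.Build R[i] 'rV[R[i]]_r R[i] *:%R (linform l) (linform_linear l).

Lemma cn_coord_le r (h : 'rV[R[i]]_r) j : cn (h 0 j) <= re `|h|.
Proof.
have : `|h 0 j| <= `|h|.
  rewrite [leRHS]/Num.norm /= mx_normE.
  have e : `|h 0 j| = (`|h 0 j|%:nng)%:num by [].
  rewrite [leLHS]e num_le.
  exact: (le_bigmax _ (fun i : 'I_1 * 'I_r => `|h i.1 i.2|%:nng) (0, j)).
by rewrite normE lecE => /andP[].
Qed.

Lemma eps_real (eps : R[i]) : 0 < eps -> 0 < re eps /\ eps = (re eps)%:C%C.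
Proof.
by rewrite ltcE /= => /andP[/eqP i0 r0]; case: eps i0 r0 => a b /= ->.
Qed.

Lemma cn_linform r (l : 'I_r -> R[i]) h : cn (linform l h) <= (\sum_j cn (l j)) * re `|h|.
Proof.
apply: (le_trans (cn_sum _ _ _)); rewrite mulr_suml; apply: ler_sum => j _.
by rewrite cnM mulrC ler_wpM2l ?cn_ge0 // cn_coord_le.
Qed.

Lemma linform_continuous r (l : 'I_r -> R[i]) : continuous (linform l).
Proof.
move=> h; apply/(@cvgrPdist_lt _ _ _ (nbhs h) _ (linform l)) => eps /eps_real [er ei].
pose S := \sum_j cn (l j).
have S1 : 0 < S + 1 by rewrite ltr_wpDl // sumr_ge0 // => j _; exact: cn_ge0.
have d0 : (0 : R[i]) < (re eps / (S + 1))%:C%C by rewrite ltcR divr_gt0.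
near=> u.
have hd : `|h - u| < (re eps / (S + 1))%:C%C by near: u;
  exact: (@cvgr_dist_lt _ _ _ (nbhs h) _ id h cvg_id _ d0).
have nh : `|h - u| = (re `|h - u|)%:C%C by rewrite RRe_real // normr_real.
move: hd; rewrite nh ltcR ltr_pdivlMr // => hd.
rewrite -linearB normE ei ltcR; apply: le_lt_trans (cn_linform _ _) _.
apply: le_lt_trans hd; rewrite mulrC ler_wpM2l ?lerDl //.
by rewrite -ler0c -nh.
Unshelve. all: by end_near. Qed.

(** Apply the hypothesis with e the sup norm of h: once e is below eps / (|C| + 1), the remainder is
    at most eps e. Hence [linform l] is the differential. *)
Lemma differentiable_quad r (F : 'rV[R[i]]_r -> R[i]) (s : 'rV[R[i]]_r) (l : 'I_r -> R[i]) (C :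
  R) :
  (forall (e : R) (h : 'rV[R[i]]_r), 0 <= e <= 1 -> (forall j, cn (h 0 j) <= e) ->
    cn (F (s + h) - F s - linform l h) <= C * e ^+ 2) -> differentiable F s.
Proof.
move=> H.
have dc := @linform_continuous r l.
have dF : F \o shift s = cst (F s) + linform l +o_ (0 : 'rV[R[i]]_r) id.
  apply/eqaddoP => eps /eps_real [er ei].
  have C1 : 0 < `|C| + 1 by rewrite ltr_wpDl.
  pose d := Num.min 1 (re eps / (`|C| + 1)).
  have d0 : 0 < d by rewrite lt_min ltr01 divr_gt0.
  have dC : (0 : R[i]) < d%:C%C by rewrite ltcR.
  near=> h.
  have hd : `|h| < d%:C%C.
    by near: h; exact: (@nbhs0_lt _ 'rV[R[i]]_r _ dC).
  have nh : `|h| = (re `|h|)%:C%C by rewrite RRe_real // normr_real.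
  set e := re `|h| in nh *.
  have e0 : 0 <= e by rewrite -ler0c -nh.
  have ed : e < d by rewrite -ltcR -nh.
  have [e1 e2] : e < 1 /\ e < re eps / (`|C| + 1).
    by move: ed; rewrite lt_min => /andP[].
  have -> : (F \o shift s - (cst (F s) + linform l)) h = F (s + h) - F s - linform l h.
    by rewrite !fctE /= [h + s]addrC opprD addrA.
  rewrite normE ei nh -rmorphM lecR.
  apply: (le_trans (H e h _ _)); first by rewrite e0 ltW.
    by move=> j; exact: cn_coord_le.
  move: e2; rewrite ltr_pdivlMr // => e2.
  rewrite expr2 mulrA ler_wpM2r //; apply: le_trans (ltW e2).
  rewrite mulrC ler_wpM2l //; apply: (le_trans (ler_norm C)); by rewrite lerDl.
have := diff_unique dc dF => e.
by apply/diff_locallyP; rewrite e.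
Unshelve. all: by end_near. Qed.

Context (K M : R) (K1 : 1 <= K) (M0 : 0 <= M).

Lemma zeta_ext_entire r (xi gam : 'I_r -> R[i]) :
  (forall j, cn (xi j) <= 1) -> (forall j, xi j != 1) ->
  (forall j, direction K M (gam j)) -> (forall j, 0 < re (gam j)) ->
  entire (fun s : 'rV[R[i]]_r => zeta_ext xi gam (fun j => s 0 j) 0).
Proof.
move=> x1 x2 gd gp s.
have [k [l [_ _ _ hl]]] := zeta_ext_taylor K1 M0 (fun j => s 0 j) x1 x2 gd gp.
(* Plain bounds suffice here: no differences, and offset 0, where the weight is 1. *)
have [C C0 hC] := hl 0%N.
apply: (@differentiable_quad _ _ s (fun j => l j 0) C) => e h he hh.
have := symb_base (hC (e, fun j => h 0 j) (conj he hh)) (cone0 K).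
rewrite /weight /= addr0 expr1n mulr1.
have -> : (fun j => (s + h) 0 j) = (fun j => s 0 j + h 0 j).
  by apply/funext => j; rewrite mxE.
by [].
Qed.
End Entire.

(** * Agreement with the series *)

Section ZetaDomain.
Context {R : realType}.

Definition fcons r (p : nat * {ffun 'I_r -> nat}) : {ffun 'I_r.+1 -> nat} :=
  [ffun i => if unlift ord0 i is Some j then p.2 j else p.1].
Definition fsplit r (m : {ffun 'I_r.+1 -> nat}) : nat * {ffun 'I_r -> nat} :=
  (m ord0, [ffun j => m (lift ord0 j)]).

Lemma fcons0 r p : @fcons r p ord0 = p.1.
Proof. by rewrite ffunE unlift_none. Qed.
Lemma fconsS r p j : @fcons r p (lift ord0 j) = p.2 j.
Proof. by rewrite ffunE liftK. Qed.

Lemma fconsK r : cancel (@fcons r) (@fsplit r).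
Proof.
move=> [a m]; rewrite /fsplit fcons0; congr pair; apply/ffunP => j.
by rewrite ffunE fconsS.
Qed.

Lemma fsplitK r : cancel (@fsplit r) (@fcons r).
Proof.
move=> m; apply/ffunP => i; rewrite ffunE; case: unliftP => [j ->|->] //=.
by rewrite ffunE.
Qed.

Lemma has_sum_fcons r (x : {ffun 'I_r.+1 -> nat} -> R[i]) l :
  has_sum (fun p => x (fcons p)) l -> has_sum x l.
Proof.
move=> h; have := has_sum_bij (@fsplitK r) (@fconsK r) h.
by congr has_sum; apply/funext => m; rewrite /= fsplitK.
Qed.

Lemma has_sum_fsplit r (x : {ffun 'I_r.+1 -> nat} -> R[i]) l :
  has_sum x l -> has_sum (fun p => x (fcons p)) l.
Proof. exact: has_sum_bij (@fconsK r) (@fsplitK r). Qed.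

Lemma asummable_fcons r (x : {ffun 'I_r.+1 -> nat} -> R[i]) B :
  asummable (fun p => x (fcons p)) B -> asummable x B.
Proof.
move=> h; have := asummable_bij (can_inj (@fsplitK r)) h.
by congr asummable; apply/funext => m; rewrite /= fsplitK.
Qed.

Lemma asummable_fsplit r (x : {ffun 'I_r.+1 -> nat} -> R[i]) B :
  asummable x B -> asummable (fun p => x (fcons p)) B.
Proof. exact: asummable_bij (can_inj (@fconsK r)). Qed.

Lemma ffun0_eq (m m' : {ffun 'I_0 -> nat}) : m = m'.
Proof. by apply/ffunP; case. Qed.

Lemma sum_ffun0 (A : {fset {ffun 'I_0 -> nat}}) (V : zmodType)
    (x : {ffun 'I_0 -> nat} -> V) m0 : (m0 \in A) -> \sum_(m <- A) x m = x m0.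
Proof.
move=> h; have -> : A = [fset m0]%fset.
  by apply/fsetP => m; rewrite inE (ffun0_eq m m0) eqxx.
by rewrite big_seq_fset1.
Qed.

Lemma has_sum_ffun0 (x : {ffun 'I_0 -> nat} -> R[i]) m0 : has_sum x (x m0).
Proof.
move=> e e0; exists [fset m0]%fset => A sA; rewrite (@sum_ffun0 _ _ _ m0) ?subrr ?cn0 //.
by apply: (fsubsetP sA); rewrite inE.
Qed.

Lemma asummable_ffun0 (x : {ffun 'I_0 -> nat} -> R[i]) m0 : asummable x (cn (x m0)).
Proof.
move=> A; case: (boolP (m0 \in A)) => h.
  by rewrite (@sum_ffun0 _ _ _ m0).
rewrite big_seq big1 ?cn_ge0 // => m mA.
by move: h; rewrite -(ffun0_eq m m0) mA.
Qed.

Definition offset_zeta_term r (xi gam s : 'I_r -> R[i]) A (m : {ffun 'I_r -> nat}) : R[i] :=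
  \prod_(j < r) (xi j ^+ (m j).+1 *
    cpow (A + \sum_(k < r | (k <= j)%N) (m k).+1%:R * gam k) (- s j)).

Lemma offset_zeta_term_cons r (xi gam s : 'I_r.+1 -> R[i]) A p :
  offset_zeta_term xi gam s A (fcons p) =
  xi ord0 ^+ p.1.+1 * cpow (A + p.1.+1%:R * gam ord0) (- s ord0) *
  offset_zeta_term (tail xi) (tail gam) (tail s) (A + p.1.+1%:R * gam ord0) p.2.
Proof.
have e0 : \sum_(k < r.+1 | (k <= (ord0 : 'I_r.+1))%N) (fcons p k).+1%:R * gam k =
    p.1.+1%:R * gam ord0.
  by rewrite big_mkcond big_ord_recl /= fcons0 big1 ?addr0.
have eS (j : 'I_r) : A + \sum_(k < r.+1 | (k <= lift ord0 j)%N) (fcons p k).+1%:R * gam k =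
    A + p.1.+1%:R * gam ord0 + \sum_(k < r | (k <= j)%N) (p.2 k).+1%:R * tail gam k.
  rewrite -addrA big_mkcond big_ord_recl /= fcons0 [in RHS]big_mkcond; do 2 congr (_ + _).
  by apply: eq_bigr => i _; rewrite fconsS /bump /= !add1n ltnS.
rewrite /offset_zeta_term big_ord_recl fcons0 e0; congr (_ * _).
by apply: eq_bigr => j _; rewrite fconsS eS.
Qed.

(** Comparison of a sum of powers with an integral, in telescoping form. With x = w + d, w^(-rho) =
    x^(-rho) exp(rho ln(x/w)); then exp y >= 1 + y and ln(x/w) >= 1 - w/x = d/x. *)
Lemma powR_telescope (rho d w : R) : 0 < rho -> 0 < d -> 0 < w ->
  expR (- (rho + 1) * ln (w + d)) <=
  (rho * d)^-1 * (expR (- rho * ln w) - expR (- rho * ln (w + d))).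
Proof.
move=> r0 d0 w0; set x := w + d; have x0 : 0 < x by rewrite addr_gt0.
have rd : 0 < rho * d by rewrite mulr_gt0.
rewrite -(ler_pM2l rd) mulVKf ?gt_eqF //.
have -> : expR (- (rho + 1) * ln x) = expR (- rho * ln x) * x^-1.
  have -> : x^-1 = expR (- ln x) by rewrite expRN lnK ?posrE.
  by rewrite -expRD; congr expR; ring.
have -> : expR (- rho * ln w) = expR (- rho * ln x) * expR (rho * (ln x - ln w)).
  by rewrite -expRD; congr expR; ring.
have h1 : 1 + rho * (ln x - ln w) <= expR (rho * (ln x - ln w)) by exact: expR_ge1Dx.
have h2 : 1 - w / x <= ln x - ln w.
  have wx : 0 < w / x by rewrite divr_gt0.
  have := @le_ln1Dx _ (w / x - 1); rewrite ltrBrDl subrr wx => /(_ isT).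
  by rewrite addrC subrK ln_div ?posrE //; lra.
have h3 : 1 - w / x = d / x by rewrite /x; field; rewrite gt_eqF.
have e0 := expR_ge0 (- rho * ln x).
have h4 : rho * (d / x) <= rho * (ln x - ln w) by apply: ler_wpM2l; [exact: ltW|rewrite -h3].
have -> : expR (- rho * ln x) * expR (rho * (ln x - ln w)) - expR (- rho * ln x) =
  expR (- rho * ln x) * (expR (rho * (ln x - ln w)) - 1) by ring.
have -> : rho * d * (expR (- rho * ln x) / x) = expR (- rho * ln x) * (rho * (d / x)) by ring.
by apply: ler_wpM2l => //; rewrite lerBrDl; apply: le_trans h1; rewrite lerD2l.
Qed.

Context (K M : R) (K1 : 1 <= K) (M0 : 0 <= M).

(** Unlike [cn_shift_pow], this keeps the exact exponent [re c], which the domain of absolute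
    convergence requires. As [re c] may have either sign, ln |z| - ln (weight z) is bounded on both
    sides. *)
Lemma cn_cpow_bound (g c : R[i]) : direction K M g -> 0 < re g -> exists2 C, 0 <= C &
  forall A, cone K A -> cn (cpow (A + g) c) <= C * expR (re c * ln (weight (A + g))).
Proof.
move=> gd gp; pose L := `|ln K| + `|ln (1 + (re g)^-1)|.
exists (expR (pi * `|im c| + `|re c| * L)); first exact: expR_ge0.
move=> A dA; have a0 := cone_re_ge0 K1 dA; set z := A + g.
have rz : re g <= re z by rewrite /z reD lerDr.
have rz0 : 0 < re z := lt_le_trans gp rz.
have zn : z != 0 by apply/eqP => e; move: rz0; rewrite e ltxx.
have cz : 0 < cn z by rewrite cn_gt0.
have dz : cone K z := cone_step dA gd.
have wz : 0 < weight z := weight_gt0 K1 dz.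
have K0 := aperture_gt0 K1; have ig : 0 < (re g)^-1 by rewrite invr_gt0.
have h1 : ln (cn z) <= ln K + ln (weight z).
  rewrite -lnM ?posrE // ler_ln ?posrE ?mulr_gt0 //; apply: (le_trans dz).
  by rewrite ler_wpM2l ?ltW // /weight; lra.
have h2 : ln (weight z) <= ln (1 + (re g)^-1) + ln (cn z).
  have p1 : 0 < 1 + (re g)^-1 by rewrite addr_gt0.
  rewrite -lnM ?posrE // ler_ln ?posrE ?mulr_gt0 // mulrDl mul1r /weight.
  have h3 : 1 <= (re g)^-1 * cn z.
    rewrite mulrC ler_pdivlMr // mul1r; exact: le_trans rz (re_cn z).
  by have := re_cn z; lra.
have h4 : `|ln (cn z) - ln (weight z)| <= L.
  rewrite /L ler_norml; have := ler_norm (ln K); have := ler_norm (ln (1 + (re g)^-1)).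
  have := normr_ge0 (ln K); have := normr_ge0 (ln (1 + (re g)^-1)).
  by move=> *; apply/andP; split; lra.
rewrite /cpow cn_cexp -expRD ler_expR reM /clog /=.
have h5 : - (im c * carg z) <= pi * `|im c|.
  apply: (le_trans (ler_norm _)); rewrite normrN normrM mulrC.
  by rewrite ler_wpM2r // carg_le.
have h6 : re c * ln (cn z) - re c * ln (weight z) <= `|re c| * L.
  rewrite -mulrBr; apply: (le_trans (ler_norm _)); rewrite normrM.
  by rewrite ler_wpM2l.
lra.
Qed.

Lemma weight_translateS (g A : R[i]) m : weight (A + m.+1%:R * g) = weight (A + m%:R * g) + re g.
Proof. by rewrite /weight !re_translateMn -addn1 natrD mulrDl mul1r !addrA. Qed.

Lemma asummable_weight (g : R[i]) rho : direction K M g -> 0 < re g -> 0 < rho -> forall A,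
  cone K A ->
  asummable (fun m : nat => (expR (- (rho + 1) * ln (weight (A + m.+1%:R * g))))%:C%C)
    ((rho * re g)^-1 * expR (- rho * ln (weight A))).
Proof.
move=> gd gp r0 A dA; have rg : 0 < (rho * re g)^-1 by rewrite invr_gt0 mulr_gt0.
apply: asummable_nat => n.
apply: (@le_trans _ _ ((rho * re g)^-1 * (expR (- rho * ln (weight A)) -
    expR (- rho * ln (weight (A + n%:R * g)))))); last first.
  by rewrite ler_wpM2l ?(ltW rg) // gerBl expR_ge0.
elim: n => [|n IH].
  by rewrite big_ord0 mul0r addr0 subrr mulr0.
rewrite big_ord_recr /=; apply: (le_trans (lerD IH (lexx _))).
have dn : cone K (A + n%:R * g) by apply: coneD => //; apply: coneMn; exact: direction_cone gd.
have := powR_telescope r0 gp (weight_gt0 K1 dn); rewrite -weight_translateS => h.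
rewrite expr0n /= addr0 sqrtr_sqr (ger0_norm (expR_ge0 _)).
apply: (le_trans (lerD (lexx _) h)); rewrite -mulrDr ler_wpM2l ?(ltW rg) //.
lra.
Qed.

(** The bound on the absolute sum is part of the induction: each summation turns the decay
    weight^(-(rho + 1)) into weight^(-rho). The k-th inequality of the domain is the positivity of
    rho when the k-th variable from the end is summed. *)
Lemma zeta_sum r (xi gam s : 'I_r -> R[i]) :
  (forall j, cn (xi j) <= 1) -> (forall j, xi j != 1) ->
  (forall j, direction K M (gam j)) -> (forall j, 0 < re (gam j)) ->
  (forall k : nat, (1 <= k <= r)%N -> k%:R < \sum_(j < r | (r - k <= j)%N) re (s j)) ->
  (exists2 C, 0 <= C & forall A, cone K A ->
     asummable (offset_zeta_term xi gam s A) (C * expR (- (\sum_j re (s j) - r%:R) * ln (weight A)))) /\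
  (forall A, cone K A -> has_sum (offset_zeta_term xi gam s A) (zeta_ext xi gam s A)).
Proof.
elim: r xi gam s => [|r IH] xi gam s x1 x2 gd gp hs.
  have m0 : {ffun 'I_0 -> nat} by exact: [ffun=> 0%N].
  split=> [|A dA].
    exists 1 => // A dA; rewrite big_ord0 subr0 oppr0 mul0r expR0 mulr1.
    have := @asummable_ffun0 (offset_zeta_term xi gam s A) m0.
    by rewrite {2}/offset_zeta_term big_ord0 cn1.
  by have := @has_sum_ffun0 (offset_zeta_term xi gam s A) m0;
    rewrite {2}/offset_zeta_term big_ord0.
have hs' k : (1 <= k <= r)%N -> k%:R < \sum_(j < r | (r - k <= j)%N) re (tail s j).
  move=> /andP[k1 kr]; have := hs k; rewrite k1 (leq_trans kr) // => /(_ isT).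
  rewrite big_mkcond big_ord_recl ifF; last first.
    by rewrite /= leqn0 subn_eq0 leqNgt ltnS kr.
  rewrite Monoid.mul1m => h; apply: (lt_le_trans h); rewrite [leRHS]big_mkcond.
  by apply: ler_sum => i _; rewrite lift0 subSn // ltnS.
have [[C C0 hA] hH] := IH (tail xi) (tail gam) (tail s)
  (fun j => x1 _) (fun j => x2 _) (fun j => gd _) (fun j => gp _) hs'.
set g := gam ord0; have gd0 : direction K M g := gd _; have gp0 : 0 < re g := gp _.
have [Cp Cp0 hCp] := cn_cpow_bound (- s ord0) gd0 gp0.
pose rho := \sum_j re (s j) - r.+1%:R.
have r0 : 0 < rho.
  have := hs r.+1; rewrite leqnn /= subnn => /(_ isT).
  by rewrite /rho subr_gt0; under eq_bigl do rewrite leq0n.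
have rhoE : rho + 1 = re (s ord0) + (\sum_j re (tail s j) - r%:R).
  by rewrite /rho big_ord_recl -natr1 /tail; ring.
pose rho' := \sum_j re (tail s j) - r%:R.
pose z (A : R[i]) m : R[i] := A + m.+1%:R * g.
have dz A m : cone K A -> cone K (z A m).
  by move=> dA; apply: coneD => //; apply: coneMn; exact: direction_cone gd0.
have zE A m : z A m = A + m%:R * g + g by exact: shiftS.
pose c A m : R[i] := cpow (z A m) (- s ord0).
have hc A m : cone K A -> cn (c A m) <= Cp * expR (- re (s ord0) * ln (weight (z A m))).
  move=> dA; rewrite /c zE -reN; apply: hCp.
  by apply: coneD => //; apply: coneMn; exact: direction_cone gd0.
pose E A m := expR (- (rho + 1) * ln (weight (z A m))).
have EE A m : expR (- re (s ord0) * ln (weight (z A m))) * expR (- rho' * ln (weight (z A m))) = E A m.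
  by rewrite -expRD /E rhoE /rho'; congr expR; ring.
have xX m : cn (xi ord0 ^+ m.+1) <= 1 by rewrite cnX exprn_ile1 // cn_ge0.
have hrow A m : cone K A -> asummable (fun n => offset_zeta_term xi gam s A (fcons (m, n))) (Cp * C * E A m).
  move=> dA; have h := asummableZ (xi ord0 ^+ m.+1 * c A m) (hA _ (dz A m dA)).
  apply: (asummable_weaken _ (asummable_le _ h)) => [|n]; last by rewrite offset_zeta_term_cons.
  rewrite cnM -(EE A m).
  apply: (@le_trans _ _ ((Cp * expR (- re (s ord0) * ln (weight (z A m)))) *
      (C * expR (- rho' * ln (weight (z A m)))))).
    apply: ler_wpM2r; first by rewrite mulr_ge0 // expR_ge0.
    by apply: le_trans (hc A m dA); rewrite ler_piMl ?cn_ge0.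
  by rewrite le_eqVlt; apply/orP; left; apply/eqP; ring.
have CC : 0 <= Cp * C by rewrite mulr_ge0.
have hE A : cone K A -> asummable (fun m => (Cp * C * E A m)%:C%C)
    (Cp * C * ((rho * re g)^-1 * expR (- rho * ln (weight A)))).
  move=> dA B; under eq_bigr do rewrite cn_real normrM (ger0_norm CC).
  rewrite -mulr_sumr ler_wpM2l //; apply: le_trans (asummable_weight gd0 gp0 r0 dA B).
  by apply: ler_sum => i _; rewrite cn_real.
have hsum A : cone K A -> asummable (offset_zeta_term xi gam s A)
    (Cp * C * ((rho * re g)^-1 * expR (- rho * ln (weight A)))).
  move=> dA; apply: asummable_fcons; apply: (asummable_sig (B := fun m => Cp * C * E A m)).
    by move=> m; exact: hrow.
  exact: hE.
split.
  exists (Cp * C * (rho * re g)^-1) => [|A dA].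
    by rewrite mulr_ge0 // invr_ge0 ltW // mulr_gt0.
  by rewrite -mulrA; exact: hsum.
move=> A dA; have [l hl] := asummable_has_sum (hsum A dA).
pose G a := shift_pow g (- s ord0) a * translate g (zeta_ext (tail xi) (tail gam) (tail s)) a.
have GE m : G (A + m%:R * g) = c A m * zeta_ext (tail xi) (tail gam) (tail s) (z A m).
  by rewrite /c zE.
have hb m : has_sum (fun n => offset_zeta_term xi gam s A (fcons (m, n)))
    (xi ord0 ^+ m.+1 * G (A + m%:R * g)).
  have := has_sumZ (xi ord0 ^+ m.+1 * c A m) (hH _ (dz A m dA)).
  rewrite GE mulrA.
  by congr has_sum; apply/funext => n; rewrite offset_zeta_term_cons.
(* The outer series converges absolutely, so the regularised value is the actual sum, with no Abel
   step. *)
have hs0 : diff_summable g 0 G A.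
  exists (Cp * C * ((rho * re g)^-1 * expR (- rho * ln (weight A)))).
  apply: asummable_le (hE A dA) => m.
  have h1 := has_sum_le (hA _ (dz A m dA)) (hH _ (dz A m dA)).
  rewrite cn_real normrM (ger0_norm CC) ger0_norm ?expR_ge0 // -(EE A m).
  rewrite [iter _ _ _ _]GE cnM.
  apply: (@le_trans _ _ ((Cp * expR (- re (s ord0) * ln (weight (z A m)))) *
      (C * expR (- rho' * ln (weight (z A m)))))).
    by apply: ler_pM; rewrite ?cn_ge0 //; exact: hc.
  by rewrite le_eqVlt; apply/orP; left; apply/eqP; ring.
have h1 := has_sum_fubini (has_sum_fsplit hl) hb.
have h2 := has_sumZ (xi ord0) (tsum0_has_sum (x1 ord0) hs0).
suff <- : l = zeta_ext xi gam s A by [].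
rewrite /= (tsum_eq (x1 ord0) (x2 ord0) hs0).
apply: has_sum_uniq h1 _; move: h2; congr has_sum; apply/funext => m.
by rewrite exprS mulrA.
Qed.
End ZetaDomain.

(** * Values at non-positive integers *)

Section PolynomialValues.
Context {R : realType} (K M : R) (K1 : 1 <= K) (M0 : 0 <= M).
Implicit Types (f : R[i] -> R[i]) (W : R[i] -> R) (A u : R[i]).

Local Notation symb := (symb K M).
Local Notation cone := (cone K).
Local Notation direction := (direction K M).

(* Polynomials of degree less than [d], seen through their differences. *)
Fixpoint nilpotent_diff d f : Prop :=
  if d is d'.+1 then forall u, direction u -> nilpotent_diff d' (fdiff u f)
  else forall A, cone A -> f A = 0.

Lemma nilpotent_diff_ext d f (g : R[i] -> R[i]) : (forall A, cone A -> f A = g A) ->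
  nilpotent_diff d f -> nilpotent_diff d g.
Proof.
elim: d f g => [|d IH] f g e hf /=; first by move=> A dA; rewrite -e // hf.
by move=> u du; apply: IH (hf u du) => A dA; rewrite /fdiff !e // (cone_step dA du).
Qed.

Lemma nilpotent_diffS d f : nilpotent_diff d f -> nilpotent_diff d.+1 f.
Proof.
elim: d f => [|d IH] f hf u du /=; last by apply: IH; exact: hf.
by move=> A dA; rewrite /fdiff !hf ?subrr // (cone_step dA du).
Qed.

Lemma nilpotent_diff_mono d e f : (d <= e)%N -> nilpotent_diff d f -> nilpotent_diff e f.
Proof.
by move=> /subnK <- h; elim: (e - d)%N => [//|k IH]; rewrite addSn; exact: nilpotent_diffS.
Qed.

Lemma nilpotent_diff_zero d f : (forall A, cone A -> f A = 0) -> nilpotent_diff d f.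
Proof. by move=> h; apply: (@nilpotent_diff_mono 0). Qed.

Lemma nilpotent_diffD d f g : nilpotent_diff d f -> nilpotent_diff d g ->
  nilpotent_diff d (fun A => f A + g A).
Proof.
elim: d f g => [|d IH] f g hf hg /=; first by move=> A dA; rewrite hf // hg // addr0.
by move=> u du; rewrite fdiffD; apply: IH; [exact: hf|exact: hg].
Qed.

Lemma nilpotent_diff_translate d f u : direction u -> nilpotent_diff d f ->
  nilpotent_diff d (translate u f).
Proof.
move=> du; elim: d f => [|d IH] f hf /=; first by move=> A dA; apply: hf; exact (cone_step dA du).
by move=> v dv; rewrite fdiff_shift; apply: IH; exact: hf.
Qed.

(** Induction on a bound for d + e: each term of the product rule lowers one of the two indices. *)
Lemma nilpotent_diffM d e f g : nilpotent_diff d f -> nilpotent_diff e g ->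
  nilpotent_diff (d + e) (fun A => f A * g A).
Proof.
move: {2}(d + e)%N (leqnn (d + e)) => n; elim: n d e f g => [|n IH] d e f g.
  rewrite leqn0 addn_eq0 => /andP[/eqP -> /eqP ->] hf _.
  by apply: nilpotent_diff_zero => A dA; rewrite hf // mul0r.
case: d => [|d] hde hf hg; first by apply: nilpotent_diff_zero => A dA; rewrite hf // mul0r.
case: e hde hg => [|e] hde hg; first by apply: nilpotent_diff_zero => A dA; rewrite hg // mulr0.
rewrite addSn => u du; rewrite fdiffM; apply: nilpotent_diffD.
  apply: (IH d e.+1) => //; [exact: hf|exact: (nilpotent_diff_translate du hg)].
have hd : (d.+1 + e <= n)%N by move: hde; rewrite addnS ltnS.
by have := IH d.+1 e f (fdiff u g) hd hf (hg u du); rewrite addSnnS.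
Qed.

Lemma nilpotent_diff_cst c : nilpotent_diff 1 (fun=> c).
Proof. by move=> u du A dA; rewrite /fdiff subrr. Qed.

Lemma nilpotent_diff_divided_pow g n : exists d, nilpotent_diff d (fun a => (a + g) ^+ n).
Proof.
elim: n => [|n [d hd]]; first by exists 1%N; exact: nilpotent_diff_cst.
exists (2 + d)%N.
have h : nilpotent_diff 2 (fun a => a + g).
  by move=> u du v dv A dA; rewrite /fdiff; ring.
by have := nilpotent_diffM h hd; under eq_fun do rewrite -exprS.
Qed.

Section Twisted.
Context (xi gam : R[i]) (xi_le1 : cn xi <= 1) (xi_neq1 : xi != 1).
Context (gam_dir : direction gam) (gam_pos : 0 < re gam).

Lemma nilpotent_diff_iter d f k A : nilpotent_diff d f -> (d <= k)%N -> cone A ->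
  iter k (fdiff gam) f A = 0.
Proof.
move=> hf dk; have {dk} : nilpotent_diff k f by exact: nilpotent_diff_mono hf.
elim: k f {hf d} A => [|k IH] f A hf dA; first exact: hf.
by rewrite iterSr; apply: IH => //; exact: hf.
Qed.

Lemma nilpotent_diff_diff_summable d f A : nilpotent_diff d f -> cone A ->
  diff_summable gam d f A.
Proof.
move=> hf dA; exists 0 => B; rewrite big1 // => m _.
by rewrite (nilpotent_diff_iter hf) ?cn0 // (cone_translateMn gam_dir m dA).
Qed.

Definition abel_coef k : R[i] := xi ^+ k / (1 - xi) ^+ k.+1.

Lemma tsum_nilpotent_diff d f A : nilpotent_diff d f -> cone A ->
  tsum xi gam f A = \sum_(k < d) abel_coef k * iter k (fdiff gam) f A.
Proof.
move=> hf dA; rewrite (tsum_eq xi_le1 xi_neq1 (nilpotent_diff_diff_summable hf dA)).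
have x0 := one_sub_neq0 xi_neq1.
elim: d f hf => [|d IH] f hf.
  rewrite big_ord0 /=; apply: tsum0_eq.
  have -> : (fun m : nat => xi ^+ m * f (A + m%:R * gam)) = fun=> 0; last exact: has_sum0.
  by apply/funext => m; rewrite hf ?mulr0 // (cone_translateMn gam_dir m dA).
rewrite [LHS]/= IH; last exact: hf.
rewrite big_ord_recl mulrDl; congr (_ + _).
  by rewrite /abel_coef expr0 expr1 mul1r mulrC.
rewrite mulr_sumr mulr_suml; apply: eq_bigr => k _.
rewrite lift0 iterSr /abel_coef !exprS; field.
by rewrite x0 expf_neq0.
Qed.

Lemma tsum_nilpotent_diff_has_sum d f A : nilpotent_diff d f -> cone A ->
  has_sum (fun k => abel_coef k * iter k (fdiff gam) f A) (tsum xi gam f A).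
Proof.
move=> hf dA; rewrite (tsum_nilpotent_diff hf dA).
apply: (has_sum_finite (x := fun k => abel_coef k * iter k (fdiff gam) f A)) => k dk.
by rewrite (nilpotent_diff_iter hf dk dA) mulr0.
Qed.

Lemma nilpotent_diff_tsum d f : nilpotent_diff d f -> nilpotent_diff d (tsum xi gam f).
Proof.
elim: d f => [|d IH] f hf /=.
  by move=> A dA; rewrite (tsum_nilpotent_diff hf dA) big_ord0.
move=> u du; apply: nilpotent_diff_ext (IH _ (hf u du)) => A dA.
apply: tsum_fdiff => //; exists d.+1; apply: nilpotent_diff_diff_summable => //;
  exact (cone_step dA du).
Qed.

Lemma symb_iter eta n k W f : symb eta (n + k) W f ->
  symb eta n (fun A => W A * eta A ^+ k) (iter k (fdiff gam) f).
Proof.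
elim: k W f => [|k IH] W f.
  by rewrite addn0; congr symb; apply/funext => A; rewrite expr0 mulr1.
rewrite addnS iterSr => -[_ /(_ gam gam_dir) /IH].
by congr symb; apply/funext => A; rewrite exprS mulrA.
Qed.

Definition abel_ratio : R := cn (xi / (1 - xi)).

Lemma cn_abel_coef k : cn (abel_coef k) = (cn (1 - xi))^-1 * abel_ratio ^+ k.
Proof.
rewrite /abel_coef exprS invfM mulrCA -exprVn -exprMn cnM cnV cnX //.
Qed.

(** The k-th term of the Abel series is at most W (abel_ratio eps)^k / |1 - xi|, a geometric
    majorant of ratio at most 1/2. The bound is thus independent of the degree d, which makes it
    uniform in n later. *)
Lemma symb_tsum_cst (eps : R) d W f : 0 <= eps -> abel_ratio * eps <= 2^-1 ->
  nilpotent_diff d f ->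
  (forall n, symb (fun=> eps) n W f) ->
  forall n, symb (fun=> eps) n (fun A => 2 / cn (1 - xi) * W A) (tsum xi gam f).
Proof.
move=> e0 qe hf hc n.
have he : decaying K (fun=> eps) by move=> A dA; split.
have base W' f' A : nilpotent_diff d f' -> (forall n, symb (fun=> eps) n W' f') -> cone A ->
    cn (tsum xi gam f' A) <= 2 / cn (1 - xi) * W' A.
  move=> hf' hc' dA; have w0 := symb_W_ge0 (hc' 0%N) dA.
  have c0 : 0 <= (cn (1 - xi))^-1 by rewrite invr_ge0 cn_ge0.
  rewrite (tsum_nilpotent_diff hf' dA); apply: (le_trans (cn_sum _ _ _)).
  apply: (@le_trans _ _ (\sum_(k < d) (cn (1 - xi))^-1 * W' A * (2^-1) ^+ k)).
    apply: ler_sum => k _; rewrite cnM cn_abel_coef.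
    have h := symb_base (symb_iter (n := 0) (hc' k)) dA.
    apply: (@le_trans _ _ ((cn (1 - xi))^-1 * abel_ratio ^+ k * (W' A * eps ^+ k))).
      by rewrite ler_wpM2l // mulr_ge0 // exprn_ge0 // cn_ge0.
    have -> : (cn (1 - xi))^-1 * abel_ratio ^+ k * (W' A * eps ^+ k) =
      (cn (1 - xi))^-1 * W' A * (abel_ratio * eps) ^+ k by rewrite exprMn; ring.
    apply: ler_wpM2l; first by rewrite mulr_ge0.
    by apply: lerXn2r; rewrite ?nnegrE ?mulr_ge0 ?cn_ge0.
  rewrite -mulr_sumr.
  have -> : 2 / cn (1 - xi) * W' A = (cn (1 - xi))^-1 * W' A * 2 by ring.
  apply: ler_wpM2l; first by rewrite mulr_ge0.
  apply: (le_trans (sum_geo_le _ _ _)); rewrite ?invr_ge0 //; first by lra.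
  by rewrite le_eqVlt; apply/orP; left; apply/eqP; field.
elim: n W f hf hc => [|n IH] W f hf hc.
  by split=> // A dA; exact: base.
split=> [A dA|u du]; first exact: base.
have hfu : nilpotent_diff d (fdiff u f) by have := nilpotent_diffS hf; exact.
have hcu m : symb (fun=> eps) m (fun A => W A * eps) (fdiff u f).
  by have [_] := hc m.+1; exact.
apply: symb_ext (symb_le he _ (IH _ _ hfu hcu)) => A dA; last by rewrite mulrA.
apply: tsum_fdiff => //; exists d; apply: nilpotent_diff_diff_summable => //;
  exact (cone_step dA du).
Qed.
End Twisted.

Lemma symb_decay_le eta eta' n W f : decaying K eta -> decaying K eta' ->
  (forall A, cone A -> eta A <= eta' A) -> symb eta n W f -> symb eta' n W f.
Proof.
move=> he he' hle; elim: n W f => [|n IH] W f.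
  by case=> h _; split.
move=> h; have [f0 f1] := h; split=> // u du.
apply: symb_le (IH _ _ (f1 u du)) => // A dA.
by rewrite ler_wpM2l ?hle // (symb_W_ge0 h).
Qed.

(** An exponential dominates a^n / n! for all n at once, which no fixed power of [weight] does. *)
Definition exp_weight (tau : R) A : R := expR (tau * re A).

Lemma exp_weight_ge0 tau A : 0 <= exp_weight tau A. Proof. exact: expR_ge0. Qed.

Lemma slowly_varying_exp_weight tau : 0 <= tau ->
  slowly_varying K M (expR (tau * M)) (exp_weight tau).
Proof.
move=> t0 A u t dA du /andP[a b]; have hu := direction_re du.
rewrite /exp_weight -expRD ler_expR reD reMr mulrDr addrC.
rewrite lerD2r ler_wpM2l //; apply: le_trans hu.
by rewrite ler_piMl // (cone_re_ge0 K1) // (direction_cone du).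
Qed.

Definition divided_pow g n a : R[i] := (a + g) ^+ n / n`!%:R.

Lemma fact_neq0 n : n`!%:R != 0 :> R[i].
Proof. by rewrite pnatr_eq0 -lt0n fact_gt0. Qed.

Lemma has_derivative_divided_pow g n : has_derivative K M (divided_pow g n.+1) (divided_pow g n).
Proof.
move=> A u t dA du ht.
have hl : cder (fun x => A + x%:C%C * u + g) t u.
  by rewrite -[u in cder _ _ u]addr0; apply: cderD; [exact: cder_line|exact: cder_cst].
have := cderZ (n.+1`!%:R)^-1 (cderX n hl).
rewrite /divided_pow factS natrM; move: (fact_neq0 n) => f0.
have n0 : n.+1%:R != 0 :> R[i] by rewrite pnatr_eq0.
move=> h; apply: cder_ext (cder_eq h _) => [x|]; first by rewrite mulrC.
by move: (n.+1%:R : R[i]) (n`!%:R : R[i]) n0 f0 => a b a0 b0; field; rewrite a0 b0.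
Qed.

(** The derivative of the divided power n + 1 is the divided power n, so a difference lowers n by
    one. Against the growth rho^n this gains 1/rho, and rho is chosen so that 2 K M exp(K M), the
    cost of the mean value step, is at most rho eps. *)
Lemma divided_pow_symb (eps : R) : 0 < eps -> exists2 rho, 1 <= rho & exists2 C, 0 <= C &
  forall g, direction g -> forall n m,
  symb (fun=> eps) m (fun A => C * rho ^+ n * exp_weight K A) (divided_pow g n).
Proof.
move=> e0; have K0 := aperture_ge0 K1.
pose rho := 1 + 2 * (K * M) * expR (K * M) / eps.
have rho1 : 1 <= rho by rewrite lerDl !mulr_ge0 ?expR_ge0 // invr_ge0 ltW.
exists rho => //; exists (expR (K * M)) => [|g gd n m]; first exact: expR_ge0.
have he : decaying K (fun=> eps) by move=> A dA; split=> //; exact: ltW.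
have hb k A : cone A -> cn (divided_pow g k A) <= expR (K * M) * rho ^+ k * exp_weight K A.
  move=> dA; rewrite /divided_pow cnM cnX cnV cnMn.
  apply: (le_trans (exp_term_le k (cn_ge0 _))).
  apply: (@le_trans _ _ (expR (K * M) * exp_weight K A)); last first.
    rewrite -mulrA ler_wpM2l ?expR_ge0 // ler_peMl ?exp_weight_ge0 //; exact: exprn_ege1.
  rewrite /exp_weight -expRD ler_expR; apply: (le_trans (cone_step dA gd)).
  by have hg := direction_re gd; rewrite reD mulrDr addrC lerD2r ler_wpM2l.
elim: m n => [|m IH] n; first by split=> // A dA; exact: hb.
case: n => [|n].
  have -> : divided_pow g 0 = fun=> 1 by apply/funext => a;
    rewrite /divided_pow expr0 fact0 divr1.
  apply: symb_le (symb_cst M m.+1 1 he) => // A dA.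
  by have := hb 0%N A dA; rewrite /divided_pow expr0 fact0 divr1 cn1.
split=> [A dA|u du]; first exact: hb.
apply: (symb_fdiff he du (has_derivative_divided_pow g n) (IH n)) => A t dA ht.
have h1 := slowly_varying_exp_weight K0 dA du ht; have h2 := direction_cn K1 du.
have r0 : 0 <= rho by lra.
apply: (@le_trans _ _ (2 * (K * M) * (expR (K * M) * rho ^+ n * (expR (K * M) * exp_weight K A)))).
  apply: ler_pM; rewrite ?mulr_ge0 ?cn_ge0 ?expR_ge0 ?exp_weight_ge0 ?exprn_ge0 //.
    by rewrite ler_wpM2l.
  by rewrite ler_wpM2l // mulr_ge0 ?expR_ge0 // exprn_ge0.
have -> : 2 * (K * M) * (expR (K * M) * rho ^+ n * (expR (K * M) * exp_weight K A)) =
  (2 * (K * M) * expR (K * M)) * (expR (K * M) * rho ^+ n * exp_weight K A) by ring.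
have -> : expR (K * M) * rho ^+ n.+1 * exp_weight K A * eps =
  (rho * eps) * (expR (K * M) * rho ^+ n * exp_weight K A) by rewrite exprS; ring.
rewrite ler_wpM2r ?mulr_ge0 ?expR_ge0 ?exprn_ge0 ?exp_weight_ge0 //.
by rewrite /rho [leRHS]mulrDl mul1r mulfVK ?gt_eqF // lerDr ltW.
Qed.

(* [zeta_ext] at the point [-n], divided by [n_1! ... n_r!]. *)
Fixpoint divided_value r : ('I_r -> R[i]) -> ('I_r -> R[i]) -> ('I_r -> nat) -> R[i] -> R[i] :=
  match r with
  | 0 => fun _ _ _ _ => 1
  | r'.+1 => fun xi gam n A => xi ord0 * tsum (xi ord0) (gam ord0)
      (fun a => divided_pow (gam ord0) (n ord0) a *
                translate (gam ord0) (divided_value (tail xi) (tail gam) (tail n)) a) A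
  end.

Definition nfact r (n : 'I_r -> nat) : R[i] := \prod_j (n j)`!%:R.
Definition nsize r (n : 'I_r -> nat) : nat := \sum_j n j.

Lemma nilpotent_diffZ d c f : nilpotent_diff d f -> nilpotent_diff d (fun A => c * f A).
Proof.
elim: d f => [|d IH] f hf /=; first by move=> A dA; rewrite hf // mulr0.
by move=> u du; rewrite fdiffZ; apply: IH; exact: hf.
Qed.

Lemma nilpotent_diff_mul_translate g n f d : direction g -> nilpotent_diff d f ->
  exists d', nilpotent_diff d' (fun a => divided_pow g n a * translate g f a).
Proof.
move=> dg hf; have [e he] := nilpotent_diff_divided_pow g n; exists (e + d)%N;
  apply: nilpotent_diffM.
  have := nilpotent_diffZ (n`!%:R)^-1 he.
  by apply: nilpotent_diff_ext => A _; rewrite /divided_pow mulrC.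
exact: nilpotent_diff_translate.
Qed.

Lemma nilpotent_diff_divided_value r (xi gam : 'I_r -> R[i]) n :
  (forall j, cn (xi j) <= 1) -> (forall j, xi j != 1) -> (forall j, direction (gam j)) ->
  exists d, nilpotent_diff d (divided_value xi gam n).
Proof.
elim: r xi gam n => [|r IH] xi gam n x1 x2 gd; first by exists 1%N; exact: nilpotent_diff_cst.
have [d hd] := IH (tail xi) (tail gam) (tail n) (fun j => x1 _) (fun j => x2 _) (fun j => gd _).
have [d' hd'] := nilpotent_diff_mul_translate (n ord0) (gd ord0) hd.
by exists d'; apply: nilpotent_diffZ; exact: (nilpotent_diff_tsum (x1 _) (x2 _) (gd _) hd').
Qed.

Lemma zeta_ext_neg r (xi gam : 'I_r -> R[i]) n A :
  (forall j, cn (xi j) <= 1) -> (forall j, xi j != 1) ->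
  (forall j, direction (gam j)) -> (forall j, 0 < re (gam j)) -> cone A ->
  zeta_ext xi gam (fun j => - (n j)%:R) A = nfact n * divided_value xi gam n A.
Proof.
elim: r xi gam n A => [|r IH] xi gam n A x1 x2 gd gp dA.
  by rewrite /nfact big_ord0 mul1r.
have [d hd] := @nilpotent_diff_divided_value r (tail xi) (tail gam) (tail n) (fun j => x1 _) (fun j => x2 _) (fun j => gd _).
have [d' hd'] := nilpotent_diff_mul_translate (n ord0) (gd ord0) hd.
have sm : regular (gam ord0) (fun a => divided_pow (gam ord0) (n ord0) a *
    translate (gam ord0) (divided_value (tail xi) (tail gam) (tail n)) a) A.
  by exists d'; exact: (nilpotent_diff_diff_summable (gd _) hd' dA).
rewrite /= mulrCA; congr (_ * _); rewrite -(tsumZ (x1 ord0) (x2 ord0) _ sm).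
apply: tsum_ext => m; set a := A + m%:R * gam ord0.
have da : cone a := cone_translateMn (gd ord0) m dA.
have dg := cone_step da (gd ord0).
rewrite /translate (_ : tail (fun j => - (n j)%:R) = (fun j => - (tail n j)%:R)) //.
rewrite (IH (tail xi) (tail gam) (tail n) _
  (fun j => x1 _) (fun j => x2 _) (fun j => gd _) (fun j => gp _) dg).
rewrite /shift_pow /cpow opprK cexpMn cexp_clog; last exact: (shift_neq0 K1 (gp ord0) da).
rewrite /nfact big_ord_recl /divided_pow -/(tail n _).
by have f0 := fact_neq0 (n ord0); rewrite /tail; field.
Qed.

Definition divided_summand r (xi gam : 'I_r.+1 -> R[i]) n a : R[i] :=
  divided_pow (gam ord0) (n ord0) a * translate (gam ord0) (divided_value (tail xi) (tail gam) (tail n)) a.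

(* Differences decay like [eps ^ k], with [eps] as small as we like, at the price
   of a growth [rho ^ n] in the degree. The double series over degrees and orders
   of differences is then absolutely convergent for small [t], which allows the
   two summations to be exchanged. *)
Definition geo_symb r (eps : R) (F : ('I_r -> nat) -> R[i] -> R[i]) :=
  exists rho C tau, [/\ 1 <= rho, 0 <= C, 0 <= tau & forall n m,
    symb (fun=> eps) m (fun A => C * rho ^+ nsize n * exp_weight tau A) (F n)].

Lemma cst_decaying (eps : R) : 0 < eps -> decaying K (fun=> eps).
Proof. by move=> e0 A dA; split=> //; exact: ltW. Qed.

Lemma divided_summand_symb_step r (xi gam : 'I_r.+1 -> R[i]) : (forall j, direction (gam j)) ->
  (forall eps, 0 < eps -> geo_symb eps (divided_value (tail xi) (tail gam))) ->
  forall eps, 0 < eps -> geo_symb eps (divided_summand xi gam).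
Proof.
move=> gd IH eps e0; set g := gam ord0; have gd0 : direction g := gd _.
have e12 : 0 < eps / 2 by rewrite divr_gt0.
have [rho' [C' [tau' [r1' C0' t0' hI]]]] := IH _ e12.
pose k := expR (tau' * M); have k0 : 0 < k by exact: expR_gt0.
(* [symbM] multiplies the first decay by the slow variation k of the second factor: k eps / (2 k) +
   eps / 2 = eps. As k depends on the weight of the inner factor, the latter is treated first. *)
have e20 : 0 < eps / (2 * k) by rewrite divr_gt0 // mulr_gt0.
have [rho1 r11 [C1 C10 hm]] := divided_pow_symb e20.
have K0 := aperture_ge0 K1.
have rr1 : 0 <= rho1 by lra.
have rr' : 0 <= rho' by lra.
have Cc0 : 0 <= C1 * (k * C').
  by apply: mulr_ge0 => //; apply: mulr_ge0 => //; exact: ltW.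
exists (rho1 * rho'), (C1 * (k * C')), (K + tau'); split=> //.
- by rewrite -(mulr1 1); apply: ler_pM.
- by rewrite addr_ge0.
move=> n m.
pose c' := C' * rho' ^+ nsize (tail n).
have c'0 : 0 <= c' by rewrite mulr_ge0 // exprn_ge0.
have sl : slowly_varying K M k (fun A => c' * exp_weight tau' A) by apply: slowly_varyingZ => //;
  exact: slowly_varying_exp_weight.
have hG : symb (fun=> eps) m (fun A => C1 * rho1 ^+ n ord0 * exp_weight K A * (k * (c' * exp_weight tau' A)))
    (divided_summand xi gam n).
  have h2 := symb_shift_slow (cst_decaying e12) sl gd0 (hI (tail n) m).
  have := symbM (cst_decaying e20) (cst_decaying e12) (ltW k0) (slowly_varyingZ (ltW k0) sl) (hm g gd0 (n ord0) m) h2.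
  congr symb; apply/funext => A; field; exact: lt0r_neq0.
apply: symb_le hG; first exact: cst_decaying.
move=> A dA.
have -> : nsize n = (n ord0 + nsize (tail n))%N by rewrite /nsize big_ord_recl.
have -> : exp_weight (K + tau') A = exp_weight K A * exp_weight tau' A by rewrite /exp_weight mulrDl expRD.
set E := exp_weight K A * exp_weight tau' A.
have E0 : 0 <= E by rewrite mulr_ge0 // exp_weight_ge0.
have -> : C1 * rho1 ^+ n ord0 * exp_weight K A * (k * (c' * exp_weight tau' A)) =
  C1 * (k * C') * (rho1 ^+ n ord0 * rho' ^+ nsize (tail n)) * E.
  by rewrite /c' /E; ring.
apply: ler_wpM2r => //; apply: ler_wpM2l => //.
rewrite exprMn; apply: ler_pM; rewrite ?exprn_ge0 //; apply: ler_weXn2l => //.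
  exact: leq_addr.
exact: leq_addl.
Qed.

Lemma nilpotent_diff_divided_summand r (xi gam : 'I_r.+1 -> R[i]) n :
  (forall j, cn (xi j) <= 1) -> (forall j, xi j != 1) -> (forall j, direction (gam j)) ->
  exists d, nilpotent_diff d (divided_summand xi gam n).
Proof.
move=> x1 x2 gd.
have [d hd] := @nilpotent_diff_divided_value r (tail xi) (tail gam) (tail n) (fun j => x1 _) (fun j => x2 _) (fun j => gd _).
exact: nilpotent_diff_mul_translate hd.
Qed.

Lemma divided_value_symb r (xi gam : 'I_r -> R[i]) :
  (forall j, cn (xi j) <= 1) -> (forall j, xi j != 1) ->
  (forall j, direction (gam j)) -> (forall j, 0 < re (gam j)) ->
  forall eps : R, 0 < eps -> geo_symb eps (divided_value xi gam).
Proof.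
elim: r xi gam => [|r IH] xi gam x1 x2 gd gp eps e0.
  exists 1, 1, 0; split=> // n m.
  apply: symb_le (symb_cst M m 1 (cst_decaying e0)); first exact: cst_decaying.
  by move=> A dA; rewrite /exp_weight expr1n mul0r expR0 cn1 !mulr1.
set x0 := xi ord0; have gd0 := gd ord0; have gp0 := gp ord0.
have x10 : cn x0 <= 1 := x1 _; have x20 : x0 != 1 := x2 _.
have q0 : 0 <= abel_ratio x0 by exact: cn_ge0.
have q1 : 0 < 2 * (abel_ratio x0 + 1) by rewrite mulr_gt0 // ltr_wpDl.
(* The second bound makes the ratio of the Abel series at most 1/2; the resulting decay e1 is
   weakened to eps at the end. *)
pose e1 := Num.min eps (2 * (abel_ratio x0 + 1))^-1.
have e10 : 0 < e1 by rewrite lt_min e0 invr_gt0.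
have e1e : e1 <= eps by rewrite ge_min lexx.
have qe : abel_ratio x0 * e1 <= 2^-1.
  apply: (@le_trans _ _ (abel_ratio x0 * (2 * (abel_ratio x0 + 1))^-1)).
    by rewrite ler_wpM2l // ge_min lexx orbT.
  rewrite ler_pdivrMr // mulrA mulVf ?mul1r; last by rewrite pnatr_eq0.
  by rewrite lerDl.
have cx : 0 <= 2 / cn (1 - x0) by rewrite divr_ge0 // cn_ge0.
have [rho [C [tau [r1 C0 t0 hG]]]] := divided_summand_symb_step gd
  (IH (tail xi) (tail gam) (fun j => x1 _) (fun j => x2 _) (fun j => gd _) (fun j => gp _)) e10.
exists rho, (2 / cn (1 - x0) * C), tau; split=> //; first exact: mulr_ge0.
move=> n m; have [d hd] := nilpotent_diff_divided_summand n x1 x2 gd.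
have := symbZ x0 (symb_tsum_cst x10 x20 gd0 (ltW e10) qe hd (hG n) m).
move=> /(symb_decay_le (cst_decaying e10) (cst_decaying e0) (fun A _ => e1e)).
apply: symb_le; first exact: cst_decaying.
move=> A dA; rewrite -!mulrA; apply: ler_piMl => //; rewrite !mulrA.
have r0 : 0 <= rho by lra.
by apply: mulr_ge0; [apply: mulr_ge0; [exact: mulr_ge0|exact: exprn_ge0]|exact: exp_weight_ge0].
Qed.

Lemma divided_summand_symb r (xi gam : 'I_r.+1 -> R[i]) :
  (forall j, cn (xi j) <= 1) -> (forall j, xi j != 1) ->
  (forall j, direction (gam j)) -> (forall j, 0 < re (gam j)) ->
  forall eps : R, 0 < eps -> geo_symb eps (divided_summand xi gam).
Proof.
move=> x1 x2 gd gp; apply: divided_summand_symb_step => //.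
exact: (@divided_value_symb r (tail xi) (tail gam) (fun j => x1 _) (fun j => x2 _) (fun j => gd _)
  (fun j => gp _)).
Qed.
End PolynomialValues.

(** * Generating functions *)

Section GeneratingFunction.
Context {R : realType} (K M : R) (K1 : 1 <= K) (M0 : 0 <= M).

Local Notation cone := (cone K).
Local Notation direction := (direction K M).

Definition monomial r (t : 'I_r -> R[i]) (n : 'I_r -> nat) : R[i] := \prod_j t j ^+ n j.

Lemma tail_fcons r (p : nat * {ffun 'I_r -> nat}) : tail (fcons p) = p.2 :> ('I_r -> nat).
Proof. by apply/funext => j; rewrite /tail fconsS. Qed.

Lemma monomial_fcons r (t : 'I_r.+1 -> R[i]) p :
  monomial t (fcons p) = t ord0 ^+ p.1 * monomial (tail t) p.2.
Proof.
rewrite /monomial big_ord_recl fcons0; congr (_ * _).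
by apply: eq_bigr => j _; rewrite fconsS.
Qed.

Lemma asummable_multigeo r (x : 'I_r -> R[i]) : (forall j, cn (x j) <= 2^-1) ->
  asummable (fun n : {ffun 'I_r -> nat} => monomial x n) (2 ^+ r).
Proof.
elim: r x => [|r IH] x hx.
  have m0 : {ffun 'I_0 -> nat} by exact: [ffun=> 0%N].
  by have := @asummable_ffun0 R (fun n => monomial x n) m0;
    rewrite {2}/monomial big_ord0 cn1 expr0.
apply: asummable_fcons.
have h : cn (x ord0) < 1 by apply: le_lt_trans (hx _) _; lra.
have := asummable_mul (asummable_geo h) (IH (tail x) (fun j => hx _)).
have -> : (fun p : nat * {ffun 'I_r -> nat} => x ord0 ^+ p.1 * monomial (tail x) p.2) =
    (fun p => monomial x (fcons p)) by apply/funext => p; rewrite monomial_fcons.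
apply: asummable_weaken; rewrite exprS ler_wpM2r ?exprn_ge0 //.
have h2 : 2^-1 <= 1 - cn (x ord0) by have := hx ord0; lra.
rewrite -[leRHS](invrK (2 : R)) lef_pV2 ?posrE ?invr_gt0 //.
by rewrite subr_gt0.
Qed.

(* On [exp (a z)] the difference in direction [g] acts as [exp (g z) - 1], so that
   the Abel series is geometric, with sum [1 / (1 - xi * exp (g z))]. *)
Fixpoint egf_rec r : ('I_r -> R[i]) -> ('I_r -> R[i]) -> ('I_r -> R[i]) -> R[i] :=
  match r with
  | 0 => fun _ _ _ => 1
  | r'.+1 => fun xi gam t =>
      xi ord0 * cexp (gam ord0 * \sum_j t j) / (1 - xi ord0 * cexp (gam ord0 * \sum_j t j)) *
      egf_rec (tail xi) (tail gam) (tail t)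
  end.

Lemma monomial_scale r c (t : 'I_r -> R[i]) n :
  monomial (fun j => c * t j) n = c ^+ nsize n * monomial t n.
Proof.
by rewrite /monomial /nsize expr_sum -big_split; apply: eq_bigr => j _; rewrite exprMn.
Qed.

Lemma geo_symb_term_le r (F : ('I_r -> nat) -> R[i] -> R[i]) (eps rho C tau : R) (t : 'I_r ->
  R[i])
    k (g A : R[i]) : 1 <= rho -> 0 <= C -> 0 <= eps -> direction g -> cone A ->
  (forall n m, symb K M (fun=> eps) m (fun A => C * rho ^+ nsize n * exp_weight tau A) (F n)) ->
  forall n, cn (iter k (fdiff g) (F n) A * monomial t n) <=
    cn (((C * exp_weight tau A)%:C%C * monomial (fun j => rho%:C%C * t j) n) * (eps%:C%C) ^+ k).
Proof.
move=> r1 C0 e0 gd dA hF n; have r0 : 0 <= rho by lra.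
have h := symb_base (symb_iter gd (n := 0) (hF n k)) dA.
rewrite !cnM cnX !cn_real (ger0_norm e0) ger0_norm ?mulr_ge0 ?exp_weight_ge0 //.
rewrite monomial_scale cnM cnX cn_real (ger0_norm r0).
have -> : C * exp_weight tau A * (rho ^+ nsize n * cn (monomial t n)) * eps ^+ k =
  C * rho ^+ nsize n * exp_weight tau A * eps ^+ k * cn (monomial t n) by ring.
by rewrite ler_wpM2r ?cn_ge0.
Qed.

Lemma egf_iter (I : choiceType) (c : I -> R[i]) (F : I -> R[i] -> R[i])
    (L : R[i] -> R[i]) (g : R[i]) : direction g ->
  (forall a, cone a -> has_sum (fun n => F n a * c n) (L a)) ->
  forall k a, cone a -> has_sum (fun n => iter k (fdiff g) (F n) a * c n) (iter k (fdiff g) L a).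
Proof.
move=> gd h; elim=> [|k IH] a da; first exact: h.
have := has_sumB (IH (a + g) (cone_step da gd)) (IH a da).
by congr has_sum; apply/funext => n; rewrite iterS /fdiff mulrBl.
Qed.

Lemma iter_fdiff_exp k (g z : R[i]) c a :
  iter k (fdiff g) (fun a => cexp (a * z) * c) a = (cexp (g * z) - 1) ^+ k * (cexp (a * z) * c).
Proof.
elim: k a => [|k IH] a; first by rewrite expr0 mul1r.
by rewrite iterS /fdiff !IH mulrDl cexpD exprS; ring.
Qed.

(** The radius d is independent of the offset A: the Abel series evaluates the inner generating
    function at all translates of A by multiples of gam. *)
Lemma egf r (xi gam : 'I_r -> R[i]) :
  (forall j, cn (xi j) <= 1) -> (forall j, xi j != 1) ->
  (forall j, direction (gam j)) -> (forall j, 0 < re (gam j)) ->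
  exists2 d : R, 0 < d & forall t, (forall j, cn (t j) <= d) -> forall A, cone A ->
    (exists B, asummable (fun n : {ffun 'I_r -> nat} => divided_value xi gam n A * monomial t n) B) /\
    has_sum (fun n : {ffun 'I_r -> nat} => divided_value xi gam n A * monomial t n)
      (cexp (A * \sum_j t j) * egf_rec xi gam t).
Proof.
elim: r xi gam => [|r IH] xi gam x1 x2 gd gp.
  exists 1 => // t _ A dA; have m0 : {ffun 'I_0 -> nat} by exact: [ffun=> 0%N].
  pose x (n : {ffun 'I_0 -> nat}) : R[i] := divided_value xi gam n A * monomial t n.
  split; first by exists (cn (x m0)); exact: asummable_ffun0.
  have := @has_sum_ffun0 R x m0; rewrite {2}/x /monomial !big_ord0 mulr0 cexp0.
  exact.
have [d' d'0 hIH] := IH (tail xi) (tail gam)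
  (fun j => x1 _) (fun j => x2 _) (fun j => gd _) (fun j => gp _).
set x0 := xi ord0; set g := gam ord0.
have gd0 : direction g := gd _; have gp0 : 0 < re g := gp _.
have x10 : cn x0 <= 1 := x1 _; have x20 : x0 != 1 := x2 _.
have q0 : 0 <= abel_ratio x0 by exact: cn_ge0.
pose e1 : R := (2 * (abel_ratio x0 + 1))^-1.
have q1 : 0 < 2 * (abel_ratio x0 + 1) by rewrite mulr_gt0 // ltr_wpDl.
have e10 : 0 < e1 by rewrite invr_gt0.
have [rho [C [tau [r1 C0 t0 hG]]]] := divided_summand_symb K1 M0 x1 x2 gd gp e10.
have [rho' [C' [tau' [r1' C0' t0' hh]]]] :=
  divided_value_symb K1 M0 x1 x2 gd gp (ltr01 : 0 < 1 :> R).
(* Bound for |g T| that makes the column series converge: with |exp z - 1| <= 2 |z| exp |z|, the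
   ratio is at most abel_ratio / (2 (abel_ratio + 1)) < 1. *)
pose eta : R := (4 * expR 1 * (abel_ratio x0 + 1))^-1.
have ee : 1 <= expR (1 : R) by have := expR_ge1Dx (1 : R); lra.
have eta0' : 0 < eta by rewrite invr_gt0 !mulr_gt0 ?expR_gt0 // ltr_wpDl.
pose d3 : R := eta / ((cn g + 1) * r.+1%:R).
have g1 : 0 < cn g + 1 by rewrite ltr_wpDl // cn_ge0.
have d30 : 0 < d3 by rewrite divr_gt0 // mulr_gt0.
have rp : 0 < rho by lra.
have rp' : 0 < rho' by lra.
(* The four bounds serve, in order, the induction hypothesis, |g T| <= eta, the majorant of the
   double series and the majorant of the series of values. *)
pose d := Num.min (Num.min d' d3) (Num.min (2 * rho)^-1 (2 * rho')^-1).
exists d; first by rewrite !lt_min d'0 d30 !invr_gt0 !mulr_gt0.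
move=> t ht A dA.
have [ht1 [ht2 [ht3 ht4]]] : (forall j, cn (t j) <= d') /\ (forall j, cn (t j) <= d3) /\
    (forall j, rho * cn (t j) <= 2^-1) /\ (forall j, rho' * cn (t j) <= 2^-1).
  have hd j : [/\ cn (t j) <= d', cn (t j) <= d3, cn (t j) <= (2 * rho)^-1 &
      cn (t j) <= (2 * rho')^-1].
    by have := ht j; rewrite !le_min => /andP[/andP[-> ->] /andP[-> ->]].
  have aux (p : R) j : 0 < p -> cn (t j) <= (2 * p)^-1 -> p * cn (t j) <= 2^-1.
    by move=> p0; rewrite invfM -ler_pdivlMl // mulrC.
  by split; [|split; [|split]] => j; have [h1 h2 h3 h4] := hd j => //; exact: aux.
have geo (p : R) : 0 < p -> (forall j, p * cn (t j) <= 2^-1) ->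
    asummable (fun n : {ffun 'I_r.+1 -> nat} => monomial (fun j => p%:C%C * t j) n) (2 ^+ r.+1).
  by move=> p0 divided_value; apply: asummable_multigeo => j; rewrite cnM cn_real gtr0_norm.
split.
  exists (cn (C' * exp_weight tau' A)%:C%C * 2 ^+ r.+1).
  apply: asummable_le (asummableZ (C' * exp_weight tau' A)%:C%C (geo rho' rp' ht4)) => n.
  have := geo_symb_term_le t 0 r1' C0' ler01 gd0 dA hh n.
  by rewrite expr0 mulr1.
set T := \sum_j t j.
pose GG a := cexp (a * T) * (cexp (g * T) * egf_rec (tail xi) (tail gam) (tail t)).
have hGG a : cone a -> has_sum (fun n : {ffun 'I_r.+1 -> nat} => divided_summand xi gam n a * monomial t n) (GG a).
  move=> da; have dag := cone_step da gd0.
  have [[B hB] hs] := hIH (tail t) (fun j => ht1 _) (a + g) dag.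
  have [B' hB'] := asummable_exp ((a + g) * t ord0).
  have := has_sum_mul hB' hB (has_sum_exp _) hs.
  have -> : cexp ((a + g) * t ord0) * (cexp ((a + g) * \sum_j tail t j) * egf_rec (tail xi) (tail gam) (tail t)) = GG a.
    rewrite /GG /T big_ord_recl !mulrA -!cexpD; congr (cexp _ * _).
    by rewrite /tail; ring.
  move=> h; apply: has_sum_fcons; move: h; congr has_sum; apply/funext => p.
  rewrite monomial_fcons /divided_summand fcons0 tail_fcons /divided_pow /translate -/g exprMn;
    ring.
(* Double series over degrees n and orders of differences k. A row is a finite Abel series and gives
   a value; a column is a k-th difference of the exponential [GG], hence geometric in k. *)
pose X (p : {ffun 'I_r.+1 -> nat} * nat) : R[i] :=
  x0 * abel_coef x0 p.2 * (iter p.2 (fdiff g) (divided_summand xi gam p.1) A * monomial t p.1).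
have qe : cn (x0 / (1 - x0) * e1%:C%C) <= 2^-1.
  rewrite cnM cn_real gtr0_norm // -/(abel_ratio x0) /e1 ler_pdivrMr // mulrA mulVf ?mul1r.
    by rewrite lerDl.
  by rewrite pnatr_eq0.
have qe1 : cn (x0 / (1 - x0) * e1%:C%C) < 1 by apply: le_lt_trans qe _; lra.
have aX : exists B, asummable X B.
  have h1 := asummableZ (C * exp_weight tau A)%:C%C (geo rho rp ht3).
  have h2 := asummableZ ((1 - x0)^-1) (asummable_geo qe1).
  have h3 := asummableZ x0 (asummable_mul h1 h2).
  eexists; apply: asummable_le h3 => -[n k] /=.
  have := geo_symb_term_le t k r1 C0 (ltW e10) gd0 dA hG n.
  set b := cn (_ * _ * _) => h.
  have -> : cn (x0 * ((C * exp_weight tau A)%:C%C * monomial (fun j => rho%:C%C * t j) n *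
      ((1 - x0)^-1 * (x0 / (1 - x0) * e1%:C%C) ^+ k))) = cn x0 * cn (abel_coef x0 k) * b.
    rewrite /b -!cnM; congr cn; rewrite /abel_coef exprMn [(x0 / (1 - x0)) ^+ k]exprMn exprVn exprS invfM; ring.
  rewrite /X /= cnM [cn (x0 * _)]cnM; apply: ler_wpM2l => //.
  by rewrite mulr_ge0 // cn_ge0.
have [B hB] := aX; have [L hL] := asummable_has_sum hB.
have hrow (n : {ffun 'I_r.+1 -> nat}) :
  has_sum (fun k => X (n, k)) (divided_value xi gam n A * monomial t n).
  have [dd hdd] := nilpotent_diff_divided_summand n x1 x2 gd.
  have := has_sumZ (x0 * monomial t n) (tsum_nilpotent_diff_has_sum x10 x20 gd0 hdd dA).
  have -> : x0 * monomial t n * tsum x0 g (divided_summand xi gam n) A = divided_value xi gam n A * monomial t n.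
    by rewrite /= -/x0 -/g -/(divided_summand xi gam n); ring.
  by congr has_sum; apply/funext => k; rewrite /X /= -/g; ring.
have hcol k : has_sum (fun n => X (n, k)) (x0 * abel_coef x0 k * ((cexp (g * T) - 1) ^+ k * GG A)).
  have := has_sumZ (x0 * abel_coef x0 k) (egf_iter gd0 hGG k dA).
  by rewrite (iter_fdiff_exp k g T (cexp (g * T) * egf_rec (tail xi) (tail gam) (tail t)) A).
have gT : cn (g * T) <= eta.
  rewrite cnM; apply: (@le_trans _ _ (cn g * (r.+1%:R * d3))).
    rewrite ler_wpM2l ?cn_ge0 //; apply: (le_trans (cn_sum _ _ _)).
    apply: (@le_trans _ _ (\sum_(j < r.+1) d3)); first by apply: ler_sum => j _; exact: ht2.
    by rewrite sumr_const card_ord mulr_natl.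
  have -> : cn g * (r.+1%:R * d3) = cn g / (cn g + 1) * eta.
    rewrite /d3; have n0 : r.+1%:R != 0 :> R by rewrite pnatr_eq0.
    by move: (r.+1%:R : R) n0 => a a0; field; rewrite gt_eqF.
  by rewrite ler_piMl ?(ltW eta0') // ler_pdivrMr // mul1r lerDl.
have eta1 : eta <= 1.
  rewrite invf_le1 ?mulr_gt0 ?expR_gt0 // ?ltr_wpDl //.
  have : 1 <= expR 1 * (abel_ratio x0 + 1) :> R by rewrite -[leLHS]mulr1 ler_pM // lerDr.
  by rewrite -mulrA; lra.
pose y := x0 / (1 - x0) * (cexp (g * T) - 1).
have y1 : cn y < 1.
  rewrite /y cnM -/(abel_ratio x0).
  apply: (@le_lt_trans _ _ (abel_ratio x0 * (2 * (eta * expR 1)))).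
    rewrite ler_wpM2l //; apply: (le_trans (cexp_sub1 _)).
    rewrite ler_wpM2l //; apply: ler_pM; rewrite ?cn_ge0 ?expR_ge0 //.
    by rewrite ler_expR (le_trans gT).
  have -> : abel_ratio x0 * (2 * (eta * expR 1)) = abel_ratio x0 / (2 * (abel_ratio x0 + 1)).
    by rewrite /eta; field; rewrite !gt_eqF // ?ltr_wpDl // expR_gt0.
  by rewrite ltr_pdivrMr // mul1r; lra.
have hsum := has_sum_fubini (has_sum_swap hL) hcol.
have hgeo := has_sumZ (x0 / (1 - x0) * GG A) (has_sum_geo y1).
have LE : L = x0 / (1 - x0) * GG A * (1 - y)^-1.
  apply: has_sum_uniq hsum _; move: hgeo; congr has_sum; apply/funext => k.
  by rewrite /y /abel_coef [in LHS]exprMn [(x0 / _) ^+ k]exprMn exprVn exprS invfM; ring.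
have := has_sum_fubini hL hrow; congr has_sum; rewrite LE.
have z0 := one_sub_neq0 x20.
have y0 : 1 - y != 0 by apply/eqP => /subr0_eq e; move: y1; rewrite -e cn1 ltxx.
(* This identity turns the sum of the geometric series into the closed form of [egf_rec]. *)
have e2 : (1 - x0) * (1 - y) = 1 - x0 * cexp (g * T) by rewrite /y; field.
rewrite [egf_rec _ _ _]/= -/x0 -/g -/T -e2 /GG; field.
by rewrite z0 y0.
Qed.
End GeneratingFunction.

(** * Uniqueness of coefficients and Bernoulli numbers *)

Section PowerSeriesUniqueness.
Context {R : realType}.

(** Outside a finite set A that controls the sum up to 1, a term is the difference of two partial
    sums, both within 1 of the limit. *)
Lemma has_sum_bounded (I : choiceType) (x : I -> R[i]) l : has_sum x l ->
  exists B, forall i, cn (x i) <= B.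
Proof.
move=> /(_ 1 ltr01) [A hA]; exists (2 + \sum_(i <- A) cn (x i)) => i.
have s0 (A' : {fset I}) : 0 <= \sum_(i <- A') cn (x i).
  by apply: sumr_ge0 => j _; exact: cn_ge0.
case: (boolP (i \in A)) => iA.
  rewrite (big_fsetD1 i iA) /=; have := s0 (A `\ i)%fset; lra.
have h1 := hA A (fsubset_refl _); have h2 := hA (i |` A)%fset (fsubsetUr _ _).
rewrite big_fsetU1 //= in h2; set S := \sum_(j <- A) x j in h1 h2.
have -> : x i = (x i + S - l) - (S - l) by ring.
by apply: (le_trans (cnB _ _)); have := s0 A; lra.
Qed.

(** The terms b_n d^n are bounded by some B, so at z = q d the terms of positive degree add up to at
    most B q / (1 - q), which tends to 0 with q. The centre is excluded for the sake of the division
    by z in [coef_univariate_eq0]. *)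
Lemma coef_const_eq0 (b : nat -> R[i]) (d : R) : 0 < d ->
  (forall z, 0 < cn z <= d -> has_sum (fun n => b n * z ^+ n) 0) -> b 0%N = 0.
Proof.
move=> d0 h; have dc : cn (d%:C%C : R[i]) = d by rewrite cn_real gtr0_norm.
have [B hB] : exists B, forall n, cn (b n * (d%:C%C) ^+ n) <= B.
  by apply: has_sum_bounded; apply: h; rewrite dc d0 lexx.
have B0 : 0 <= B := le_trans (cn_ge0 _) (hB 0%N).
apply/eqP; rewrite -cn_eq0; apply/eqP/le_anti; rewrite cn_ge0 andbT.
apply/ler_addgt0Pr => e e0; rewrite add0r.
(* Then B q <= e / 2 <= e (1 - q). *)
pose q := Num.min (2^-1) (e / (2 * (B + 1))).
have B1 : 0 < 2 * (B + 1) by rewrite mulr_gt0 // ltr_wpDl.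
have q0 : 0 < q by rewrite lt_min invr_gt0 divr_gt0 // ltr0n.
have q2 : q <= 2^-1 by rewrite ge_min lexx.
have qe : q <= e / (2 * (B + 1)) by rewrite ge_min lexx orbT.
pose z : R[i] := (q * d)%:C%C.
have zc : cn z = q * d by rewrite cn_real gtr0_norm // mulr_gt0.
have hz : has_sum (fun n => b n * z ^+ n) 0.
  apply: h; rewrite zc mulr_gt0 //= ler_piMl ?(ltW d0) //; lra.
have hq : cn (q%:C%C : R[i]) < 1 by rewrite cn_real gtr0_norm //; lra.
have zE n : b n * z ^+ n = (b n * (d%:C%C) ^+ n) * (q%:C%C) ^+ n.
  by rewrite /z rmorphM exprMn; ring.
have a1 : asummable (fun n => b n * z ^+ n) (cn (B%:C%C : R[i]) * (1 - cn (q%:C%C : R[i]))^-1).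
  apply: asummable_le (asummableZ B%:C%C (asummable_geo hq)) => n.
  by rewrite zE !cnM cn_real (ger0_norm B0) -cnM ler_wpM2r // cn_ge0.
have a2 : asummable (fun n => b n.+1 * z ^+ n.+1)
    (cn ((B * q)%:C%C : R[i]) * (1 - cn (q%:C%C : R[i]))^-1).
  apply: asummable_le (asummableZ (B * q)%:C%C (asummable_geo hq)) => n.
  rewrite zE [(q%:C%C) ^+ n.+1]exprS [_ * (q%:C%C * _)]mulrA !cnM cn_real (gtr0_norm q0) -cnM.
  rewrite cn_real (ger0_norm (mulr_ge0 B0 (ltW q0))) ler_wpM2r ?cn_ge0 //.
  by rewrite ler_wpM2r // ltW.
have [l hl] := asummable_has_sum a2.
have := has_sum_uniq hz (has_sum_shift a1 hl); rewrite expr0 mulr1 => e1.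
have -> : b 0%N = - l by apply/eqP; rewrite -addr_eq0 -e1.
rewrite cnN; apply: (le_trans (has_sum_le a2 hl)).
rewrite !cn_real (gtr0_norm q0) (ger0_norm (mulr_ge0 B0 (ltW q0))).
have q1 : 0 < 1 - q by lra.
rewrite ler_pdivrMr //.
have h3 : (B + 1) * q <= e / 2.
  have := ler_wpM2l (ltW B1) qe; rewrite mulrCA mulfV ?gt_eqF // mulr1; lra.
have h4 : e * q <= e * 2^-1 by rewrite ler_wpM2l // ltW.
lra.
Qed.

Lemma has_sum_behead (x : nat -> R[i]) l : has_sum x l ->
  has_sum (fun n => x n.+1) (l - x 0%N).
Proof.
move=> h e e0; have [A hA] := h e e0.
exists [fset n.-1 | n in A]%fset => B sB.
have := hA (0%N |` [fset n.+1 | n in B])%fset _.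
rewrite big_fsetU1; last by apply/imfsetP => -[].
rewrite big_imfset /=; last by move=> i j _ _ [].
move=> k; have -> : \sum_(i <- B) x i.+1 - (l - x 0%N) = x 0%N + \sum_(i <- B) x i.+1 - l.
  by ring.
apply: k; apply/fsubsetP => -[|n] nA; rewrite !inE //=.
apply/imfsetP; exists n => //=; apply: (fsubsetP sB).
by apply/imfsetP; exists n.+1.
Qed.

Lemma coef_univariate_eq0 (b : nat -> R[i]) (d : R) : 0 < d ->
  (forall z, 0 < cn z <= d -> has_sum (fun n => b n * z ^+ n) 0) -> forall n, b n = 0.
Proof.
move=> d0 h n; elim: n b h => [|n IH] b h; first exact: coef_const_eq0 d0 h.
have b0 := coef_const_eq0 d0 h.
apply: (IH (fun n => b n.+1)) => z hz.
have z0 : z != 0 by rewrite -cn_gt0; case/andP: hz.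
have := has_sumZ z^-1 (has_sum_behead (h z hz)).
rewrite expr0 mulr1 b0 subr0 mulr0; congr has_sum; apply/funext => k.
by rewrite exprS; field.
Qed.

(** With the other variables frozen, the row sums are the coefficients of a power series in the
    first variable. They vanish, and each row is then a series in r variables with sum 0. *)
Lemma coef_eq0 r (c : {ffun 'I_r -> nat} -> R[i]) (d : R) : 0 < d ->
  (forall t : 'I_r -> R[i], (forall j, cn (t j) <= d) ->
    has_sum (fun n : {ffun 'I_r -> nat} => c n * monomial t n) 0) -> forall n, c n = 0.
Proof.
elim: r c d => [|r IH] c d d0 h n.
  have := h (fun=> 0) (fun=> _); rewrite cn0 => /(_ (fun=> ltW d0)) h0.
  have := has_sum_uniq h0 (@has_sum_ffun0 R (fun n => c n * monomial (fun=> 0) n) n).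
  by rewrite /monomial big_ord0 mulr1 => <-.
have dc : cn (d%:C%C : R[i]) = d by rewrite cn_real gtr0_norm.
have [B hB] : exists B, forall n : {ffun 'I_r.+1 -> nat},
  cn (c n * monomial (fun=> d%:C%C) n) <= B.
  by apply: has_sum_bounded; apply: h => j; rewrite dc.
have d2 : 0 < d / 2 by rewrite divr_gt0.
(* Bounded terms at radius d give a geometric majorant at radius d / 2; the induction therefore
   halves the radius. *)
have as1 (t : 'I_r.+1 -> R[i]) : (forall j, cn (t j) <= d / 2) ->
    asummable (fun n : {ffun 'I_r.+1 -> nat} => c n * monomial t n) (cn (B%:C%C : R[i]) * 2 ^+ r.+1).
  move=> ht; pose t' j := (d%:C%C)^-1 * t j.
  have ht' j : cn (t' j) <= 2^-1.
    by rewrite cnM cnV dc ler_pdivrMl //; exact: ht.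
  apply: asummable_le (asummableZ B%:C%C (asummable_multigeo ht')) => m.
  have -> : c m * monomial t m = (c m * monomial (fun=> d%:C%C) m) * monomial t' m.
    rewrite -mulrA; congr (_ * _); rewrite /monomial -big_split /=; apply: eq_bigr => j _.
    rewrite -exprMn /t' mulrA mulfV ?mul1r //.
    by rewrite -cn_gt0 dc.
  rewrite cnM [leRHS]cnM ler_wpM2r ?cn_ge0 // cn_real.
  exact: le_trans (hB m) (ler_norm _).
have row a : forall m : {ffun 'I_r -> nat}, c (fcons (a, m)) = 0.
  apply: (IH _ (d / 2) d2) => t ht.
  pose tt (z : R[i]) (j : 'I_r.+1) := if unlift ord0 j is Some j' then t j' else z.
  have tt0 z : tt z ord0 = z by rewrite /tt unlift_none.
  have ttS z : tail (tt z) = t by apply/funext => j; rewrite /tail /tt liftK.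
  have htt z : cn z <= d / 2 -> forall j, cn (tt z j) <= d / 2.
    by move=> hz j; rewrite /tt; case: unliftP.
  have d2c : cn ((d / 2)%:C%C : R[i]) <= d / 2 by rewrite cn_real gtr0_norm.
  have dn0 : (d / 2)%:C%C != 0 :> R[i] by rewrite -cn_gt0 cn_real gtr0_norm.
  (* Each row is a part of an absolutely convergent series in which the first variable is d / 2; the
     nonzero factor (d / 2)^k is divided out. *)
  have inner k : exists l, has_sum (fun m : {ffun 'I_r -> nat} => c (fcons (k, m)) * monomial t m) l.
    have h1 := asummable_row k (asummable_fsplit (as1 _ (htt _ d2c))).
    have [l hl] := asummable_has_sum h1.
    exists (((d / 2)%:C%C ^+ k)^-1 * l).
    have := has_sumZ ((d / 2)%:C%C ^+ k)^-1 hl; congr has_sum; apply/funext => m.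
    rewrite monomial_fcons ttS tt0 /=; field; exact: expf_neq0.
  have [b hb] : exists b : nat -> R[i], forall k,
      has_sum (fun m : {ffun 'I_r -> nat} => c (fcons (k, m)) * monomial t m) (b k).
    by exists (fun k => projT1 (cid (inner k))) => k; exact: (projT2 (cid (inner k))).
  suff b0 : forall k, b k = 0 by rewrite -(b0 a); exact: hb.
  apply: (coef_univariate_eq0 d2) => z /andP[z0 zd].
  have hz : has_sum (fun n : {ffun 'I_r.+1 -> nat} => c n * monomial (tt z) n) 0.
    by apply: h => j; apply: le_trans (htt z zd j) _; lra.
  apply: has_sum_fubini (has_sum_fsplit hz) _ => k.
  have := has_sumZ (z ^+ k) (hb k); rewrite mulrC; congr has_sum; apply/funext => m.
  by rewrite monomial_fcons ttS tt0 /= mulrCA.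
by rewrite -[n]fsplitK; exact: row.
Qed.
End PowerSeriesUniqueness.

(** * Identification of the values with Bernoulli numbers *)

Section Bernoulli.
Context {R : realType}.

Lemma near0_coordP r (P : 'rV[R[i]]_r -> Prop) :
  (\forall t \near (0 : 'rV[R[i]]_r), P t) <->
  exists2 d : R, 0 < d & forall t : 'rV[R[i]]_r, (forall j, cn (t 0 j) <= d) -> P t.
Proof.
split.
- move=> /nbhs_normP [e /= /eps_real [e0 eE] he].
  exists (re e / 2) => [|t ht]; first by rewrite divr_gt0.
  apply: he; rewrite /ball_ /= sub0r normrN.
  have [->|tn0] := eqVneq t 0; first by rewrite normr0 eE ltcR.
  have tm : mx_norm t != 0 by apply/eqP => /mx_norm_eq0 /eqP; rewrite (negbTE tn0).
  have [[i j] e2] := mx_norm_neq0 tm.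
  rewrite /Num.norm /= e2 (ord1 i) /= normE eE ltcR.
  by apply: (le_lt_trans (ht j)); lra.
- move=> [d d0 h]; apply/nbhs_normP; exists d%:C%C => /=; first by rewrite ltcR.
  move=> t; rewrite /ball_ /= sub0r normrN => td; apply: h => j.
  apply: (le_trans (cn_coord_le t j)); apply: ltW; rewrite -ltcR RRe_real //.
Qed.

Lemma bernoulli_expansionP r (xi gam : 'I_r -> R[i]) B :
  bernoulli_expansion xi gam B <->
  exists2 d : R, 0 < d & forall t : 'rV[R[i]]_r, (forall j, cn (t 0 j) <= d) ->
    has_sum (bernoulli_term B t) (bernoulli_gen xi gam t).
Proof.
rewrite /bernoulli_expansion near0_coordP.
by split=> -[d d0 h]; exists d => // t /h /has_sumP.
Qed.

Definition egf_prod r (xi gam t : 'I_r -> R[i]) : R[i] :=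
  \prod_(j < r) (1 / (1 - (xi j)^-1 * cexp (gam j * \sum_(k < r | (j <= k)%N) t k))).

(* [xi w / (1 - xi w) = - 1 / (1 - (xi w)^-1)] *)
Lemma egf_prod_rec r (xi gam t : 'I_r -> R[i]) : (forall j, xi j != 0) ->
  egf_prod xi gam t = (-1) ^+ r * egf_rec xi gam (fun j => - t j).
Proof.
elim: r xi gam t => [|r IH] xi gam t xn0; first by rewrite /egf_prod big_ord0 mulr1.
rewrite /egf_prod big_ord_recl.
have -> : \prod_(i < r) (1 / (1 - (xi (lift ord0 i))^-1 *
    cexp (gam (lift ord0 i) * \sum_(k < r.+1 | (lift ord0 i <= k)%N) t k))) =
    egf_prod (tail xi) (tail gam) (tail t).
  apply: eq_bigr => j _; rewrite /tail; congr (1 / (1 - _ * cexp (_ * _))).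
  have f0 : (lift ord0 j <= (ord0 : 'I_r.+1))%N = false by rewrite lift0.
  rewrite big_mkcond big_ord_recl f0 Monoid.mul1m [RHS]big_mkcond.
  by apply: eq_bigr => k _; rewrite !lift0 ltnS.
rewrite IH; last by move=> j; exact: xn0.
rewrite exprS /= -[fun j : 'I_r => - tail t j]/(tail (fun j => - t j)).
rewrite sumrN mulrN cexpN; set E := cexp _.
have E0 : E != 0 by exact: cexp_neq0.
set x := xi ord0; have x0 : x != 0 := xn0 _.
suff -> : 1 / (1 - x^-1 * E) = - (x * E^-1 / (1 - x * E^-1)) by ring.
(* The two denominators vanish together, and both sides are then 0 because the inverse of 0 is 0;
   the identity thus holds for every t. *)
have [e|ne] := eqVneq (1 - x * E^-1) 0.
  have -> : 1 - x^-1 * E = 0.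
    have e2 : x * E^-1 = 1 by apply/esym/eqP; rewrite -subr_eq0 e.
    by rewrite -[x^-1 * E]invrK invfM invrK e2 invr1 subrr.
  by rewrite e invr0 !mulr0 oppr0.
have ne2 : E - x != 0.
  by apply: contra_neq ne => /subr0_eq <-; rewrite mulfV // subrr.
field.
by rewrite x0 E0 ne2 -(opprB E x) oppr_eq0 ne2.
Qed.

Lemma twisted_bernoulli_eq r (xi gam : 'I_r -> R[i]) B :
  bernoulli_expansion xi gam B -> twisted_bernoulli xi gam = B.
Proof.
move=> hB; have hG : bernoulli_expansion xi gam (twisted_bernoulli xi gam).
  by apply: (@getPex _ (bernoulli_expansion xi gam)); exists B.
move: hB hG => /bernoulli_expansionP [d d0 h] /bernoulli_expansionP [d' d'0 h'].
set G := twisted_bernoulli xi gam in h' *.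
have m0 : 0 < Num.min d d' by rewrite lt_min d0 d'0.
apply/funext => n; apply/eqP; rewrite -subr_eq0.
have key := @coef_eq0 _ r (fun n => (G n - B n) / nfact n) _ m0.
have nf : nfact n != 0 :> R[i].
  by rewrite /nfact prodf_seq_neq0; apply/allP => j _; rewrite fact_neq0.
suff /eqP : (G n - B n) / nfact n = 0 by rewrite mulf_eq0 invr_eq0 (negbTE nf) orbF.
apply: key => t ht.
have ht1 j : cn ((\row_j t j) 0 j) <= d by rewrite mxE; move: (ht j); rewrite le_min => /andP[].
have ht2 j : cn ((\row_j t j) 0 j) <= d' by rewrite mxE; move: (ht j); rewrite le_min => /andP[].
have := has_sumB (h' _ ht2) (h _ ht1); rewrite subrr; congr has_sum; apply/funext => m.
rewrite /bernoulli_term -mulrBl -mulrA; congr (_ * _).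
under eq_bigr do rewrite mxE.
by rewrite big_split /= prodfV mulrC.
Qed.

(** The signed values themselves are shown to satisfy [bernoulli_expansion]. This yields the
    existence of the expansion, so that [get] is meaningful, and the formula by uniqueness; the sign
    squares to 1. *)
Lemma bernoulli_values (K M : R) (K1 : 1 <= K) (M0 : 0 <= M) r (xi gam : 'I_r -> R[i]) :
  (forall j, cn (xi j) <= 1) -> (forall j, xi j != 1) -> (forall j, xi j != 0) ->
  (forall j, direction K M (gam j)) -> (forall j, 0 < re (gam j)) ->
  forall n : {ffun 'I_r -> nat}, zeta_ext xi gam (fun j => - (n j)%:R) 0 =
    (-1) ^+ (r + \sum_(j < r) n j) * twisted_bernoulli (fun j => (xi j)^-1) gam n.
Proof.
move=> x1 x2 xn0 gd gp n.
pose B (n : {ffun 'I_r -> nat}) : R[i] :=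
  (-1) ^+ (r + \sum_(j < r) n j) * (nfact n * divided_value xi gam n 0).
have -> : twisted_bernoulli (fun j => (xi j)^-1) gam = B.
  apply: twisted_bernoulli_eq; apply/bernoulli_expansionP.
  have [d d0 h] := egf K1 M0 x1 x2 gd gp; exists d => // t ht.
  have ht' j : cn (- t 0 j) <= d by rewrite cnN.
  have [_ hs] := h (fun j => - t 0 j) ht' 0 (cone0 K).
  have := has_sumZ ((-1) ^+ r) hs; rewrite mul0r cexp0 mul1r -egf_prod_rec //.
  congr has_sum; apply/funext => m; rewrite /bernoulli_term /B exprD.
  have -> : monomial (fun j => - t 0 j) m = (-1) ^+ (\sum_(j < r) m j) * monomial (fun j => t 0 j) m.
    by rewrite -monomial_scale; congr monomial; apply/funext => j; rewrite mulN1r.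
  have -> : \prod_(j < r) (t 0 j ^+ m j / (m j)`!%:R) = monomial (fun j => t 0 j) m / nfact m.
    by rewrite big_split /= prodfV.
  have nf : nfact m != 0 :> R[i].
    by rewrite /nfact prodf_seq_neq0; apply/allP => j _; rewrite fact_neq0.
  by field.
rewrite /B mulrA -exprD addnn -mul2n exprM sqrrN expr1n expr1n mul1r.
exact: (zeta_ext_neg K1 n x1 x2 gd gp (cone0 K)).
Qed.

Lemma root_of_unity_cn (z : R[i]) : is_root_of_unity z -> cn z = 1.
Proof.
move=> [n n0]; rewrite /root_of_unity /root !hornerE => /eqP /subr0_eq h.
have : cn z ^+ n = 1 by rewrite -cnX h cn1.
by move/eqP; rewrite pexpr_eq1 ?cn_ge0 // -?lt0n // => /eqP.
Qed.

Lemma sum_has_sum (I : choiceType) (x : I -> R[i]) l :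
  has_sum x l -> summability.sum x = l.
Proof.
move=> /has_sumP h; apply: (@cvg_lim _ _ _ _ (summability.totally_filter) _ _ h).
exact: norm_hausdorff.
Qed.
End Bernoulli.

Unset Implicit Arguments.

Theorem theorem1p13 (R : realType) (r : nat) (xi gamma : 'I_r -> R[i])
    (r_gt0 : (0 < r)%N)
    (xi_root : forall j, is_root_of_unity (xi j))
    (gamma_pos : forall j, 0 < complex.Re (gamma j))
    (xi_neq1 : forall j, xi j != 1) :
  exists F : 'rV[R[i]]_r -> R[i],
    [/\ entire F,
        (forall s, zeta_domain s -> F s = zeta xi gamma s) &
        forall n : {ffun 'I_r -> nat},
          F (\row_j - (n j)%:R) =
          (-1) ^+ (r + \sum_(j < r) n j) *
            twisted_bernoulli (fun j => (xi j)^-1) gamma n].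
Proof.
have x1 j : cn (xi j) <= 1 by rewrite (root_of_unity_cn (xi_root j)).
have x0 j : xi j != 0 by rewrite -cn_gt0 (root_of_unity_cn (xi_root j)).
(* The sums in K and M dominate each of their terms, so one sector and one bound on steps serve all
   the gamma_j. *)
pose K : R := 1 + \sum_j cn (gamma j) / re (gamma j).
pose M : R := \sum_j re (gamma j).
have c0 j : 0 <= cn (gamma j) / re (gamma j) by rewrite divr_ge0 ?cn_ge0 // ltW.
have K1 : 1 <= K by rewrite lerDl sumr_ge0.
have M0 : 0 <= M by rewrite sumr_ge0 // => j _; exact: ltW.
have gd j : direction K M (gamma j).
  apply/andP; split.
    rewrite /cone -ler_pdivrMr // /K (bigD1 j) //= addrCA lerDl addr_ge0 //.
    by rewrite sumr_ge0.
  by rewrite /M (bigD1 j) //= lerDl sumr_ge0 // => i _; exact: ltW.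
exists (fun s => zeta_ext xi gamma (fun j => s 0 j) 0); split.
- exact: (zeta_ext_entire K1 M0 x1 xi_neq1 gd gamma_pos).
- move=> s sD; apply/esym/sum_has_sum.
  have hs k : (1 <= k <= r)%N -> k%:R < \sum_(j < r | (r - k <= j)%N) re (s 0 j).
    by move=> /sD; rewrite re_sum.
  have [_ /(_ 0 (cone0 K))] := zeta_sum K1 x1 xi_neq1 gd gamma_pos hs.
  congr has_sum; apply/funext => m; rewrite /offset_zeta_term /zeta_term.
  by apply: eq_bigr => j _; rewrite add0r.
- move=> n; rewrite -(bernoulli_values K1 M0 x1 xi_neq1 x0 gd gamma_pos).
  by congr (zeta_ext _ _ _ _); apply/funext => j; rewrite mxE.
Qed.
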